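(* Let $(R,\mathfrak m)$ be a local ring of finite embedding dimension. The following numbers are all equal: (i) the geometric dimension $d$ of $R$; (ii) the least possible number of elements generating an $\mathfrak m$-primary ideal; (iii) the (Krull) dimension of the completion $\widehat R$ of $R$; (iv) the (Krull) dimension of the graded ring $\operatorname{gr}(R)=\bigoplus_n\mathfrak m^n/\mathfrak m^{n+1}$ associated to $R$; (v) the degree of the Hilbert-Samuel polynomial $\operatorname{HS}_R$, where $\operatorname{HS}_R$ is the unique polynomial with rational coefficients for which $\operatorname{HS}_R(n)$ equals the length of $R/\mathfrak m^n$ for all large $n$; (vi) the geometric dimension of the separated quotient $R_{\mathrm{sep}}$ of $R$.
   Context: A local ring is a (not necessarily Noetherian) commutative ring with a unique maximal ideal; its embedding dimension is the minimal number of generators of its maximal ideal. The geometric dimension $\operatorname{gdim}(R)$ of a local ring $(R,\mathfrak m)$ is defined recursively: $\operatorname{gdim}(R)=0$ if and only if $R$ is Artinian; $\operatorname{gdim}(R)\leq d$ if there is $x\in\mathfrak m$ with $\operatorname{gdim}(R/xR)\leq d-1$; $\operatorname{gdim}(R)=d$ if $\operatorname{gdim}(R)\leq d$ but not $\operatorname{gdim}(R)\leq d-1$; and $\operatorname{gdim}(R)=\infty$ if no such $d$ exists. The completion $\widehat R$ is the inverse limit of the $R/\mathfrak m^n$, and $R_{\mathrm{sep}}:=R/\bigcap_n\mathfrak m^n$. *)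

(* Defs.v *)
From HB Require Import structures.
From mathcomp Require Import all_boot all_order all_algebra.
From mathcomp Require Import boolp.
Set Implicit Arguments.
Unset Strict Implicit.
Unset Printing Implicit Defensive.
Import GRing.Theory.
Local Open Scope ring_scope.
Local Open Scope quotient_scope.

(** Conventions.  [idealr R] is the library's type of proper ideals of [R] and
    [prime_idealr R] its type of prime ideals; a possibly improper ideal is a
    submodule of the regular module [R^o], that is, [submodClosed R^o].  The
    library only provides the quotient ring [{ideal_quot I}] by a proper ideal
    [I], so that quotients by powers of an ideal are indexed by [n.+1]. *)

Definition maximal_ideal (R : comNzRingType) (M : idealr R) : Prop :=
  forall J : idealr R, {subset M <= J} -> J =i M.

Definition local_ring (R : comNzRingType) (m : idealr R) : Prop :=
  maximal_ideal m /\ (forall M : idealr R, maximal_ideal M -> M =i m).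

Definition generated_by (R : comNzRingType) (n : nat) (a : n.-tuple R)
    (J : idealr R) : Prop :=
  forall x, x \in J <-> exists c : 'I_n -> R, x = \sum_(i < n) c i * tnth a i.

Definition finite_embdim (R : comNzRingType) (m : idealr R) : Prop :=
  exists (n : nat) (a : n.-tuple R), generated_by a m.

Definition primary_ideal (R : comNzRingType) (I : idealr R) : Prop :=
  forall x y, x * y \in I -> x \in I \/ exists n : nat, y ^+ n \in I.

Definition m_primary (R : comNzRingType) (m I : idealr R) : Prop :=
  primary_ideal I /\ (forall x, x \in m <-> exists n : nat, x ^+ n \in I).

Definition idealM (R : comNzRingType) (I J : {pred R}) : {pred R} :=
  [pred x | `[< exists2 s : seq (R * R),
      all (fun p => (p.1 \in I) && (p.2 \in J)) s
    & x = \sum_(p <- s) p.1 * p.2 >] ].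

Definition idealX (R : comNzRingType) (I : {pred R}) (n : nat) : {pred R} :=
  iter n (idealM I) predT.

Definition ideal_inf (R : comNzRingType) (I : {pred R}) : {pred R} :=
  [pred x | `[< forall n : nat, x \in idealX I n >] ].

Section IdealPowers.
Variables (R : comNzRingType) (m : idealr R).
Implicit Types (x y a : R) (n : nat).

Lemma idealX0 x : x \in idealX m 0. Proof. by []. Qed.

Lemma idealXSP n x : reflect (exists2 s : seq (R * R),
      all (fun p => (p.1 \in (m : {pred R})) && (p.2 \in idealX m n)) s
    & x = \sum_(p <- s) p.1 * p.2) (x \in idealX m n.+1).
Proof. exact: asboolP. Qed.

Lemma idealX_closed n : 0 \in idealX m n /\
  forall a, {in idealX m n &, forall x y, a * x + y \in idealX m n}.
Proof.
case: n => [|n]; first by split.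
split; first by apply/idealXSP; exists [::]; rewrite ?big_nil.
move=> a _ _ /idealXSP[s sP ->] /idealXSP[t tP ->]; apply/idealXSP.
exists ([seq (a * p.1, p.2) | p <- s] ++ t); last first.
  rewrite big_cat big_map mulr_sumr; congr (_ + _).
  by apply: eq_bigr => p _; rewrite mulrA.
rewrite all_cat tP andbT all_map; apply: sub_all sP => p /= /andP[p1 ->].
by rewrite idealMr.
Qed.

Lemma idealXMl n a x : x \in idealX m n -> a * x \in idealX m n.
Proof.
by case: (idealX_closed n) => X0 XM xX; rewrite -[a * x]addr0 XM.
Qed.

Lemma idealX_sum n (I : Type) (r : seq I) (P : pred I) (F : I -> R) :
  (forall i, P i -> F i \in idealX m n) ->
  \sum_(i <- r | P i) F i \in idealX m n.
Proof.
case: (idealX_closed n) => X0 XM FX; apply: (big_ind (fun x => x \in idealX m n)) => // x y xX yX.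
by rewrite -[x]mul1r XM.
Qed.

Lemma idealX_mul i j x y :
  x \in idealX m i -> y \in idealX m j -> x * y \in idealX m (i + j)%N.
Proof.
elim: i x => [|i IHi] x; first by move=> _; apply: idealXMl.
move=> /idealXSP[s sP ->] yX; rewrite addSn; apply/idealXSP.
exists [seq (p.1, p.2 * y) | p <- s]; last first.
  by rewrite big_map mulr_suml; apply: eq_bigr => p _; rewrite mulrA.
rewrite all_map; apply: sub_all sP => p /= /andP[-> p2] /=.
exact: IHi.
Qed.

Lemma idealX_mulE i j n x y : (i + j)%N = n ->
  x \in idealX m i -> y \in idealX m j -> x * y \in idealX m n.
Proof. by move=> <-; apply: idealX_mul. Qed.

Lemma idealX_add n x y :
  x \in idealX m n -> y \in idealX m n -> x + y \in idealX m n.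
Proof.
by have [_ XM] := idealX_closed n => /XM /[apply] /(_ 1); rewrite mul1r.
Qed.

Lemma idealXS_sub n : {subset idealX m n.+1 <= idealX m n}.
Proof.
move=> _ /idealXSP[s sP ->]; elim: s sP => [|p s IHs] /=.
  by rewrite big_nil; case: (idealX_closed n).
case/andP=> /andP[_ p2] /IHs sX; rewrite big_cons.
by case: (idealX_closed n) => _ XM; apply: XM.
Qed.

Lemma idealXS_sub1 n : {subset idealX m n.+1 <= m}.
Proof.
move=> _ /idealXSP[s sP ->]; elim: s sP => [|p s IHs] /=.
  by rewrite big_nil idealr0.
case/andP=> /andP[p1 _] /IHs sX; rewrite big_cons rpredD //.
by rewrite mulrC idealMr.
Qed.

Lemma idealXS_idealr_closed n : idealr_closed (idealX m n.+1).
Proof.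
have [X0 XM] := idealX_closed n.+1; split=> //.
by apply/negP => /idealXS_sub1; rewrite idealr1.
Qed.

HB.instance Definition _ n :=
  isIdealr.Build R (idealX m n.+1) (idealXS_idealr_closed n).

Lemma ideal_inf_idealr_closed : idealr_closed (ideal_inf m).
Proof.
split.
- by apply/asboolP => n; case: (idealX_closed n).
- by apply/negP => /asboolP /(_ 1%N) /idealXS_sub1; rewrite idealr1.
move=> a x y /asboolP xX /asboolP yX; apply/asboolP => n.
by case: (idealX_closed n) => _ XM; apply: XM.
Qed.

HB.instance Definition _ :=
  isIdealr.Build R (ideal_inf m) ideal_inf_idealr_closed.

End IdealPowers.

Definition quoX (R : comNzRingType) (m : idealr R) (n : nat) : comNzRingType :=
  {ideal_quot (idealX m n.+1)}.

Definition piX (R : comNzRingType) (m : idealr R) (n : nat) (x : R) :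
    quoX m n := \pi_({ideal_quot (idealX m n.+1)}) x.

Definition reprX (R : comNzRingType) (m : idealr R) (n : nat) (x : quoX m n) :
    R := repr (x : {ideal_quot (idealX m n.+1)}).

Section PowerQuotients.
Variables (R : comNzRingType) (m : idealr R).

Lemma piX_is_zmod_morphism n : zmod_morphism (piX m n).
Proof. by move=> x y; exact: rmorphB. Qed.

Lemma piX_is_monoid_morphism n : monoid_morphism (piX m n).
Proof. by split=> [|x y]; [exact: rmorph1 | exact: rmorphM]. Qed.

HB.instance Definition _ n :=
  GRing.isZmodMorphism.Build R (quoX m n) (piX m n) (piX_is_zmod_morphism n).
HB.instance Definition _ n :=
  GRing.isMonoidMorphism.Build R (quoX m n) (piX m n)
    (piX_is_monoid_morphism n).

Lemma reprXK n : cancel (@reprX R m n) (piX m n).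
Proof. exact: reprK. Qed.

Lemma piX_eq n (x y : R) :
  piX m n x = piX m n y <-> x - y \in idealX m n.+1.
Proof.
split=> [xy|xyX]; last by apply/eqP; rewrite -Quotient.idealrBE.
by rewrite Quotient.idealrBE; apply/eqP.
Qed.

Lemma reprX_piX n (x : R) : reprX (piX m n x) - x \in idealX m n.+1.
Proof. by apply/piX_eq; rewrite reprXK. Qed.

(** The canonical projection from [R / m^(n+2)] to [R / m^(n+1)]. *)
Definition quoX_trans n (x : quoX m n.+1) : quoX m n := piX m n (reprX x).

Lemma quoX_transE n (x : R) : quoX_trans (piX m n.+1 x) = piX m n x.
Proof. by apply/piX_eq; apply: idealXS_sub; apply: reprX_piX. Qed.

Lemma quoX_trans1 n : quoX_trans (1 : quoX m n.+1) = 1.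
Proof. by rewrite -(rmorph1 (piX m n.+1)) quoX_transE rmorph1. Qed.

Lemma quoX_transB n (x y : quoX m n.+1) :
  quoX_trans (x - y) = quoX_trans x - quoX_trans y.
Proof.
rewrite -[x]reprXK -[y]reprXK -(rmorphB (piX m n.+1)).
by rewrite !quoX_transE rmorphB.
Qed.

Lemma quoX_transM n (x y : quoX m n.+1) :
  quoX_trans (x * y) = quoX_trans x * quoX_trans y.
Proof.
rewrite -[x]reprXK -[y]reprXK -(rmorphM (piX m n.+1)).
by rewrite !quoX_transE rmorphM.
Qed.

End PowerQuotients.

Definition artinian (R : comNzRingType) : Prop :=
  forall I : nat -> submodClosed R^o,
    (forall n, {subset I n.+1 <= I n}) ->
  exists N : nat, forall n, (N <= n)%N -> I n =i I N.

(** [gdim_le d R] is [gdim R <= d], for a local ring [R].  Only [x] is a genuine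
    choice: [m] is the maximal ideal of [R] and [J] is the ideal [x R]. *)
Fixpoint gdim_le (d : nat) (R : comNzRingType) : Prop :=
  if d is e.+1 then
    exists (m J : idealr R) (x : R),
      [/\ local_ring m, x \in m, generated_by [tuple x] J
        & gdim_le e {ideal_quot J}]
  else artinian R.

Definition has_gdim (R : comNzRingType) (d : nat) : Prop :=
  gdim_le d R /\ ((0 < d)%N -> ~ gdim_le d.-1 R).

Definition m_primary_gens (R : comNzRingType) (m : idealr R) (n : nat) : Prop :=
  exists (I : idealr R) (a : n.-tuple R), generated_by a I /\ m_primary m I.

Definition least_m_primary_gens (R : comNzRingType) (m : idealr R) (d : nat) :
    Prop :=
  m_primary_gens m d /\ (forall n, m_primary_gens m n -> (d <= n)%N).

Definition has_prime_chain (R : comNzRingType) (d : nat) : Prop :=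
  exists P : nat -> prime_idealr R, forall i, (i < d)%N ->
    {subset P i <= P i.+1} /\ ~ {subset P i.+1 <= P i}.

Definition has_krull_dim (R : comNzRingType) (d : nat) : Prop :=
  has_prime_chain R d /\ (forall n, has_prime_chain R n -> (n <= d)%N).

Definition has_submod_chain (R : comNzRingType) (V : lmodType R) (l : nat) :
    Prop :=
  exists N : nat -> submodClosed V, forall i, (i < l)%N ->
    {subset N i <= N i.+1} /\ ~ {subset N i.+1 <= N i}.

Definition has_length (R : comNzRingType) (V : lmodType R) (l : nat) : Prop :=
  has_submod_chain V l /\ (forall k, has_submod_chain V k -> (k <= l)%N).

(** The [R]-submodules of [R / m^n] are its ideals, so its length is computed
    over [R / m^n] itself. *)
Definition hilbert_samuel (R : comNzRingType) (m : idealr R) (p : {poly rat}) :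
    Prop :=
  exists N : nat, forall n, (N <= n)%N -> exists l : nat,
    has_length (quoX m n)^o l /\ p.[n.+1%:R] = l%:R.

Section Products.
Variable A : nat -> comNzRingType.

Definition prodring : Type := forall n : nat, A n.

HB.instance Definition _ := gen_eqMixin prodring.
HB.instance Definition _ := gen_choiceMixin prodring.

Implicit Types f g h : prodring.

Definition prodring0 : prodring := fun n => 0.
Definition prodring1 : prodring := fun n => 1.
Definition prodringN f : prodring := fun n => - f n.
Definition prodringD f g : prodring := fun n => f n + g n.
Definition prodringM f g : prodring := fun n => f n * g n.

Lemma prodringDA : associative prodringD.
Proof. by move=> f g h; apply: functional_extensionality_dep => n; exact: addrA. Qed.
Lemma prodringDC : commutative prodringD.
Proof. by move=> f g; apply: functional_extensionality_dep => n; exact: addrC. Qed.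
Lemma prodring0D : left_id prodring0 prodringD.
Proof. by move=> f; apply: functional_extensionality_dep => n; exact: add0r. Qed.
Lemma prodringND : left_inverse prodring0 prodringN prodringD.
Proof. by move=> f; apply: functional_extensionality_dep => n; exact: addNr. Qed.

HB.instance Definition _ :=
  GRing.isZmodule.Build prodring prodringDA prodringDC prodring0D prodringND.

Lemma prodringMA : associative prodringM.
Proof. by move=> f g h; apply: functional_extensionality_dep => n; exact: mulrA. Qed.
Lemma prodringMC : commutative prodringM.
Proof. by move=> f g; apply: functional_extensionality_dep => n; exact: mulrC. Qed.
Lemma prodring1M : left_id prodring1 prodringM.
Proof. by move=> f; apply: functional_extensionality_dep => n; exact: mul1r. Qed.
Lemma prodringMDl : left_distributive prodringM +%R.
Proof. by move=> f g h; apply: functional_extensionality_dep => n; exact: mulrDl. Qed.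
Lemma prodring1_neq0 : prodring1 != 0.
Proof.
apply/eqP => /(congr1 (fun f : prodring => f 0)) /eqP.
by rewrite (negPf (oner_neq0 (A 0))).
Qed.

HB.instance Definition _ := GRing.Zmodule_isComNzRing.Build prodring
  prodringMA prodringMC prodring1M prodringMDl prodring1_neq0.

Lemma prodring1E n : (1 : prodring) n = 1. Proof. by []. Qed.
Lemma prodring0E n : (0 : prodring) n = 0. Proof. by []. Qed.
Lemma prodringBE f g n : (f - g) n = f n - g n. Proof. by []. Qed.
Lemma prodringME f g n : (f * g) n = f n * g n. Proof. by []. Qed.

End Products.

Section CompletionAndGraded.
Variables (R : comNzRingType) (m : idealr R).

Local Notation tower := (prodring (quoX m)).

Definition completion_pred : {pred tower} :=
  [pred f : tower | `[< forall n, quoX_trans (f n.+1) = f n >] ].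

Lemma completion_subring : GRing.subring_closed completion_pred.
Proof.
split=> [|f g /asboolP fP /asboolP gP|f g /asboolP fP /asboolP gP].
- by apply/asboolP => n; rewrite !prodring1E quoX_trans1.
- by apply/asboolP => n; rewrite !prodringBE quoX_transB fP gP.
- by apply/asboolP => n; rewrite !prodringME quoX_transM fP gP.
Qed.

HB.instance Definition _ :=
  GRing.isSubringClosed.Build tower completion_pred completion_subring.

(** The inverse limit of the rings [R / m^n]. *)
Record completion : Type := Completion {
  completion_val :> tower;
  completion_valP : completion_val \in completion_pred }.

HB.instance Definition _ := [isSub for completion_val].
HB.instance Definition _ := [Choice of completion by <:].
HB.instance Definition _ := [SubChoice_isSubComNzRing of completion by <:].

(** The summand [m^n / m^(n+1)] is the image of [m^n] in [R / m^(n+1)]. *)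
Definition graded_pred : {pred tower} :=
  [pred f : tower | `[<
    (forall n, exists2 a, a \in idealX m n & f n = piX m n a) /\
    (exists N : nat, forall n, (N <= n)%N -> f n = 0) >] ].

Lemma graded_zmod : zmod_closed graded_pred.
Proof.
split=> [|f g /asboolP[fX [N fN]] /asboolP[gX [M gM]]]; apply/asboolP.
  split=> [n|]; last by exists 0.
  by exists 0; [case: (idealX_closed m n)|rewrite rmorph0].
split=> [n|].
  have [a aX fa] := fX n; have [b bX gb] := gX n; exists (a - b).
    have [_ XM] := idealX_closed m n.
    by rewrite addrC -mulN1r XM.
  by rewrite prodringBE fa gb rmorphB.
exists (maxn N M) => n; rewrite geq_max => /andP[Nn Mn].
by rewrite prodringBE fN ?gM ?subr0.
Qed.

HB.instance Definition _ :=
  GRing.isZmodClosed.Build tower graded_pred graded_zmod.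

Record graded : Type := Graded {
  graded_val : tower;
  graded_valP : graded_val \in graded_pred }.

HB.instance Definition _ := [isSub for graded_val].
HB.instance Definition _ := [Choice of graded by <:].
HB.instance Definition _ := [SubChoice_isSubZmodule of graded by <:].

(** The product of the classes of [a] in [m^i / m^(i+1)] and of [b] in
    [m^j / m^(j+1)] is the class of [a * b] in [m^(i+j) / m^(i+j+1)]. *)
Definition conv (f g : tower) : tower := fun n =>
  piX m n (\sum_(i < n.+1) reprX (f i) * reprX (g (n - i)%N)).

Definition unit_tower : tower := fun n => (n == 0)%:R.

(** The ring axioms are lifted from [{poly R}]: a polynomial whose [n]-th
    coefficient lies in [m^n] represents an element of [graded]. *)
Definition rees (p : {poly R}) := forall n, p`_n \in idealX m n.
Definition cls (p : {poly R}) : tower := fun n => piX m n p`_n.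

Lemma reesM p q : rees p -> rees q -> rees (p * q).
Proof.
move=> pX qX n; rewrite coefM; apply: idealX_sum => i _.
have in_ : (i <= n)%N by rewrite -ltnS.
exact: idealX_mulE (subnKC in_) (pX i) (qX _).
Qed.

Lemma cls_graded p : rees p -> cls p \in graded_pred.
Proof.
move=> pX; apply/asboolP; split=> [n|]; first by exists p`_n.
by exists (size p) => n pn; rewrite /cls nth_default // rmorph0.
Qed.

Lemma cls_surj f : f \in graded_pred -> exists2 p, rees p & cls p = f.
Proof.
move=> /asboolP[fX [N fN]]; exists (\poly_(n < N) reprX (f n)) => [n|].
  rewrite coef_poly; case: ifP => _; last by case: (idealX_closed m n).
  have [a aX ->] := fX n; rewrite -[reprX _](subrK a).
  by apply: idealX_add => //; apply: idealXS_sub; apply: reprX_piX.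
apply: functional_extensionality_dep => n; rewrite /cls coef_poly.
by case: ltnP => nN; rewrite ?reprXK // rmorph0 fN.
Qed.

Lemma clsM p q : rees p -> rees q -> conv (cls p) (cls q) = cls (p * q).
Proof.
move=> pX qX; apply: functional_extensionality_dep => n.
apply/piX_eq; rewrite coefM -sumrB; apply: idealX_sum => i _.
have in_ : (i <= n)%N by rewrite -ltnS.
have -> : reprX (cls p i) * reprX (cls q (n - i)%N) - p`_i * q`_(n - i) =
    (reprX (cls p i) - p`_i) * reprX (cls q (n - i)%N) +
    p`_i * (reprX (cls q (n - i)%N) - q`_(n - i)).
  by rewrite mulrBl mulrBr addrA subrK.
apply: idealX_add.
  have eqn : (i.+1 + (n - i))%N = n.+1 by rewrite addSn subnKC.
  apply: (idealX_mulE eqn); first exact: reprX_piX.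
  rewrite -[reprX _](subrK q`_(n - i)).
  by apply: idealX_add => //; apply: idealXS_sub; apply: reprX_piX.
have eqn : (i + (n - i).+1)%N = n.+1 by rewrite addnS subnKC.
by apply: (idealX_mulE eqn) => //; exact: reprX_piX.
Qed.

Lemma clsD p q : cls (p + q) = cls p + cls q.
Proof.
by apply: functional_extensionality_dep => n; rewrite /cls coefD rmorphD.
Qed.

Lemma cls1 : cls 1 = unit_tower.
Proof.
by apply: functional_extensionality_dep => n; rewrite /cls coef1 rmorph_nat.
Qed.

Lemma rees1 : rees 1.
Proof. by case=> // n; rewrite coef1; case: (idealX_closed m n.+1). Qed.

Lemma reesD p q : rees p -> rees q -> rees (p + q).
Proof.
move=> pX qX n; by rewrite coefD; apply: idealX_add.
Qed.

Lemma conv_graded (f g : graded) :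
  conv (graded_val f) (graded_val g) \in graded_pred.
Proof.
have [p pX <-] := cls_surj (graded_valP f).
have [q qX <-] := cls_surj (graded_valP g).
by rewrite clsM //; apply: cls_graded; apply: reesM.
Qed.

Lemma unit_graded : unit_tower \in graded_pred.
Proof. by rewrite -cls1; apply: cls_graded; exact: rees1. Qed.

Definition graded_mul (f g : graded) : graded := Graded (conv_graded f g).
Definition graded_one : graded := Graded unit_graded.

Lemma graded_valD (f g : graded) :
  graded_val (f + g) = graded_val f + graded_val g.
Proof. exact: (raddfD (val : graded -> tower)). Qed.

Lemma graded_mulA : associative graded_mul.
Proof.
move=> [f fX] [g gX] [h hX]; apply: val_inj => /=.
have [p pX <-] := cls_surj fX; have [q qX <-] := cls_surj gX.
have [r rX <-] := cls_surj hX.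
rewrite (clsM qX rX) (clsM pX qX) (clsM pX (reesM qX rX)).
by rewrite (clsM (reesM pX qX) rX) mulrA.
Qed.

Lemma graded_mulC : commutative graded_mul.
Proof.
move=> [f fX] [g gX]; apply: val_inj => /=.
have [p pX <-] := cls_surj fX; have [q qX <-] := cls_surj gX.
by rewrite (clsM pX qX) (clsM qX pX) mulrC.
Qed.

Lemma graded_mul1 : left_id graded_one graded_mul.
Proof.
move=> [f fX]; apply: val_inj => /=; have [p pX <-] := cls_surj fX.
by rewrite -cls1 (clsM rees1 pX) mul1r.
Qed.

Lemma convDl f g h : f \in graded_pred -> g \in graded_pred ->
  h \in graded_pred -> conv (f + g) h = conv f h + conv g h.
Proof.
move=> /cls_surj[p pX <-] /cls_surj[q qX <-] /cls_surj[r rX <-].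
rewrite -clsD (clsM (reesD pX qX) rX) mulrDl clsD.
by rewrite (clsM pX rX) (clsM qX rX).
Qed.

Lemma graded_mulDl : left_distributive graded_mul +%R.
Proof.
move=> f g h; apply: val_inj.
apply: etrans (esym (graded_valD (graded_mul f h) (graded_mul g h))).
apply: etrans (convDl (graded_valP f) (graded_valP g) (graded_valP h)).
exact: (congr1 (fun u => conv u (graded_val h)) (graded_valD f g)).
Qed.

Lemma graded_one_neq0 : graded_one != 0.
Proof.
have val0 : graded_val 0 = 0 by exact: (raddf0 (val : graded -> tower)).
apply/eqP => /(congr1 (fun f => graded_val f 0)) /eqP.
by rewrite val0 (negPf (oner_neq0 (quoX m 0))).
Qed.

HB.instance Definition _ := GRing.Zmodule_isComNzRing.Build graded
  graded_mulA graded_mulC graded_mul1 graded_mulDl graded_one_neq0.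

End CompletionAndGraded.

(* Main.v *)
(* The length of [R / m^n] is the number of exponents of degree less than [n]
   in generators [t] of [m] that are not leading exponents of relations between
   these generators; such exponents form an up-set, so by Dickson's lemma this
   number is eventually a polynomial in [n], of degree [delta] say.
   - If [s] elements of [m] generate an ideal that contains a power of [m], a
     count of monomials bounds the length of [R / m^n] by [O(n^s)], so that
     [delta <= s]; the same count applies to the graded ring.
   - In the completion, an Artin-Rees lemma for [P + x A], obtained from a
     standard basis (Dickson again) and convergence of successive
     approximations, shows that the growth of [A / (P + M^n)] loses one degree
     at each step of a chain of primes: the Krull dimension is at most [delta].
     In the graded ring this bound comes from the algebraic dependence of any
     [delta + 1] elements over [R / m].
   - If a ring has no chain of primes of length [e + 1], then locally at [M]
     some [e] elements generate an ideal containing a power of [M] (the local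
     form of Kronecker's theorem, as in Lombardi and Quitte). For the
     completion these elements can be taken in [R], by Nakayama's lemma.
   Finally the geometric dimension of [R], or of its separated quotient, is the
   least number of elements of [m] that generate an ideal containing a power of
   [m]. *)
Require Import Defs.
From HB Require Import structures.
From mathcomp Require Import all_boot all_order all_algebra.
From mathcomp Require Import boolp classical_sets ring zify.
Set Implicit Arguments.
Unset Strict Implicit.
Unset Printing Implicit Defensive.
Import Order.TTheory GRing.Theory Num.Theory.
Local Open Scope ring_scope.
Local Open Scope classical_set_scope.

(** * Chains of submodules *)

Section Span.
Variables (S B : comNzRingType) (phi : {rmorphism S -> B}).
Implicit Types (J K T F : set B) (gs : seq B).

(** [R] is not assumed Noetherian, so no Noetherian dimension theory is available; finiteness enters
    only through monomials in the generators of the maximal ideal and Nakayama's lemma. Lengths are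
    treated as bounds on strict chains. In a list where each generator spans zero or a simple module
    over the later ones, the number of essential generators bounds every chain and is attained,
    which replaces the Jordan-Hölder theorem; chains are then moved along multiplications and ring
    maps. Kronecker's theorem takes the place of prime avoidance. The comparison closes into a
    cycle: the bound on primes of the completion yields [delta] parameters, and fewer are excluded
    by growth. In the graded ring the parameters need not be homogeneous and are not lifted to [R];
    the growth that they impose is enough. *)

Definition submod K := K 0 /\ forall a x y, K x -> K y -> K (phi a * x + y).

Lemma submodD K x y : submod K -> K x -> K y -> K (x + y).
Proof. by case=> _ KM Kx Ky; rewrite -[x]mul1r -(rmorph1 phi); apply: KM. Qed.

Lemma submodM K a x : submod K -> K x -> K (phi a * x).
Proof. by case=> K0 KM Kx; rewrite -[_ * x]addr0; apply: KM. Qed.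

Lemma submodN K x : submod K -> K x -> K (- x).
Proof.
by move=> Ks Kx; rewrite -mulN1r -(rmorph1 phi) -rmorphN; apply: submodM.
Qed.

Lemma submodB K x y : submod K -> K x -> K y -> K (x - y).
Proof. by move=> Ks Kx Ky; apply: submodD => //; apply: submodN. Qed.

Lemma submod_subr K x y : submod K -> K y -> K (x - y) -> K x.
Proof. by move=> Ks Ky Kxy; rewrite -(subrK y x); apply: submodD. Qed.

Lemma submod_sum K (I : Type) (r : seq I) (P : pred I) (f : I -> B) :
  submod K -> (forall i, P i -> K (f i)) -> K (\sum_(i <- r | P i) f i).
Proof.
move=> Ks Kf; elim/big_ind: _ => //; first by case: Ks.
by move=> x y; apply: submodD.
Qed.

Lemma submodI K T : submod K -> submod T -> submod (K `&` T).
Proof.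
move=> [K0 KM] [T0 TM]; split=> [//|a x y [Kx Tx] [Ky Ty]].
by split; [apply: KM | apply: TM].
Qed.

(** Scalars act through [phi]: the identity gives ideals, the map from [R] to its graded ring gives
    [R]-submodules. Peeling off the head turns the list into a filtration indexed by its
    suffixes. *)
Fixpoint span J gs x : Prop :=
  if gs is g :: b then exists a, span J b (x - phi a * g) else J x.

Lemma span_submod J gs : submod J -> submod (span J gs).
Proof.
move=> Js; elim: gs => //= g b [b0 bM]; split.
  by exists 0; rewrite rmorph0 mul0r subr0.
move=> c x y [a1 xa] [a2 ya]; exists (c * a1 + a2).
have -> : phi c * x + y - phi (c * a1 + a2) * g =
  phi c * (x - phi a1 * g) + (y - phi a2 * g) by rewrite rmorphD rmorphM; ring.
exact: bM.
Qed.

Lemma span_base J gs : J `<=` span J gs.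
Proof.
elim: gs => //= g b IH x Jx; exists 0.
by rewrite rmorph0 mul0r subr0; apply: IH.
Qed.

Lemma span_behead J g b : span J b `<=` span J (g :: b).
Proof. by move=> x bx; exists 0; rewrite rmorph0 mul0r subr0. Qed.

Lemma mem_span J gs g : submod J -> g \in gs -> span J gs g.
Proof.
move=> Js; elim: gs => //= h b IH; rewrite in_cons => /orP[/eqP->|/IH gb].
  by exists 1; rewrite rmorph1 mul1r subrr; case: (span_submod b Js).
by exists 0; rewrite rmorph0 mul0r subr0.
Qed.

Lemma span_min J K gs : submod K -> J `<=` K ->
  (forall g, g \in gs -> K g) -> span J gs `<=` K.
Proof.
move=> Ks JK; elim: gs => //= g b IH Kg x [a xa].
apply: (@submod_subr _ _ (phi a * g)) => //.
  by apply: submodM => //; apply: Kg; rewrite mem_head.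
by apply: IH xa => h hb; apply: Kg; rewrite in_cons hb orbT.
Qed.

Lemma span_cat J s1 s2 : span J (s1 ++ s2) = span (span J s2) s1.
Proof.
elim: s1 => //= g b IH; apply/funext => x /=.
by rewrite IH.
Qed.

(** For a list satisfying [tower] below, this is the length of the quotient of [span J gs] by
    [J]. *)
Fixpoint ess J gs : nat :=
  if gs is g :: b then (~~ `[< span J b g >] + ess J b)%N else 0%N.

Lemma ess_cat J s1 s2 : ess J (s1 ++ s2) = (ess (span J s2) s1 + ess J s2)%N.
Proof. by elim: s1 => //= g b ->; rewrite span_cat addnA. Qed.

Lemma ess_size J gs : (ess J gs <= size gs)%N.
Proof. by elim: gs => //= g b; case: `[< _ >]; lia. Qed.

(** Built downwards from [T]; the lowest term need only contain [J], so a chain survives enlarging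
    [T] or shrinking [J]. *)
Fixpoint chain (l : nat) J T : Prop :=
  if l is k.+1 then
    exists K, [/\ submod K, chain k J K, K `<=` T & exists2 x, T x & ~ K x]
  else J `<=` T.

Lemma chain_sub l J T : chain l J T -> J `<=` T.
Proof. by elim: l T => //= l IH T [K [_ /IH JK KT _]] x /JK/KT. Qed.

Lemma chain_topW l J T T' : T `<=` T' -> chain l J T -> chain l J T'.
Proof.
case: l => [|l] TT' /=; first by move=> JT x /JT/TT'.
move=> [K [Ks JK KT [x Tx Kx]]]; exists K; split=> //.
  by move=> y /KT/TT'.
by exists x => //; apply: TT'.
Qed.

Lemma chain_botW l J J' T : J' `<=` J -> chain l J T -> chain l J' T.
Proof.
move=> J'J; elim: l T => [|l IH] T /=; first by move=> JT x /J'J/JT.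
by move=> [K [Ks /IH JK KT Tx]]; exists K.
Qed.

Lemma chain_cat p q J K T : chain p J K -> chain q K T -> chain (p + q) J T.
Proof.
move=> JK; elim: q T => [|q IH] T; first by rewrite addn0 => /chain_topW; apply.
by rewrite addnS /= => -[L [Ls /IH JL LT Tx]]; exists L.
Qed.

Lemma chain_ess J gs : submod J -> chain (ess J gs) J (span J gs).
Proof.
move=> Js; elim: gs => //= g b IH; case: asboolP => [gb|gb].
  by apply: chain_topW IH; apply: span_behead.
exists (span J b); split=> //; [exact: span_submod|exact: span_behead|].
by exists g => //; apply: (@mem_span J (g :: b)) => //; rewrite mem_head.
Qed.

(* Modulo the span of the later ones, each generator spans [0] or a simple
   module. *)
Fixpoint tower J gs : Prop :=
  if gs is g :: b then
    (forall a, span J b (phi a * g) \/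
       exists a', span J b (phi a' * phi a * g - g)) /\ tower J b
  else True.

(** Since the quotient of [span F [:: g]] by [F] is zero or simple, intersecting with [F] loses at
    most one step, the one at which the chain leaves [F]. *)
Lemma chain_cut J F g l T : submod F -> submod T -> J `<=` F ->
    (forall a, F (phi a * g) \/ exists a', F (phi a' * phi a * g - g)) ->
    T `<=` span F [:: g] -> chain l J T ->
  T `<=` F \/ chain l.-1 J (T `&` F).
Proof.
move=> Fs + JF gF; elim: l T => [|l IH] T Ts TF.
  by move=> JT; right => x Jx; split; [apply: JT|apply: JF].
move=> /= [K [Ks JK KT [x Tx Kx]]].
have [?|nTF] := pselect (T `<=` F); [by left|right].
have [KF|nKF] := pselect (K `<=` F).
  by apply: chain_topW JK => y Ky; split; [apply: KT|apply: KF].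
have [//|] := IH K Ks (fun y Ky => TF y (KT y Ky)) JK.
case: l JK {IH} => [|l] JK /= JKF.
  by move=> y Jy; split; [apply/KT/JK|apply: JF].
exists (K `&` F); split=> //; [exact: submodI|by move=> y [/KT]|].
move/existsNP: nKF => [k /not_implyP[Kk Fk]].
have [a1 ka1] := TF k (KT k Kk); have [a xa] := TF x Tx.
have [Fa1|[a' ga']] := gF a1.
  by case: Fk; apply: submod_subr Fa1 ka1.
(* Modulo [F], [x] is [a] times [g] and [k] is [a1] times [g], and [a'] inverts [a1] on [g]; so this
   element lies in [F], and it differs from [x] by an element of [K]. *)
exists (x - phi (a * a') * k); last first.
  move=> [Kxk _]; apply: Kx; apply: submod_subr Kxk => //.
  exact: submodM.
split; first by apply: submodB => //; apply: submodM => //; apply: KT.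
have -> : x - phi (a * a') * k = (x - phi a * g) -
    phi (a * a') * (k - phi a1 * g) - phi a * (phi a' * phi a1 * g - g).
  by rewrite rmorphM; ring.
by do 2?apply: submodB => //; apply: submodM.
Qed.

(** Cutting by the span of the tail costs one step at an essential generator and none at the
    others. *)
Lemma chain_bound J gs l T : submod J -> tower J gs -> submod T ->
  T `<=` span J gs -> chain l J T -> (l <= ess J gs)%N.
Proof.
move=> Js; elim: gs l T => [|g b IH] l T /=.
  case: l => //= l _ _ TJ [K [_ JK _ [x Tx Kx]]].
  by case: Kx; apply: chain_sub JK _ (TJ _ Tx).
move=> [gb tb] Ts Tgb JT; have bs := span_submod b Js.
case: asboolP => [bg|nbg].
  apply: IH JT => // x /Tgb[a xa].
  by apply: submod_subr xa => //; apply: submodM.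
have Jb : J `<=` span J b by apply: span_base.
have [Tb|JTb] := chain_cut bs Ts Jb gb Tgb JT.
  exact: leq_trans (IH _ _ tb Ts Tb JT) (leqnSn _).
suff: (l.-1 <= ess J b)%N by rewrite /=; lia.
by apply: (IH _ _ tb _ _ JTb); [exact: submodI|move=> x []].
Qed.

End Span.

(** * Exponents and eventually polynomial functions *)

(** Listed in increasing lexicographic order, so that comparing a monomial with the later entries,
    as [ess] does, means comparing it with the larger exponents. *)
Fixpoint monos (r n : nat) : seq (seq nat) :=
  if r is r'.+1 then
    flatten [seq [seq j :: a | a <- monos r' (n - j)] | j <- iota 0 n.+1]
  else if n is 0 then [:: [::]] else [::].

Fixpoint box (k n : nat) : seq (seq nat) :=
  if k is k'.+1 then flatten [seq [seq j :: a | a <- box k' n] | j <- iota 0 n]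
  else [:: [::]].

Fixpoint slt (a b : seq nat) : bool :=
  match a, b with
  | x :: a', y :: b' => (x < y)%N || (x == y) && slt a' b'
  | _, _ => false
  end.

Definition madd (a b : seq nat) : seq nat := [seq (p.1 + p.2)%N | p <- zip a b].

Lemma mem_monos r n a : (a \in monos r n) = (size a == r) && (sumn a == n).
Proof.
elim: r n a => [|r IH] n [|x a]; [by case: n|by case: n| |].
  by apply/negbTE/negP => /flatten_mapP[j _ /mapP[]].
apply/flatten_mapP/andP => [[j]|[/eqP[sa] /eqP sn]].
  rewrite mem_iota => /andP[_ jn] /mapP[b + [-> ->]].
  by rewrite IH => /andP[/eqP <- /eqP sb]; split; apply/eqP => //=; lia.
exists x; first by rewrite mem_iota; move: sn => /=; lia.
by apply: map_f; rewrite IH sa eqxx /=; apply/eqP; move: sn => /=; lia.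
Qed.

Lemma size_box k n : size (box k n) = (n ^ k)%N.
Proof.
elim: k => //= k IH; rewrite size_flatten /shape -map_comp.
rewrite (eq_map (g := fun=> (n ^ k)%N)); last by move=> j; rewrite /= size_map.
have H (c : nat) s : sumn [seq c | _ <- s] = (size s * c)%N by elim: s => //= _ s ->.
by rewrite H size_iota expnS.
Qed.

Lemma mem_box k n a : a \in box k n -> size a = k /\ (sumn a <= k * n)%N.
Proof.
elim: k a => [|k IH] a /=; first by rewrite in_cons orbF => /eqP->.
move=> /flatten_mapP[j]; rewrite mem_iota => jn /mapP[b /IH[<- sb] ->] /=.
by split=> //; rewrite mulSn; apply: leq_add sb; case/andP: jn => _ /ltnW.
Qed.

Lemma slt_irr a : slt a a = false.
Proof. by elim: a => //= x a ->; rewrite ltnn eqxx. Qed.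

Lemma slt_trans : transitive slt.
Proof.
move=> b a c; elim: b a c => [|y b IH] [|x a] [|z c] //=.
move=> /orP[xy|/andP[/eqP-> ab]] /orP[yz|/andP[/eqP <- bc]].
- by rewrite (ltn_trans xy).
- by rewrite xy.
- by rewrite yz.
- by rewrite eqxx (IH a c) ?orbT.
Qed.

Lemma slt_madd a b c : size a = size c -> size b = size c ->
  slt a b -> slt (madd a c) (madd b c).
Proof.
elim: c a b => [|z c IH] [|x a] [|y b] //= [sa] [sb].
move=> /orP[xy|/andP[/eqP-> ab]]; first by rewrite ltn_add2r xy.
by rewrite eqxx IH ?orbT.
Qed.

Lemma size_madd a c : size a = size c -> size (madd a c) = size c.
Proof. by move=> s; rewrite size_map size_zip s minnn. Qed.

Lemma sumn_madd a c : size a = size c -> sumn (madd a c) = (sumn a + sumn c)%N.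
Proof.
elim: a c => [|x a IH] [|z c] //= [s]; rewrite /madd /= -/(madd a c) IH //; lia.
Qed.

Lemma pairwise_flatten (f : nat -> seq (seq nat)) js :
  sorted ltn js -> (forall j, pairwise slt (f j)) ->
  pairwise slt (flatten [seq [seq j :: a | a <- f j] | j <- js]).
Proof.
move=> + fs; elim: js => //= j js IH jjs; rewrite pairwise_cat.
apply/and3P; split; last exact/IH/(path_sorted jjs).
  apply/allrelP => _ _ /mapP[a _ ->] /flatten_mapP[i ijs /mapP[b _ ->]] /=.
  by have /allP/(_ i ijs) -> := order_path_min ltn_trans jjs.
rewrite pairwise_map; apply: sub_pairwise (fs j) => a b /=.
by rewrite eqxx => ->; rewrite orbT.
Qed.

Lemma pairwise_monos r n : pairwise slt (monos r n).
Proof.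
elim: r n => [|r IH] n; first by case: n.
apply: (pairwise_flatten (f := fun j => monos r (n - j))) => //.
exact: iota_ltn_sorted.
Qed.

Lemma pairwise_box k n : pairwise slt (box k n).
Proof.
elim: k => //= k IH.
by apply: (pairwise_flatten (f := fun=> box k n)) => //; exact: iota_ltn_sorted.
Qed.

Lemma filter_slt_suffix s1 a s2 : pairwise slt (s1 ++ a :: s2) ->
  [seq b <- s1 ++ a :: s2 | slt a b] = s2.
Proof.
rewrite pairwise_cat /= => /and3P[/allrelP s1a _ /andP[/all_filterP as2 _]].
rewrite filter_cat /= slt_irr as2 (_ : filter _ s1 = [::]) //.
apply/eqP; rewrite -(negbK (_ == _)) -has_filter; apply/negP.
move=> /hasP[b bs1 ab]; have := s1a b a bs1 (mem_head _ _) => /(slt_trans ab).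
by rewrite slt_irr.
Qed.

Definition upset r (E : seq nat -> Prop) := forall a c,
  size a = r -> size c = r -> E a -> E (madd a c).

Definition dickson r := forall E, upset r E ->
  exists gens : seq (seq nat), (forall g, g \in gens -> size g = r /\ E g) /\
    forall a, size a = r -> E a ->
    exists g c, [/\ g \in gens, size c = r & a = madd g c].

(** The union of the [E j] is an up-set; its finitely many generators all lie in one [E J], which
    therefore is the whole union. *)
Lemma dickson_stable r (E : nat -> seq nat -> Prop) : dickson r ->
  (forall j, upset r (E j)) ->
  (forall i j a, (i <= j)%N -> size a = r -> E i a -> E j a) ->
  exists J, forall j a, (J <= j)%N -> size a = r -> E j a -> E J a.
Proof.
move=> dr Eup Emono; have [|gens [gensE gensP]] := dr (fun a => exists j, E j a).
  by move=> a c sa sc [j Ea]; exists j; apply: Eup.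
have [J JP] : exists J, forall g, g \in gens -> E J g.
  elim: gens gensE {gensP} => [|g gens IH] gP; first by exists 0.
  have [|J JP] := IH; first by move=> h hg; apply: gP; rewrite in_cons hg orbT.
  have [sg [j Eg]] := gP g (mem_head _ _); exists (maxn j J) => h.
  rewrite in_cons => /orP[/eqP->|hg]; first by apply: Emono Eg; rewrite ?leq_maxl.
  have [|sh _] := gP h; first by rewrite in_cons hg orbT.
  by apply: Emono (JP h hg); rewrite ?leq_maxr.
exists J => j a Jj sa Ea; have [|g [c [gg sc ->]]] := gensP a sa; first by exists j.
by have [sg _] := gensE g gg; apply: Eup => //; apply: JP.
Qed.

Lemma upset_cons r E j : upset r.+1 E -> upset r (fun a => E (j :: a)).
Proof.
move=> Eup a c sa sc Ea; have := Eup (j :: a) (0%N :: c).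
by rewrite /madd /= addn0 sa sc; apply.
Qed.

Lemma upset_cons_leq r E i j a : upset r.+1 E -> (i <= j)%N -> size a = r ->
  E (i :: a) -> E (j :: a).
Proof.
move=> Eup ij sa Ea; have := Eup (i :: a) ((j - i)%N :: nseq r 0%N).
rewrite /madd /= subnKC // sa size_nseq -/(madd _ _).
have -> : madd a (nseq r 0%N) = a.
  by rewrite -sa; elim: a {sa Ea} => //= x a IH; rewrite /madd /= addn0 -/(madd _ _) IH.
by apply.
Qed.

(** Slicing along the first exponent [j]: the slices grow with [j] and are constant from some [J]
    on, so generators of the slices up to [J] suffice. *)
Lemma dicksonP r : dickson r.
Proof.
elim: r => [|r IH] E Eup.
  have [E0|nE0] := pselect (E [::]).
    exists [:: [::]]; split; first by move=> g; rewrite inE => /eqP->.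
    by case=> // _ _; exists [::], [::].
  by exists [::]; split => // -[].
have [J JP] := dickson_stable IH (fun j => upset_cons (j := j) Eup)
  (fun i j a ij sa => upset_cons_leq Eup ij sa).
have [G GP] := choice (fun j => IH _ (upset_cons (j := j) Eup)).
exists (flatten [seq [seq j :: g | g <- G j] | j <- iota 0 J.+1]); split.
  move=> g /flatten_mapP[j _ /mapP[a aG ->]] /=.
  by have [/(_ a aG)[-> Ea] _] := GP j.
move=> [//|j a] [sa] Ea; have [jJ|Jj] := leqP j J.
  have [_ /(_ a sa Ea)[g [c [gG sc ->]]]] := GP j.
  exists (j :: g), (0%N :: c); split; [|by rewrite /= sc|by rewrite /madd /= addn0].
  by apply/flatten_mapP; exists j; rewrite ?mem_iota ?map_f.
have {}Ea := JP _ _ (ltnW Jj) sa Ea.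
have [_ /(_ a sa Ea)[g [c [gG sc ->]]]] := GP J.
exists (J :: g), ((j - J)%N :: c); split; [|by rewrite /= sc|].
  by apply/flatten_mapP; exists J; rewrite ?mem_iota ?map_f //= ltnSn.
by rewrite /madd /= subnKC // ltnW.
Qed.

(** * Eventually polynomial functions and their degrees *)

Definition evpoly (f : nat -> nat) := exists (p : {poly rat}) (N : nat),
  forall n, (N <= n)%N -> (f n)%:R = p.[n%:R].

Lemma evpoly_eq f g N : (forall n, (N <= n)%N -> f n = g n) -> evpoly f -> evpoly g.
Proof.
move=> fg [p [M pM]]; exists p, (maxn N M) => n.
by rewrite geq_max => /andP[Nn Mn]; rewrite -fg ?pM.
Qed.

Lemma evpolyD f g : evpoly f -> evpoly g -> evpoly (fun n => (f n + g n)%N).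
Proof.
move=> [p [N pN]] [q [M qM]]; exists (p + q), (maxn N M) => n.
by rewrite geq_max => /andP[Nn Mn]; rewrite hornerD -pN // -qM // natrD.
Qed.

Lemma evpoly_subn f j : evpoly f -> evpoly (fun n => f (n - j)%N).
Proof.
move=> [p [N pN]]; exists (p \Po ('X - (j%:R)%:P)), (N + j)%N => n Nn.
rewrite pN; last by lia.
by rewrite horner_comp hornerXsubC natrB //; lia.
Qed.

Lemma evpoly_addn f j : evpoly f -> evpoly (fun n => f (n + j)%N).
Proof.
move=> [p [N pN]]; exists (p \Po ('X + (j%:R)%:P)), N => n Nn.
rewrite pN; last by lia.
by rewrite horner_comp hornerD hornerX hornerC natrD.
Qed.

Lemma size_shift_powB s : exists2 q : {poly rat},
  ('X + 1) ^+ s.+1 - 'X^(s.+1) = s.+1%:R *: 'X^s + q & (size q <= s)%N.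
Proof.
elim: s => [|s [q qE qs]].
  exists 0; rewrite ?size_poly0 // !expr1 scale1r addr0.
  by rewrite addrAC subrr add0r.
exists (s.+1%:R *: 'X^s + q * ('X + 1)).
  rewrite exprS.
  have -> : ('X + 1) ^+ s.+1 =
      'X^(s.+1) + (s.+1%:R *: 'X^s + q) :> {poly rat}.
    by rewrite -qE; ring.
  rewrite -[s.+2%:R]natr1 scalerDl scale1r -!mul_polyC !exprS.
  by set a := polyC _; ring.
apply: leq_trans (size_polyD _ _) _; rewrite geq_max; apply/andP; split.
  by apply: leq_trans (size_scale_leq _ _) _; rewrite size_polyXn.
apply: leq_trans (size_polyMleq _ _) _.
have -> : size ('X + 1 : {poly rat}) = 2.
  by rewrite -[1]opprK -polyCN size_XsubC.
by rewrite addn2.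
Qed.

(** Discrete integration by removing leading terms: the difference of ['X^(s.+1)] has leading term
    [s.+1%:R *: 'X^s]. *)
Lemma antidiff (p : {poly rat}) :
  exists q : {poly rat}, forall x, q.[x + 1] - q.[x] = p.[x].
Proof.
suff H s : forall p : {poly rat}, (size p <= s)%N ->
    exists q : {poly rat}, q \Po ('X + 1) - q = p.
  have [q <-] := H (size p) p (leqnn _); exists q => x.
  by rewrite hornerD hornerN horner_comp hornerD hornerX hornerC.
elim: s => [|s IH] {}p ps.
  by exists 0; rewrite comp_poly0 subr0; apply/esym/eqP; rewrite -size_poly_leq0.
have [q qE qs] := size_shift_powB s.
pose c := p`_s / s.+1%:R.
have [|u uE] := IH (p - c *: (('X + 1) ^+ s.+1 - 'X^(s.+1))).
  apply/leq_sizeP => j; rewrite leq_eqVlt => /orP[/eqP <-|sj].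
    rewrite coefB coefZ qE coefD coefZ coefXn eqxx mulr1.
    rewrite (nth_default 0 qs) addr0 /c mulfVK ?subrr //.
    by rewrite pnatr_eq0.
  rewrite coefB coefZ qE coefD coefZ coefXn (nth_default 0 (leq_trans ps sj)).
  by rewrite (nth_default 0 (leq_trans qs (ltnW sj))) gtn_eqF // mulr0 addr0 mulr0 subr0.
exists (u + c *: 'X^(s.+1)).
rewrite comp_polyD comp_polyZ rmorphXn /= comp_polyX.
rewrite -[RHS](subrK (c *: (('X + 1) ^+ s.+1 - 'X^(s.+1)))) -uE scalerBr.
by ring.
Qed.

Lemma evpoly_sum f : evpoly f -> evpoly (fun n => \sum_(i < n) f i)%N.
Proof.
move=> [p [N pN]]; have [q qE] := antidiff p.
exists (q + ((\sum_(i < N) f i)%N%:R - q.[N%:R])%:P), N => n.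
elim: n => [|n IH].
  by rewrite leqn0 => /eqP->; rewrite hornerD hornerC addrC subrK.
rewrite leq_eqVlt => /orP[/eqP<-|Nn].
  by rewrite hornerD hornerC addrC subrK.
rewrite big_ord_recr natrD IH //= pN // -qE !hornerD !hornerC -natr1; ring.
Qed.

Lemma evpoly_bigsum (f : nat -> nat -> nat) J : (forall j, evpoly (f j)) ->
  evpoly (fun n => \sum_(j < J) f j n)%N.
Proof.
move=> fP; elim: J => [|J IH].
  by exists 0, 0%N => n _; rewrite big_ord0 horner0.
by apply: (@evpoly_eq _ _ 0) (evpolyD IH (fP J)) => n _; rewrite big_ord_recr.
Qed.

Lemma count_monosS r (P : pred (seq nat)) n : count P (monos r.+1 n) =
  (\sum_(j < n.+1) count (fun a => P (nat_of_ord j :: a)) (monos r (n - j)))%N.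
Proof.
rewrite -(big_mkord xpredT (fun j => count (fun a => P (j :: a)) (monos r (n - j)))).
rewrite /= count_cat count_map subn0 big_ltn // /index_iota subSS subn0.
congr (_ + _)%N; elim: (iota 1 n) => [|j s IH]; first by rewrite big_nil.
by rewrite big_cons /= count_cat IH count_map.
Qed.

Lemma evpoly_count_monos r (E : seq nat -> Prop) : upset r E ->
  evpoly (fun n => count (fun a => ~~ `[< E a >]) (monos r n)).
Proof.
elim: r E => [|r IH] E Eup.
  by exists 0, 1%N => -[//|n] _; rewrite /= horner0.
have Euj j := upset_cons (j := j) Eup.
have [J JP] := dickson_stable (@dicksonP r) Euj
  (fun i j a ij sa => upset_cons_leq Eup ij sa).
pose c j n := count (fun a => ~~ `[< E (j :: a) >]) (monos r n).
have cJ j n : (J <= j)%N -> c j n = c J n.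
  move=> Jj; apply: eq_in_count => a; rewrite mem_monos => /andP[/eqP sa _].
  congr (~~ _); apply: asbool_equiv_eq; split; first exact: JP.
  exact: upset_cons_leq Eup Jj sa.
(* From [J] on every slice is counted by [c J], and reversing the summation turns the degrees
   [n - j] into those from [0] to [n - J]. *)
apply: (@evpoly_eq (fun n => \sum_(j < J) c j (n - j) +
                             \sum_(i < (n - J) + 1) c J i)%N _ J).
  move=> n Jn; rewrite count_monosS -(big_mkord xpredT (fun j => c j (n - j)%N)).
  rewrite -[in RHS](big_mkord xpredT (fun j => c j (n - j)%N)).
  rewrite [in RHS](@big_cat_nat _ _ _ J) //=; last by rewrite leqW.
  congr (_ + _)%N; rewrite -(big_mkord xpredT (c J)).
  have := @big_addn _ 0%N addn 0 n.+1 J xpredT (fun i => c i (n - i)%N).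
  rewrite add0n => ->; rewrite subSn // addn1 big_nat_rev /=.
  apply: eq_big_nat => i; rewrite add0n => ?.
  by rewrite (cJ (_ + J)%N) ?leq_addl //; congr (c J); lia.
apply: evpolyD.
  by apply: evpoly_bigsum (fun j => evpoly_subn j (IH _ (Euj j))).
have h : evpoly (fun n => \sum_(i < n + 1) c J i)%N.
  exact: evpoly_addn (evpoly_sum (IH _ (Euj J))).
exact: (evpoly_subn J h).
Qed.

Lemma horner_natr_bound (p : {poly rat}) : exists C : nat, forall n, (0 < n)%N ->
  `|p.[n%:R]| <= C%:R * n%:R ^+ (size p).-1.
Proof.
pose S := \sum_(i < size p) `|p`_i|.
have S0 : 0 <= S by apply: sumr_ge0.
exists (Num.bound S) => n n0.
rewrite horner_coef; apply: le_trans (ler_norm_sum _ _ _) _.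
apply: (@le_trans _ _ (S * n%:R ^+ (size p).-1)).
  rewrite mulr_suml; apply: ler_sum => i _; rewrite normrM normrX normr_nat.
  apply: ler_wpM2l => //; rewrite -!natrX ler_nat leq_pexp2l //.
  by have := ltn_ord i; lia.
by apply: ler_wpM2r; [rewrite exprn_ge0|apply/ltW/archi_boundP].
Qed.

Lemma size_horner_bound (p : {poly rat}) C s N : (forall n, (N <= n)%N ->
  `|p.[n%:R]| <= C%:R * n%:R ^+ s) -> (size p <= s.+1)%N.
Proof.
move=> pC; rewrite leqNgt; apply/negP => sp.
have [K [Ks sK]] : exists K, size p = K.+2 /\ (s <= K)%N.
  by exists (size p).-2; split; lia.
pose a := lead_coef p; pose q := p - a *: 'X^(K.+1).
have sq : (size q <= K.+1)%N.
  apply/leq_sizeP => j; rewrite leq_eqVlt => /orP[/eqP <-|Kj].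
    by rewrite coefB coefZ coefXn eqxx mulr1 /a lead_coefE Ks subrr.
  rewrite coefB coefZ coefXn gtn_eqF // mulr0 subr0 nth_default // Ks; lia.
have [C' qC] := horner_natr_bound q.
have a0 : 0 < `|a| by rewrite normr_gt0 lead_coef_eq0 -size_poly_eq0 Ks.
have cmp0 : 0 <= (C + C')%:R / `|a| by rewrite divr_ge0.
(* Here [n] times the absolute value of [a] exceeds [C + C'], so the leading term outweighs both the
   assumed bound on [p] and the bound on the lower terms [q]. *)
pose n := maxn N (Num.bound ((C + C')%:R / `|a|)).+1.
have Nn : (N <= n)%N by apply: leq_maxl.
have n0 : (0 < n)%N by rewrite /n; lia.
have n0' : 0 < n%:R :> rat by rewrite ltr0n.
have: (C + C')%:R < `|a| * n%:R.
  rewrite mulrC -ltr_pdivrMr //; apply: lt_le_trans (archi_boundP cmp0) _.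
  by rewrite ler_nat /n; lia.
apply/negP; rewrite -leNgt -(@ler_pM2r _ (n%:R ^+ K)) ?exprn_gt0 //.
have -> : `|a| * n%:R * n%:R ^+ K = `|p.[n%:R] - q.[n%:R]|.
  rewrite /q hornerD hornerN hornerZ hornerXn opprD opprK addrA subrr add0r.
  by rewrite normrM normrX normr_nat -mulrA -exprS.
apply: le_trans (ler_normB _ _) _; rewrite natrD mulrDl; apply: lerD.
  apply: le_trans (pC n Nn) _; apply: ler_wpM2l => //.
  by rewrite -!natrX ler_nat leq_pexp2l.
apply: le_trans (qC n n0) _; apply: ler_wpM2l => //.
rewrite -!natrX ler_nat leq_pexp2l //; lia.
Qed.

Lemma horner_natr_inj (p q : {poly rat}) N :
  (forall n, (N <= n)%N -> p.[n%:R] = q.[n%:R]) -> p = q.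
Proof.
move=> pq; apply/eqP; rewrite -subr_eq0; apply/eqP; apply: contrapT => /eqP pq0.
pose rs := [seq (n%:R : rat) | n <- iota N (size (p - q))].
have := @max_poly_roots _ (p - q) rs pq0.
rewrite size_map size_iota ltnn => H; suff: false by [].
apply: H.
  apply/allP => _ /mapP[n nN ->]; move: nN; rewrite mem_iota => /andP[Nn _].
  by rewrite rootE hornerD hornerN pq // subrr.
by rewrite map_inj_uniq ?iota_uniq // => i j /eqP; rewrite eqr_nat => /eqP.
Qed.

(** * Standard monomials and Hilbert functions *)

Notation ideal := (submod idfun).
Notation ispan := (span idfun).

Section SpanTheory.
Variables (S B : comNzRingType) (phi : {rmorphism S -> B}).
Implicit Types (J K T F : set B) (gs : seq B).

Lemma span_subset J J' gs : J `<=` J' -> span phi J gs `<=` span phi J' gs.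
Proof.
move=> JJ'; elim: gs => //= g b IH x [a xa].
by exists a; apply: IH.
Qed.

Lemma tower_cat J s1 s2 :
  tower phi J (s1 ++ s2) <-> tower phi (span phi J s2) s1 /\ tower phi J s2.
Proof.
elim: s1 => [|g b IH] /=; first by split=> [|[]].
rewrite span_cat; split=> [[gb /IH[sb s2J]]|[[gb sb] s2J]] //.
by split=> //; apply/IH.
Qed.

Lemma tower_simple J gs : submod phi J -> (forall g, g \in gs -> forall a,
    J (phi a * g) \/ exists a', J (phi a' * phi a * g - g)) ->
  tower phi J gs.
Proof.
move=> Js; elim: gs => //= g b IH gJ; split.
  move=> a; have [?|[a' ?]] := gJ g (mem_head _ _) a.
    by left; apply: span_base.
  by right; exists a'; apply: span_base.
by apply: IH => h hb; apply: gJ; rewrite in_cons hb orbT.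
Qed.

Lemma tower_mul J J' x gs : (forall y, J y -> J' (x * y)) ->
  tower phi J gs -> tower phi J' [seq x * g | g <- gs].
Proof.
move=> JJ'.
have H s y : span phi J s y -> span phi J' [seq x * g | g <- s] (x * y).
  elim: s y => [|g s IH] y /=; first exact: JJ'.
  by move=> [a ya]; exists a; rewrite mulrCA -mulrBr; apply: IH.
elim: gs => //= g b IH [gb /IH tb]; split=> // a.
have [ga|[a' ga]] := gb a; [left|right; exists a'].
  by rewrite mulrCA; apply: H.
by rewrite mulrCA -mulrBr; apply: H.
Qed.

(** Dependences transfer from the second list to the first, so an entry essential in the first is
    essential in the second; the common index list keeps them aligned. *)
Lemma ess_le (J1 : set B) gs1 (S2 B2 : comNzRingType)
    (phi2 : {rmorphism S2 -> B2}) (J2 : set B2) (I : eqType) (f1 : I -> B)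
    (f2 : I -> B2) (s : seq I) :
  (forall s1 i s2, s = s1 ++ i :: s2 ->
     span phi2 J2 (map f2 s2) (f2 i) -> span phi J1 (map f1 s2 ++ gs1) (f1 i)) ->
  (ess phi (span phi J1 gs1) (map f1 s) <= ess phi2 J2 (map f2 s))%N.
Proof.
elim: s => //= i s IH fs; rewrite leq_add //; last first.
  by apply: IH => s1 j s2 sE; apply: (fs (i :: s1)); rewrite sE.
case: asboolP => // nf1; case: asboolP => // f2s.
by case: nf1; have := fs [::] i s erefl f2s; rewrite span_cat.
Qed.

End SpanTheory.

Section Lin.
Variable B : comNzRingType.
Implicit Types (J K : set B) (gs : seq B).

Lemma idealM K a x : ideal K -> K x -> K (a * x).
Proof. by move=> Ks; apply: (@submodM _ _ idfun K a x). Qed.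

Lemma idealD K x y : ideal K -> K x -> K y -> K (x + y).
Proof. exact: submodD. Qed.

Lemma idealN K x : ideal K -> K x -> K (- x).
Proof. exact: submodN. Qed.

Lemma idealB K x y : ideal K -> K x -> K y -> K (x - y).
Proof. exact: submodB. Qed.

Lemma ideal_full K : ideal K -> K 1 -> K = setT.
Proof.
by move=> Ks K1; apply/seteqP; split=> // x _; rewrite -[x]mulr1; apply: idealM.
Qed.

(** For an ideal [K], the product of [K] with the ideal of [gs]. Unlike [span], it records how deep
    the coefficients lie, as convergence and Artin-Rees estimates require. *)
Fixpoint lin K gs x : Prop :=
  if gs is g :: b then exists2 a, K a & lin K b (x - a * g) else x = 0.

Lemma lin_ideal K gs : ideal K -> ideal (lin K gs).
Proof.
move=> Ks; elim: gs => [|g b [b0 bM]] /=.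
  by split=> // a x y -> ->; rewrite mulr0 addr0.
split; first by exists 0; [case: Ks|rewrite mul0r subr0].
move=> c x y [a1 Ka1 xa] [a2 Ka2 ya]; exists (c * a1 + a2); first by apply: Ks.2.
have -> : idfun c * x + y - (c * a1 + a2) * g =
  c * (x - a1 * g) + (y - a2 * g) by rewrite /=; ring.
exact: bM.
Qed.

Lemma lin_mem K gs a g : ideal K -> K a -> g \in gs -> lin K gs (a * g).
Proof.
move=> Ks Ka; elim: gs => //= h b IH; rewrite in_cons => /orP[/eqP->|/IH gb].
  by exists a => //; rewrite subrr; case: (lin_ideal b Ks).
by exists 0; rewrite ?mul0r ?subr0 //; case: Ks.
Qed.

Lemma lin_min K K' gs : ideal K' -> (forall a g, K a -> g \in gs -> K' (a * g)) ->
  lin K gs `<=` K'.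
Proof.
move=> Ks; elim: gs => [|g b IH] KK' x /=; first by move->; case: Ks.
move=> [a Ka xa]; apply: (submod_subr Ks (y := a * g)).
  by apply: KK' => //; rewrite mem_head.
by apply: IH xa => c h Kc hb; apply: KK' => //; rewrite in_cons hb orbT.
Qed.

Lemma ispan_lin J gs x : ispan J gs x -> exists2 y, lin setT gs y & J (x - y).
Proof.
elim: gs x => [|g b IH] x /=; first by exists 0; rewrite ?subr0.
move=> [a /IH[y yb Jxy]]; exists (y + a * g).
  by exists a => //; rewrite addrK.
by rewrite opprD addrA addrAC.
Qed.

Lemma lin_ispan J K gs : ideal J -> lin K gs `<=` ispan J gs.
Proof.
move=> Js; apply: lin_min; first exact: span_submod.
move=> a g _ gg; apply: idealM; first exact: span_submod.
exact: mem_span.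
Qed.

Definition pw (M : idealr B) n : set B := [set x | x \in idealX M n].

Lemma pw_ideal (M : idealr B) n : ideal (pw M n).
Proof. exact: idealX_closed. Qed.

Lemma pw_mul (M : idealr B) i j x y : pw M i x -> pw M j y -> pw M (i + j) (x * y).
Proof. exact: idealX_mul. Qed.

Lemma pwT (M : idealr B) : pw M 0 = setT.
Proof. by apply/seteqP; split. Qed.

Lemma pw_leq (M : idealr B) i j : (i <= j)%N -> pw M j `<=` pw M i.
Proof.
move=> /subnK <-; elim: (j - i)%N => // k IH x; rewrite addSn => /idealXS_sub.
exact: IH.
Qed.

Lemma pw1 (M : idealr B) x : pw M 1 x <-> x \in M.
Proof.
split=> [|xM]; first exact: idealXS_sub1.
by apply/idealXSP; exists [:: (x, 1)]; rewrite ?big_seq1 ?mulr1 //= xM.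
Qed.

Lemma pwX (M : idealr B) x n : x \in M -> pw M n (x ^+ n).
Proof.
move=> xM; elim: n => // n IH; rewrite exprS -add1n.
by apply: pw_mul IH; apply/pw1.
Qed.

Fixpoint mon (t : seq B) (a : seq nat) : B :=
  match t, a with
  | x :: t', n :: a' => x ^+ n * mon t' a'
  | _, _ => 1
  end.

Lemma mon_madd t a c : size a = size t -> size c = size t ->
  mon t (madd a c) = mon t a * mon t c.
Proof.
elim: t a c => [|x t IH] [|n a] [|k c] //=; rewrite ?mulr1 // => -[sa] [sc].
by rewrite /madd /= -/(madd a c) IH // exprD; ring.
Qed.

Lemma mon0 t : mon t (nseq (size t) 0%N) = 1.
Proof. by elim: t => //= x t ->; rewrite expr0 mulr1. Qed.

Lemma mon_delta t x : x \in t ->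
  exists c, [/\ size c = size t, sumn c = 1%N & mon t c = x].
Proof.
elim: t => //= y t IH; rewrite in_cons => /orP[/eqP->|/IH[c [sc c1 cx]]].
  exists (1%N :: nseq (size t) 0%N); rewrite /= size_nseq sumn_nseq mul0n.
  by rewrite mon0 mulr1 expr1.
by exists (0%N :: c); rewrite /= sc c1 cx expr0 mul1r.
Qed.

Lemma mon_pw (M : idealr B) t a : (forall x, x \in t -> x \in M) ->
  size a = size t -> pw M (sumn a) (mon t a).
Proof.
elim: t a => [|x t IH] [|n a] //= tM [sa]; apply: pw_mul.
  by apply: pwX; apply: tM; rewrite mem_head.
by apply: IH => // y yt; apply: tM; rewrite in_cons yt orbT.
Qed.

End Lin.
Arguments pw {B}.

Section Standard.
Variables (B : comNzRingType) (M : idealr B) (t : seq B).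
Local Notation r := (size t).
Local Notation mons n := (map (mon t) (monos r n)).

Definition generates := forall x, x \in M <-> lin setT t x.

(** The terms beyond [mon t a] for a local monomial order: higher degree, or the same degree and a
    larger exponent. *)
Definition standard_gt (a : seq nat) : set B :=
  ispan (pw M (sumn a).+1)
    [seq mon t b | b <- [seq b <- monos r (sumn a) | slt a b]].

(* [nonstd] holds of the leading exponents of the relations between the
   generators [t]; the other monomials of degree [n] represent a basis of
   [M^n / M^(n+1)]. *)
Definition nonstd a := standard_gt a (mon t a).

(** Under the hypotheses below, the dimension of [M^n / M^(n+1)] over the residue field, so that
    [hilbsum n] is the length of [B / M^n]. *)
Definition hilb n := count (fun a => ~~ `[< nonstd a >]) (monos r n).
Definition hilbsum n := (\sum_(i < n) hilb i)%N.

Hypothesis tM : generates.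

Lemma generators_in x : x \in t -> x \in M.
Proof. by move=> xt; apply/tM; rewrite -[x]mul1r; apply: lin_mem. Qed.

Lemma mon_pw_sumn a : size a = r -> pw M (sumn a) (mon t a).
Proof. exact: mon_pw generators_in. Qed.

Lemma mon_in n a : a \in monos r n -> pw M n (mon t a).
Proof. by rewrite mem_monos => /andP[/eqP sa /eqP <-]; apply: mon_pw_sumn. Qed.

Lemma pw_lin n k : pw M (n + k) `<=` lin (pw M k) (mons n).
Proof.
have Ms m := pw_ideal M m; elim: n => [|n IH] x.
  move=> xk; rewrite -[x]mulr1 -(mon0 t); apply: lin_mem => //.
  by apply: map_f; rewrite mem_monos size_nseq sumn_nseq mul0n eqxx.
rewrite addSn => /idealXSP[s /allP sP ->]; rewrite big_seq.
have Ls := lin_ideal (mons n.+1) (Ms k).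
apply: (submod_sum _ Ls) => p /sP /andP[/tM p1 /IH p2].
have HL : lin setT t `<=` fun y => lin (pw M k) (mons n.+1) (y * p.2).
  apply: lin_min => [|a x1 _ xt].
    split=> [|a y z yL zL]; first by rewrite mul0r; case: Ls.
    by rewrite mulrDl -mulrA; apply: Ls.2.
  rewrite -mulrA; apply: idealM => //.
  have HR : lin (pw M k) (mons n) `<=` fun y => lin (pw M k) (mons n.+1) (x1 * y).
    apply: lin_min => [|b g bk /mapP[c + ->]].
      split=> [|b y z yL zL]; first by rewrite mulr0; case: Ls.
      by rewrite mulrDr mulrCA; apply: Ls.2.
    rewrite mem_monos => /andP[/eqP sc /eqP nc].
    have [d [sd d1 <-]] := mon_delta xt.
    rewrite mulrCA -mon_madd //; apply: lin_mem => //; apply: map_f.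
    by rewrite mem_monos size_madd ?sd // sumn_madd ?sd // d1 nc add1n sc !eqxx.
  exact: HR.
exact: HL.
Qed.

Lemma span_mons n : ispan (pw M n.+1) (mons n) = pw M n.
Proof.
apply/seteqP; split.
  apply: span_min; [exact: pw_ideal|exact: pw_leq|].
  by move=> _ /mapP[a an ->]; apply: mon_in.
move=> x xn; apply: (@lin_ispan _ _ (pw M 0) _ (pw_ideal M n.+1)).
by apply: pw_lin; rewrite addn0.
Qed.

Definition mons_from j k := flatten [seq mons i | i <- iota j k].

Lemma span_mons_from j k : ispan (pw M (j + k)) (mons_from j k) = pw M j.
Proof.
elim: k j => [|k IH] j; first by rewrite addn0.
by rewrite /mons_from /= span_cat -addSnnS IH span_mons.
Qed.

Lemma span_mons_suffix n s1 a s2 : monos r n = s1 ++ a :: s2 ->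
  standard_gt a = ispan (pw M n.+1) (map (mon t) s2).
Proof.
move=> ns; have: a \in monos r n by rewrite ns mem_cat mem_head orbT.
rewrite mem_monos => /andP[_ /eqP an]; rewrite /standard_gt an ns filter_slt_suffix //.
by rewrite -ns pairwise_monos.
Qed.

Lemma ess_mons n : ess idfun (pw M n.+1) (mons n) = hilb n.
Proof.
rewrite /hilb; suff H s1 s2 : monos r n = s1 ++ s2 ->
    ess idfun (pw M n.+1) (map (mon t) s2) = count (fun a => ~~ `[< nonstd a >]) s2.
  exact: (H [::]).
elim: s2 s1 => //= a s IH s1 ns; rewrite (IH (rcons s1 a)) ?cat_rcons //.
by rewrite /nonstd (span_mons_suffix ns).
Qed.

Lemma ess_mons_from j k :
  ess idfun (pw M (j + k)) (mons_from j k) = (\sum_(i < k) hilb (j + i))%N.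
Proof.
elim: k j => [|k IH] j; first by rewrite big_ord0.
rewrite /mons_from /= ess_cat -addSnnS span_mons_from ess_mons IH big_ord_recl addn0.
by congr (_ + _)%N; apply: eq_bigr => i _; rewrite addSnnS.
Qed.

Lemma chain_pw_hilbsum n : chain idfun (hilbsum n) (pw M n) setT.
Proof.
have := chain_ess (mons_from 0 n) (pw_ideal M (0 + n)).
by rewrite ess_mons_from span_mons_from pwT.
Qed.

Lemma standard_gt_ideal a : ideal (standard_gt a).
Proof. exact: span_submod (pw_ideal M _). Qed.

(** Multiplication by a monomial respects the monomial order; this makes the leading exponents of
    relations an up-set. *)
Lemma standard_gt_mon a c y : size a = r -> size c = r ->
  standard_gt a y -> standard_gt (madd a c) (mon t c * y).
Proof.
move=> sa sc; have Gs := standard_gt_ideal (madd a c).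
apply: (span_min (K := fun y => standard_gt (madd a c) (mon t c * y))).
- split=> [|b u v uG vG]; first by rewrite mulr0; case: Gs.
  by rewrite mulrDr mulrCA; apply: Gs.2.
- move=> u ua; apply: span_base; rewrite sumn_madd ?sa // -addSn mulrC.
  by apply: pw_mul => //; apply: mon_pw_sumn.
- move=> _ /mapP[b + ->]; rewrite mem_filter mem_monos.
  move=> /andP[ab /andP[/eqP sb /eqP nb]].
  rewrite mulrC -mon_madd //; apply: mem_span; first exact: pw_ideal.
  rewrite map_f // mem_filter slt_madd ?sa ?sb //= mem_monos.
  by rewrite size_madd ?sc // !sumn_madd ?sa ?sb // nb !eqxx.
Qed.

Lemma upset_nonstd : upset r nonstd.
Proof.
by move=> a c sa sc na; rewrite /nonstd mon_madd // mulrC; apply: standard_gt_mon.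
Qed.

Lemma evpoly_hilbsum : evpoly hilbsum.
Proof. exact: evpoly_sum (evpoly_count_monos upset_nonstd). Qed.

Hypothesis resM : forall a, a \in M \/ exists a', a' * a - 1 \in M.

(** Inverses modulo [M] make [M^n / M^(n+1)] a vector space. They also exist for the irrelevant
    ideal of the graded ring, which need not be local. *)
Lemma simple_pw n g a : pw M n g ->
  pw M n.+1 (a * g) \/ exists a', pw M n.+1 (a' * a * g - g).
Proof.
move=> gn; have [aM|[a' aM]] := resM a; [left|right; exists a'].
  by rewrite -add1n; apply: pw_mul => //; apply/pw1.
by rewrite -{2}[g]mul1r -mulrBl -add1n; apply: pw_mul => //; apply/pw1.
Qed.

Lemma tower_mons_from j k : tower idfun (pw M (j + k)) (mons_from j k).
Proof.
elim: k j => [|k IH] j //; rewrite /mons_from /= -addSnnS; apply/tower_cat.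
split=> //; rewrite span_mons_from; apply: tower_simple; first exact: pw_ideal.
by move=> _ /mapP[b bj ->] a; apply: simple_pw; apply: mon_in.
Qed.

(** Together with [chain_pw_hilbsum], this identifies [hilbsum n] with the length of [B / M^n]. *)
Lemma chain_pw_bound l n T :
  ideal T -> chain idfun l (pw M n) T -> (l <= hilbsum n)%N.
Proof.
move=> Ts lT; have := ess_mons_from 0 n; rewrite /hilbsum /= => <-.
apply: chain_bound Ts _ lT; [exact: pw_ideal|exact: tower_mons_from|].
by rewrite (span_mons_from 0 n) pwT.
Qed.

Lemma hilbsum_gt0 n : (0 < n)%N -> (0 < hilbsum n)%N.
Proof.
case: n => // n _; apply: (@chain_pw_bound 1 n.+1 setT) => //.
exists (pw M n.+1); split=> //; first exact: pw_ideal.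
by exists 1 => // /idealXS_sub1; rewrite idealr1.
Qed.

Lemma sum_size_monos s n : (\sum_(i < n) size (monos s i) <= n ^ s)%N.
Proof.
have sizeS q k : size (monos q.+1 k) = (\sum_(j < k.+1) size (monos q j))%N.
  rewrite -(count_predT (monos q.+1 k)) count_monosS.
  rewrite (reindex_inj rev_ord_inj) /=; apply: eq_bigr => j _.
  by rewrite count_predT; congr (size (monos q _)); have := ltn_ord j; lia.
elim: s n => [|s IH] n.
  rewrite expn0; case: n => [|n]; first by rewrite big_ord0.
  by rewrite big_ord_recl big1.
apply: leq_trans (_ : (\sum_(i < n) n ^ s <= _)%N); last first.
  by rewrite sum_nat_const card_ord expnS.
apply: leq_sum => i _; rewrite sizeS; apply: leq_trans (IH _) _.
by case: s {IH} => // s; rewrite leq_exp2r.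
Qed.

(* Modulo [M ^ n], the ring is generated by the products of the at most
   [n ^ size c] monomials of degree less than [n] in [c] with the monomials of
   degree at most [N] in [t]. *)
Lemma chain_pw_growth (c : seq B) N : (forall x, x \in c -> x \in M) ->
    (forall n, pw M N `<=` ispan (pw M n) c) ->
  exists C, forall n l T, ideal T -> chain idfun l (pw M n) T ->
    (l <= C * n ^ size c)%N.
Proof.
move=> cM cN; exists (size (mons_from 0 N.+1)) => n l T Ts lT.
(* Descending induction on the degree [i]: monomials of degree [n] in [c] already lie in [M^n], and
   degree [0] provides the generator [1]. *)
suff H k i : (i + k = n)%N -> exists gs, [/\ tower idfun (pw M n) gs,
    (size gs <= size (mons_from 0 N.+1) *
       \sum_(j < k) size (monos (size c) (i + j)))%N &
    forall a, a \in monos (size c) i -> ispan (pw M n) gs (mon c a)].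
  have [gs [tgs sgs gs1]] := H n 0%N erefl.
  have Tgs : T `<=` ispan (pw M n) gs.
    rewrite (ideal_full (span_submod gs (pw_ideal M n))) //.
    rewrite -(mon0 c); apply: gs1.
    by rewrite mem_monos size_nseq sumn_nseq mul0n eqxx.
  apply: leq_trans (chain_bound (pw_ideal M n) tgs Ts Tgs lT) _.
  apply: leq_trans (ess_size _ _ _) (leq_trans sgs _).
  by rewrite leq_mul2l; apply/orP; right; exact: sum_size_monos.
elim: k i => [|k IH] i; rewrite ?addn0 => ikn.
  exists [::]; split=> //.
  move=> a; rewrite mem_monos => /andP[/eqP sa /eqP ai] /=.
  by rewrite -ikn -ai; apply: mon_pw.
have [|gs [tgs sgs gsP]] := IH i.+1; first by rewrite addSnnS.
exists (flatten [seq [seq mon c a * g | g <- mons_from 0 N.+1]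
         | a <- monos (size c) i] ++ gs).
pose J := ispan (pw M n) gs; have Js : ideal J := span_submod gs (pw_ideal M n).
(* Multiples of [mon c a] by [M^(N+1)] are spanned by monomials of the next degree, so generators of
   [B / M^(N+1)] are the only new coefficients of [mon c a]. *)
have cJ a : a \in monos (size c) i -> forall y, pw M N.+1 y -> J (mon c a * y).
  rewrite mem_monos => /andP[/eqP sa /eqP ai] y /(pw_leq (leqnSn N))/(cN n).
  apply: (span_min (K := fun z => J (mon c a * z))) => [|z zn|x xc].
  - split=> [|b u v uJ vJ]; first by rewrite mulr0; case: Js.
    by rewrite mulrDr mulrCA; apply: Js.2.
  - by apply: idealM => //; apply: span_base.
  - have [d [sd d1 <-]] := mon_delta xc; rewrite -mon_madd //; apply: gsP.
    by rewrite mem_monos size_madd ?sa // sd sumn_madd ?sa // ai d1 addn1 !eqxx.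
split.
- apply/tower_cat; split=> //; rewrite -/J.
  suff H s : {subset s <= monos (size c) i} -> tower idfun J
      (flatten [seq [seq mon c a * g | g <- mons_from 0 N.+1] | a <- s]) by apply: H.
  elim: s => //= a s IHs sP; apply/tower_cat; split; last first.
    by apply: IHs => b bs; apply: sP; rewrite in_cons bs orbT.
  apply: tower_mul (tower_mons_from 0 N.+1) => y yN.
  by apply: span_base; apply: cJ => //; apply: sP; rewrite mem_head.
- rewrite size_cat big_ord_recl addn0 mulnDr; apply: leq_add.
    rewrite size_flatten /shape -map_comp.
    elim: (monos (size c) i) => //= a s IHs.
    by rewrite size_map mulnS leq_add.
  apply: leq_trans sgs _; rewrite leq_mul2l; apply/orP; right.
  by apply: leq_sum => j _; rewrite addSnnS.
- move=> a ai; rewrite span_cat.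
  apply: mem_span => //; apply/flatten_mapP; exists a => //.
  apply/mapP; exists 1; rewrite ?mulr1 // -(mon0 t).
  by rewrite mem_cat map_f // mem_monos size_nseq sumn_nseq mul0n eqxx.
Qed.

End Standard.

(** * Chains of primes and Kronecker's theorem *)

Section Primes.
Variable B : comNzRingType.
Implicit Types (I K P Q : set B) (xs : seq B).

Definition primeI P :=
  [/\ ideal P, ~ P 1 & forall x y, P (x * y) -> P x \/ P y].

Lemma primeIX P x n : primeI P -> P (x ^+ n) -> P x.
Proof.
move=> [_ P1 PM]; elim: n => [|n IH]; first by rewrite expr0.
by rewrite exprS => /PM[].
Qed.

Lemma ideal_idealr K : ideal K -> ~ K 1 -> exists J : idealr B, forall x, x \in J <-> K x.
Proof.
move=> [K0 KM] K1; have Kc : idealr_closed [pred x | `[< K x >]].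
  split; [exact/asboolP|exact/asboolP|].
  by move=> a x y /asboolP Kx /asboolP Ky; apply/asboolP/KM.
pose J : idealr B := HB.pack_for (idealr B) (fun x => `[< K x >]) (isIdealr.Build B _ Kc).
by exists J => x; split=> /asboolP.
Qed.

Lemma prime_idealr_primeI (J : prime_idealr B) : primeI [set x | x \in J].
Proof.
split=> [||x y].
- split=> [|a x y]; first exact: idealr0.
  by move=> xJ yJ; apply: rpredD => //; apply: idealMr.
- by rewrite /= idealr1.
- by rewrite /= prime_idealrM => /orP.
Qed.

Lemma primeI_prime_idealr P : primeI P ->
  exists J : prime_idealr B, forall x, x \in J <-> P x.
Proof.
move=> [[P0 PM] P1 PP]; have Pc : idealr_closed [pred x | `[< P x >]].
  split; [exact/asboolP|exact/asboolP|].
  by move=> a x y /asboolP Kx /asboolP Ky; apply/asboolP/PM.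
have Pp : prime_idealr_closed [pred x | `[< P x >]].
  by move=> x y /asboolP/PP[/asboolP xP|/asboolP yP]; apply/orP; [left|right].
pose J : prime_idealr B := HB.pack_for (prime_idealr B) (fun x => `[< P x >])
  (isIdealr.Build B _ Pc) (isPrimeIdealrClosed.Build B _ Pp).
by exists J => x; split=> /asboolP.
Qed.

Lemma has_prime_chainP d : has_prime_chain B d <->
  exists P : nat -> set B, (forall i, primeI (P i)) /\
    forall i, (i < d)%N -> P i `<=` P i.+1 /\ exists2 x, P i.+1 x & ~ P i x.
Proof.
split=> [[J JP]|[P [Pp PP]]].
  exists (fun i => [set x | x \in J i]); split=> [i|i /JP[JJ nJ]].
    exact: prime_idealr_primeI.
  split=> //; apply: contrapT => nex; apply: nJ => x xJ.
  by apply: contrapT => nx; apply: nex; exists x.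
have [J JE] := choice (fun i => primeI_prime_idealr (Pp i)).
exists J => i /PP[PS [x Px nPx]]; split=> [y /JE/PS/JE //|JJ].
by apply/nPx/JE/JJ/JE.
Qed.

(** An ideal maximal among those avoiding a multiplicative set is prime. Maximality is kept in the
    conclusion: for [S = [set 1]] it yields a maximal ideal. *)
Lemma prime_exists I (S : set B) : ideal I -> S 1 ->
    (forall x y, S x -> S y -> S (x * y)) -> (forall x, I x -> ~ S x) ->
  exists P, [/\ primeI P, I `<=` P, (forall x, P x -> ~ S x) &
    forall K, ideal K -> P `<=` K -> (forall x, K x -> ~ S x) -> K `<=` P].
Proof.
move=> Is S1 SM IS.
pose good K := [/\ ideal K, I `<=` K & forall x, K x -> ~ S x].
have [|P [PP Pmax]] := @Zorn_bigcup B [set K | K = set0 \/ good K].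
  move=> F FP Ftot.
  have [[K [FK gK]]|nF] := pselect (exists K, F K /\ good K); last first.
    left; apply/seteqP; split=> // x [K FK Kx].
    have [K0|gK] := FP K FK; first by rewrite K0 in Kx.
    by case: nF; exists K.
  right; have [Ks IK _] := gK; split; last first.
  - move=> x [L FL Lx]; have [L0|[_ _ LS]] := FP L FL; last exact: LS.
    by rewrite L0 in Lx.
  - by move=> x /IK Kx; exists K.
  split=> [|a x y [L1 FL1 L1x] [L2 FL2 L2y]]; first by exists K => //; case: Ks.
  have gd L z : F L -> L z -> ideal L.
    by move=> /FP[-> //|[]].
  have [L12|L21] := Ftot _ _ FL1 FL2.
    by exists L2 => //; apply: (gd _ _ FL2 L2y).2 => //; apply: L12.
  by exists L1 => //; apply: (gd _ _ FL1 L1x).2 => //; apply: L21.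
have {PP} [Ps IP PS] : good P.
  case: PP => // P0; exfalso; apply: (Pmax I); last by right; split.
  rewrite P0; split=> // /(_ 0); apply; by case: Is.
have Kmax K : ideal K -> P `<=` K -> (forall x, K x -> ~ S x) -> K `<=` P.
  move=> Ks PK KS; apply: contrapT => nKP.
  apply: (Pmax K); last by right; split=> // x /IP/PK.
  by split.
exists P; split=> //; split=> [//|P1|x y Pxy]; first exact: PS P1 S1.
have ext z : ~ P z -> exists2 s, S s & ispan P [:: z] s.
  move=> nPz; apply: contrapT => nex; apply: nPz.
  apply: (Kmax (ispan P [:: z])); [exact: span_submod|exact: span_base| |].
    by move=> s sP Ss; apply: nex; exists s.
  by apply: mem_span => //; rewrite mem_head.
apply: contrapT => /not_orP[/ext[s1 Ss1 [a sa]] /ext[s2 Ss2 [b sb]]].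
apply: (PS (s1 * s2)); last exact: SM.
have -> : s1 * s2 = s2 * (s1 - idfun a * x) + (a * x) * (s2 - idfun b * y) +
  (a * b) * (x * y) by rewrite /=; ring.
by apply: idealD => //; [apply: idealD => //|]; apply: idealM.
Qed.

Lemma local_ring_unit (m : idealr B) x : local_ring m -> x \notin m ->
  exists y, y * x = 1.
Proof.
move=> [_ mmax] xm; apply: contrapT => nx.
pose I : set B := [set y | exists a, y = a * x].
have Is : ideal I.
  split=> [|a y z [b ->] [c ->]]; first by exists 0; rewrite mul0r.
  by exists (a * b + c); rewrite /= mulrDl mulrA.
have [|||P [[Ps P1 _] IP _ Pmax]] := @prime_exists I [set 1] Is.
- by [].
- by move=> y z -> ->; rewrite /= mulr1.
- by move=> y [a ->] /= ax; apply: nx; exists a.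
have [J JE] := ideal_idealr Ps P1.
have /mmax Jm : maximal_ideal J.
  move=> K JK y; apply/idP/idP => [yK|/JK//]; apply/JE.
  apply: (Pmax [set z | z \in K]) => //.
  - split=> [|a u v uK vK]; first exact: idealr0.
    by apply: rpredD => //; apply: idealMr.
  - by move=> z /JE/JK.
  - by move=> z zK /= z1; move: zK; rewrite z1 /= idealr1.
by move: xm; rewrite -Jm => /negP; apply; apply/JE/IP; exists 1; rewrite mul1r.
Qed.

(* The iterated boundary monoid of Lombardi and Quitte: its avoiding [0] means
   that there is a chain of primes separated by the elements of [xs]. *)
Fixpoint bmon xs : set B :=
  if xs is x :: xs' then
    [set y | exists n s a, bmon xs' s /\ y = x ^+ n * (s + a * x)]
  else [set 1].

Lemma bmon1 xs : bmon xs 1.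
Proof.
elim: xs => //= x xs IH; exists 0%N, 1, 0; split=> //.
by rewrite expr0 mul0r addr0 mulr1.
Qed.

Lemma bmonM xs y z : bmon xs y -> bmon xs z -> bmon xs (y * z).
Proof.
elim: xs y z => [|x xs IH] y z /=; first by move=> -> ->; rewrite mulr1.
move=> [n [s [a [xs_s ->]]]] [k [u [b [xs_u ->]]]].
exists (n + k)%N, (s * u), (s * b + a * u + a * b * x); split; first exact: IH.
by rewrite exprD; ring.
Qed.

(** If a prime [P] avoids the monoid of [x :: xs], then [P + (x)] avoids the monoid of [xs], which
    gives the next prime; and [x], an element of the first monoid, is not in [P]. *)
Lemma bmon_prime_chain xs I : ideal I -> (forall y, I y -> ~ bmon xs y) ->
  exists P : nat -> set B, [/\ forall i, primeI (P i), I `<=` P 0%N &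
    forall i, (i < size xs)%N -> P i `<=` P i.+1 /\ exists2 x, P i.+1 x & ~ P i x].
Proof.
elim: xs I => [|x xs IH] I Is IS.
  have [|||P [Pp IP _ _]] := @prime_exists I (bmon [::]) Is => //.
    by move=> y z -> ->; rewrite /= mulr1.
  by exists (fun=> P).
have [P [Pp IP PS _]] := prime_exists Is (bmon1 _) (@bmonM (x :: xs)) IS.
have Ps : ideal P by case: Pp.
have [|y [a ya] xsy|Q [Qp PQ Qch]] := IH (ispan P [:: x]).
- exact: span_submod.
- apply: PS ya _; exists 0%N, y, (- a); split=> //=.
  by rewrite expr0 mul1r mulNr.
exists (fun i => if i is j.+1 then Q j else P); split=> [[|i]|//|[_|i iP]] //.
  split; first by move=> y Py; apply/PQ/span_base.
  exists x; first by apply: PQ; apply: mem_span => //; rewrite mem_head.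
  move=> Px; apply: PS Px _; exists 1%N, 1, 0; split; first exact: bmon1.
  by rewrite expr1 mul0r addr0 mulr1.
exact: Qch.
Qed.

Lemma prime_chain_bmon xs (P : nat -> set B) y : (forall i, primeI (P i)) ->
    (forall i, (i < size xs)%N ->
      [/\ P i `<=` P i.+1, P i.+1 xs`_i & ~ P i xs`_i]) ->
  bmon xs y -> ~ P 0%N y.
Proof.
elim: xs P y => [|x xs IH] P y Pp Pxs; first by move=> ->; case: (Pp 0%N).
move=> /= [n [s [a [xs_s ->]]]] P0.
have /= [P01 P1x nP0x] := Pxs 0%N isT.
have [_ _ PM] := Pp 0%N.
have [/(primeIX (Pp 0%N))//|/P01 P1sx] := PM _ _ P0.
have [Ps _ _] := Pp 1%N.
have P1s : P 1%N s.
  rewrite -(addrK (a * x) s); apply: idealB => //.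
  exact: idealM.
by apply: (IH (fun i => P i.+1) s) P1s => // i; apply: (Pxs i.+1).
Qed.

(** For [b] as long as [xs], the ideal generated by the monomials in [xs] with lexicographically
    larger exponent, in the nested form that matches [bmon]. *)
Fixpoint lexgt xs (b : seq nat) : set B :=
  match xs, b with
  | x :: xs', n :: b' =>
    [set y | exists y' a, lexgt xs' b' y' /\ y = x ^+ n * (y' + a * x)]
  | _, _ => [set 0]
  end.

Lemma lexgt_ideal xs b : ideal (lexgt xs b).
Proof.
elim: xs b => [|x xs IH] [|n b]; try by split=> // a x' y -> ->; rewrite mulr0 addr0.
have [L0 LM] := IH b; split=> [|a y z [y' [c [yL ->]]] [z' [d [zL ->]]]].
  by exists 0, 0; rewrite mul0r addr0 mulr0.
exists (a * y' + z'), (a * c + d); split; first exact: LM.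
by rewrite /=; ring.
Qed.

Lemma lexgt_mon xs b c : size b = size xs -> size c = size xs ->
  slt b c -> lexgt xs b (mon xs c).
Proof.
elim: xs b c => [|x xs IH] [|n b] [|k c] //= [sb] [sc].
move=> /orP[nk|/andP[/eqP<- bc]].
  exists 0, (x ^+ (k - n.+1) * mon xs c); split; first by case: (lexgt_ideal xs b).
  by rewrite add0r -[in LHS](subnKC nk) exprD exprS; ring.
exists (mon xs c), 0; split; first exact: IH.
by rewrite mul0r addr0.
Qed.

Lemma bmon_lexgt xs b y : size b = size xs -> lexgt xs b y -> bmon xs (mon xs b + y).
Proof.
elim: xs b y => [|x xs IH] [|n b] y //= => [_ ->|[sb] [y' [a [yL ->]]]].
  by rewrite addr0.
exists n, (mon xs b + y'), a; split; first exact: IH.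
by ring.
Qed.

(** A monomial dependent on later ones, minus its expression by them, would be an element of
    [bmon xs] equal to [0]. *)
Lemma ess_lex (S : comNzRingType) (phi : {rmorphism S -> B}) xs (bs : seq (seq nat)) :
  ~ bmon xs 0 -> pairwise slt bs -> (forall b, b \in bs -> size b = size xs) ->
  ess phi [set 0] (map (mon xs) bs) = size bs.
Proof.
move=> nxs; elim: bs => //= b bs IH /andP[/allP bbs /IH {}IH] sbs.
rewrite IH => [|c cbs]; last by apply: sbs; rewrite in_cons cbs orbT.
case: asboolP => // bsb; case: nxs; have Ls := lexgt_ideal xs b.
have sb : size b = size xs by apply: sbs; rewrite mem_head.
have : lexgt xs b (mon xs b).
  apply: (span_min (phi := phi)) bsb.
  - by split=> [|a x y xL yL]; [case: Ls|apply: Ls.2].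
  - by move=> _ ->; case: Ls.
  - move=> _ /mapP[c cbs ->]; apply: lexgt_mon; rewrite ?sb //; last exact: bbs.
    by apply: sbs; rewrite in_cons cbs orbT.
by move=> /(idealN Ls)/(bmon_lexgt sb); rewrite subrr.
Qed.

Variable M : set B.
Hypothesis Mp : primeI M.

(* A prime [Q] that contains [x ^+ n * (s + b * x)] and [x + a * (s + b * x)]
   but not [a] contains [x] and [s]: going down the list, [y] in [Q] forces
   [a] in [Q]. *)
Lemma bmon_reduce xs a y : M a -> (forall x, x \in xs -> M x) ->
    bmon (rcons xs a) y ->
  exists cs, [/\ size cs = size xs, forall c, c \in cs -> M c &
    forall Q, primeI Q -> Q `<=` M -> (forall c, c \in cs -> Q c) ->
      (Q y -> Q a) /\ (Q a -> forall x, x \in xs -> Q x)].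
Proof.
have [Ms M1 _] := Mp; move=> Ma; elim: xs y => [|x xs IH] y xsM /=.
  move=> [n [s [b [-> ->]]]]; exists [::]; split=> // Q Qp QM _.
  split=> // Qy; have [_ _ QQ] := Qp.
  have [/(primeIX Qp)//|/QM M1ba] := QQ _ _ Qy.
  case: M1; rewrite -(addrK (b * a) 1); apply: idealB => //.
  exact: idealM.
move=> [n [s [b [xs_s ->]]]].
have [|cs [scs csM csQ]] := IH s _ xs_s.
  by move=> z zxs; apply: xsM; rewrite in_cons zxs orbT.
pose w := s + b * x.
exists (x + a * w :: cs); split=> /=; first by rewrite scs.
  move=> c; rewrite in_cons => /orP[/eqP->|/csM//].
  apply: idealD => //; first by apply: xsM; rewrite mem_head.
  by rewrite mulrC; apply: idealM.
move=> Q Qp QM Qcs; have [Qs _ QQ] := Qp.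
have Qc : Q (x + a * w) by apply: Qcs; rewrite mem_head.
have [|Q1 Q2] := csQ Q Qp QM.
  by move=> c cc; apply: Qcs; rewrite in_cons cc orbT.
split=> [Qy|Qa z]; last first.
  rewrite in_cons => /orP[/eqP->|]; last exact: Q2.
  apply: (submod_subr Qs (y := - (a * w))); last by rewrite opprK.
  by apply: idealN => //; rewrite mulrC; apply: idealM.
have [//|nQa] := pselect (Q a).
have [Qx Qw] : Q x /\ Q w.
  have [/(primeIX Qp) Qx|Qw] := QQ _ _ Qy; split=> //.
    have Qaw : Q (a * w) by rewrite -[a * w](addKr x) addrC; apply: idealB.
    by have [] := QQ _ _ Qaw.
  by rewrite -(addrK (a * w) x); apply: idealB => //; apply: idealM.
apply: Q1; rewrite -(addrK (b * x) s); apply: idealB => //.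
exact: idealM.
Qed.

(** Without chains of length [e.+1], [0] lies in the monoid of any [e.+1] elements, so [bmon_reduce]
    replaces [e] elements and one more by [e] elements. The list [bs] is absorbed one element at a
    time, starting from [e] zeros. *)
Lemma kronecker e (bs : seq B) :
    ~ has_prime_chain B e.+1 -> (forall b, b \in bs -> M b) ->
  exists cs, [/\ size cs = e, forall c, c \in cs -> M c &
    forall Q, primeI Q -> Q `<=` M -> (forall c, c \in cs -> Q c) ->
      forall b, b \in bs -> Q b].
Proof.
move=> nch; have [Ms _ _] := Mp.
have col xs : size xs = e.+1 -> bmon xs 0.
  move=> sxs; apply: contrapT => nxs; apply/nch/has_prime_chainP.
  have [||P [Pp _ PP]] := @bmon_prime_chain xs [set 0].
  - by split=> // a x y -> ->; rewrite mulr0 addr0.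
  - by move=> y ->.
  by exists P; rewrite -sxs.
elim: bs => [|b bs IH] bM.
  by exists (nseq e 0); rewrite size_nseq; split=> // c /nseqP[-> _]; case: Ms.
have [|cs [scs csM csQ]] := IH.
  by move=> c cbs; apply: bM; rewrite in_cons cbs orbT.
have bb : M b by apply: bM; rewrite mem_head.
have [|ds [sds dsM dsQ]] := bmon_reduce bb csM (col (rcons cs b) _).
  by rewrite size_rcons scs.
exists ds; split=> // [|Q Qp QM Qds c]; first by rewrite sds.
have [Qb Qcs] := dsQ Q Qp QM Qds.
have {}Qb : Q b by apply: Qb; case: Qp => -[].
by rewrite in_cons => /orP[/eqP->//|]; apply: csQ => //; apply: Qcs.
Qed.

End Primes.

Section LocalParameters.
Variables (B : comNzRingType) (M : idealr B) (t : seq B).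
Hypotheses (tM : generates M t) (Mp : primeI [set x | x \in M]).

(** Pigeonhole: some exponent in [a] is at least [n]. *)
Lemma mon_large (K : set B) n a : ideal K -> size a = size t ->
  (forall x, x \in t -> K (x ^+ n)) -> (size t * n < sumn a)%N -> K (mon t a).
Proof.
move=> Ks; elim: t a => [|x s IH] [|k a] //= [sa] sK; rewrite mulSn => an.
have [nk|kn] := leqP n k.
  rewrite -(subnK nk) exprD mulrAC; apply: idealM => //.
  by apply: sK; rewrite mem_head.
apply: idealM => //; apply: IH => //; last by lia.
by move=> y ys; apply: sK; rewrite in_cons ys orbT.
Qed.

(** The multiplier [u] stands for localization at [M]. If no [u * b ^+ n] with [u] outside [M] were
    in the ideal of [cs], a prime containing [cs] and avoiding all of them would lie inside [M] and
    miss [b], against Kronecker. *)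
Lemma local_parameters e : ~ has_prime_chain B e.+1 ->
  exists cs u N, [/\ size cs = e, forall c, c \in cs -> c \in M, u \notin M &
    forall x, pw M N x -> ispan [set 0] cs (u * x)].
Proof.
move=> nch; have [Ms M1 MM] := Mp.
have tinM := generators_in tM.
have [cs [scs csM csQ]] := kronecker Mp nch tinM.
have z0 : ideal ([set 0] : set B).
  by split=> // a x y -> ->; rewrite mulr0 addr0.
have Cs : ideal (ispan [set 0] cs) by apply: span_submod.
have bP b : b \in t -> exists u n, u \notin M /\ ispan [set 0] cs (u * b ^+ n).
  move=> bt; apply: contrapT => nb.
  pose S : set B := [set y | exists u n, u \notin M /\ y = u * b ^+ n].
  have [|||P [Pp CP PS _]] := @prime_exists _ (ispan [set 0] cs) S Cs.
  - by exists 1, 0%N; rewrite expr0 mulr1 idealr1.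
  - move=> _ _ [u [n [uM ->]]] [v [k [vM ->]]]; exists (u * v), (n + k)%N.
    by split; [apply/negP => /MM[]; apply/negP|rewrite exprD; ring].
  - by move=> y yC [u [n [uM yE]]]; apply: nb; exists u, n; rewrite -yE.
  have PM : P `<=` [set x | x \in M].
    move=> x Px; apply: contrapT => xM; apply: PS Px _.
    by exists x, 0%N; rewrite expr0 mulr1; split=> //; apply/negP.
  have Pb : P b by apply: csQ bt => // c cc; apply: CP; apply: mem_span.
  by apply: PS Pb _; exists 1, 1%N; rewrite idealr1 expr1 mul1r.
have [u [n [uM un]]] : exists u n, u \notin M /\
    forall b, b \in t -> ispan [set 0] cs (u * b ^+ n).
  elim: t bP => [|b s IH] bP; first by exists 1, 0%N; rewrite idealr1.
  have [|u [n [uM un]]] := IH.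
    by move=> c cs'; apply: bP; rewrite in_cons cs' orbT.
  have [v [k [vM vk]]] := bP b (mem_head _ _).
  exists (u * v), (n + k)%N; split; first by apply/negP => /MM[]; apply/negP.
  move=> c; rewrite in_cons => /orP[/eqP->|/un cn].
    have -> : u * v * b ^+ (n + k) = (u * b ^+ n) * (v * b ^+ k).
      by rewrite exprD; ring.
    exact: idealM.
  have -> : u * v * c ^+ (n + k) = (v * c ^+ k) * (u * c ^+ n).
    by rewrite exprD; ring.
  exact: idealM.
exists cs, u, (size t * n).+1; split=> // x xN.
have Ks : ideal (fun y => ispan [set 0] cs (u * y)).
  split=> [|a y z yC zC]; first by rewrite mulr0; case: Cs.
  by rewrite mulrDr mulrCA; apply: Cs.2.
have := @pw_lin _ M t tM (size t * n).+1 0 x; rewrite addn0 => /(_ xN).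
apply: (lin_min (K' := fun y => ispan [set 0] cs (u * y))) => // a _ _ /mapP[d + ->].
rewrite mem_monos => /andP[/eqP sd /eqP nd].
apply: (idealM (K := fun y => ispan [set 0] cs (u * y))) => //.
by apply: (mon_large Ks sd un); rewrite nd.
Qed.

End LocalParameters.

(** * The Artin-Rees lemma and the Krull dimension *)

Section Sums.
Variable B : comNzRingType.
Implicit Types I J K T : set B.

Definition addI I J : set B := [set z | exists2 p, I p & J (z - p)].

Lemma addI_ideal I J : ideal I -> ideal J -> ideal (addI I J).
Proof.
move=> Is Js; split=> [|a x y [p Ip xp] [q Iq yq]].
  by exists 0; [case: Is|rewrite subr0; case: Js].
exists (a * p + q); first exact: Is.2.
have -> : idfun a * x + y - (a * p + q) = a * (x - p) + (y - q) by rewrite /=; ring.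
exact: Js.2.
Qed.

Lemma addIS I I' J J' : I `<=` I' -> J `<=` J' -> addI I J `<=` addI I' J'.
Proof. by move=> II JJ z [p /II Ip /JJ zp]; exists p. Qed.

Lemma addI_subl I J : ideal J -> I `<=` addI I J.
Proof. by move=> [J0 _] x Ix; exists x; rewrite ?subrr. Qed.

Lemma addI_subr I J : ideal I -> J `<=` addI I J.
Proof. by move=> [I0 _] x Jx; exists 0; rewrite ?subr0. Qed.

(** Strictness survives because [x * y] in [J'] forces [y] into [J], which lies in every term;
    adding [J'] to the images keeps them above it. *)
Lemma chain_scale (x : B) J J' l T : ideal J -> ideal J' -> ideal T ->
    (forall y, J' (x * y) -> J y) -> chain idfun l J T ->
  chain idfun l J' [set z | exists2 y, T y & J' (z - x * y)].
Proof.
move=> Js Js' + JJ'; elim: l T => [|l IH] T Ts /=.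
  by move=> JT z Jz; exists 0; [case: Ts|rewrite mulr0 subr0].
move=> [K [Ks JK KT [y Ty nKy]]].
exists [set z | exists2 y, K y & J' (z - x * y)]; split.
- split=> [|a u v [u' Ku uu] [v' Kv vv]].
    by exists 0; [case: Ks|rewrite mulr0 subr0; case: Js'].
  exists (a * u' + v'); first exact: Ks.2.
  have -> : idfun a * u + v - x * (a * u' + v') = a * (u - x * u') + (v - x * v').
    by rewrite /=; ring.
  exact: Js'.2.
- exact: IH.
- by move=> z [k /KT Tk zk]; exists k.
exists (x * y); first by exists y => //; rewrite subrr; case: Js'.
move=> [k Kk]; rewrite -mulrBr => /JJ' /(chain_sub JK) Kyk.
by apply: nKy; rewrite -(subrK k y); apply: idealD.
Qed.

Lemma chain_preimage (S : comNzRingType) (f : {rmorphism S -> B}) l J T :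
    (forall z, exists x, J (z - f x)) -> ideal T -> chain idfun l J T ->
  chain idfun l [set x | J (f x)] [set x | T (f x)].
Proof.
move=> fJ; elim: l T => [|l IH] T Ts /=; first by move=> JT x /JT.
move=> [K [Ks JK KT [z Tz nKz]]]; have JsubK := chain_sub JK.
exists [set x | K (f x)]; split; [|exact: IH|by move=> x /KT|].
  split=> [|a x y Kx Ky]; first by rewrite /= rmorph0; case: Ks.
  by rewrite /= rmorphD rmorphM; apply: Ks.2.
have [x Jzx] := fJ z; exists x => /= [|Kx].
  by rewrite -(subKr z (f x)); apply: idealB => //; apply/KT/JsubK.
by apply: nKz; rewrite -(subrK (f x) z); apply: idealD => //; apply: JsubK.
Qed.

End Sums.

Section ArtinRees.
Variables (A : comNzRingType) (M : idealr A) (t : seq A).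
Hypothesis tM : generates M t.
Hypothesis unitM : forall x, x \notin M -> exists y, y * x = 1.

(* Successive approximations converge: [M]-adic completeness. *)
Hypothesis convM : forall (Q : set A) (zs : seq A) n e,
  (forall k z, Q z -> pw M (n + k) z -> exists y,
     [/\ lin (pw M (e + k)) zs y, Q (z - y) & pw M (n + k).+1 (z - y)]) ->
  forall z, Q z -> pw M n z -> lin (pw M e) zs z.

(* A standard basis of [I]: by Dickson's lemma the leading exponents of the
   elements of [I] are those of multiples of finitely many [zs]. *)
Lemma standard_basis (I : set A) : ideal I ->
  exists (zs : seq A) c, (forall z, z \in zs -> I z) /\
    forall n z, I z -> pw M n z -> exists y,
      [/\ lin (pw M (n - c)) zs y, I (z - y) & pw M n.+1 (z - y)].
Proof.
move=> Is; have monM := mon_pw_sumn tM.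
(* The leading exponents of [I]; the leading coefficient can be taken to be [1] since elements
   outside [M] are units. *)
pose E a := exists2 z, I z & standard_gt M t a (z - mon t a).
have Eup : upset (size t) E.
  move=> a c sa sc [z Iz za]; exists (mon t c * z); first exact: idealM.
  by rewrite mon_madd // [mon t a * _]mulrC -mulrBr; apply: standard_gt_mon.
have [gens [gE gP]] := dicksonP Eup.
have [Z ZP] : exists Z : seq nat -> A, forall g, g \in gens ->
    I (Z g) /\ standard_gt M t g (Z g - mon t g).
  have H g : exists z, g \in gens -> I z /\ standard_gt M t g (z - mon t g).
    have [gg|ng] := boolP (g \in gens); last by exists 0.
    by have [_ [z Iz zg]] := gE g gg; exists z.
  by have [Z ZP] := choice H; exists Z.
pose zs := map Z gens; pose c := sumn (map sumn gens).
have zsI z : z \in zs -> I z by move=> /mapP[g /ZP[Ig _] ->].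
have cP g : g \in gens -> (sumn g <= c)%N.
  rewrite /c; elim: gens {gE gP ZP zs c zsI} => //= h s IH.
  by rewrite in_cons => /orP[/eqP->|/IH]; lia.
exists zs, c; split=> // n z Iz zn.
(* The degree [n] part of [z] is removed monomial by monomial in increasing order; [s2] lists those
   still to be treated. *)
suff H s1 s2 : monos (size t) n = s1 ++ s2 -> forall z, I z ->
    ispan (pw M n.+1) (map (mon t) s2) z ->
    exists2 y, lin (pw M (n - c)) zs y & pw M n.+1 (z - y).
  have [|y yl zy] := H [::] _ erefl z Iz; first by rewrite span_mons.
  exists y; split=> //; apply: idealB => //.
  by apply: lin_min yl => // a g _ /zsI Ig; apply: idealM.
have Ls := lin_ideal zs (pw_ideal M (n - c)).
elim: s2 s1 => [|a s2 IH] s1 ns {zn Iz}z Iz.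
  by move=> /= zn; exists 0; rewrite ?subr0 //; case: Ls.
move=> /= [b zb].
have {}IH := IH (rcons s1 a); rewrite cat_rcons in IH.
have: a \in monos (size t) n by rewrite ns mem_cat mem_head orbT.
rewrite mem_monos => /andP[/eqP sa /eqP an].
have [bM|bM] := boolP (b \in M).
  apply: IH => //; rewrite -(subrK (b * mon t a) z).
  apply: idealD => //; first by apply: span_submod; apply: pw_ideal.
  apply: span_base; rewrite -add1n; apply: pw_mul; first exact/pw1.
  by rewrite -an; apply: monM.
have [b' b'b] := unitM bM.
have Gs := standard_gt_ideal M t a.
have aG := span_mons_suffix M ns.
have Ea : E a.
  exists (b' * z); first exact: idealM.
  have -> : b' * z - mon t a = b' * (z - b * mon t a) by rewrite mulrBr mulrA b'b mul1r.
  by apply: idealM => //; rewrite aG.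
have [g [d [gg sd aE]]] := gP a sa Ea.
have [sg _] := gE g gg; have [Ig Zg] := ZP g gg.
(* This multiple of a basis element has the leading term of [z]; its coefficient lies in the power
   [sumn d = n - sumn g] of [M], hence in [M^(n-c)]. *)
pose y0 := b * mon t d * Z g.
have y0l : lin (pw M (n - c)) zs y0.
  apply: lin_mem; [exact: pw_ideal| |exact: map_f].
  apply: idealM; first exact: pw_ideal.
  apply: (@pw_leq _ M _ (sumn d)); last exact: monM.
  by have := cP g gg; rewrite -an aE sumn_madd ?sg //; lia.
have [||y yl zy] := IH ns (z - y0).
- by apply: idealB => //; apply: idealM.
- rewrite -aG.
  have -> : z - y0 = (z - b * mon t a) - b * (mon t d * (Z g - mon t g)).
    by rewrite aE mon_madd // /y0; ring.
  apply: idealB => //; first by rewrite aG.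
  by apply: idealM => //; rewrite aE; apply: standard_gt_mon.
exists (y0 + y); first exact: idealD.
by rewrite opprD addrA.
Qed.

(** An element of [P + x A] in [M^n] expands on the standard basis with coefficients in [M^(n-c)],
    so modulo [P] it is [x * h] with [h] in [M^(n-c)]. As [P] is prime and misses [x], the factor
    [x] cancels. *)
Lemma artin_rees (P : set A) x : primeI P -> ~ P x ->
  exists c, forall n y, addI P (pw M n) (x * y) -> addI P (pw M (n - c)) y.
Proof.
move=> [Ps _ PM] nPx.
have Is : ideal (ispan P [:: x]) by apply: span_submod.
have [zs [c [zsI zsP]]] := standard_basis Is.
exists c => n y [p Pp xyp]; have [cn|nc] := leqP c n; last first.
  have -> : (n - c = 0)%N by lia.
  by exists 0; [case: Ps|rewrite pwT].
have [h hn Ph] : exists2 h, pw M (n - c) h & P (x * y - p - x * h).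
  have Hs : ideal [set z | exists2 h, pw M (n - c) h & P (z - x * h)].
    split=> [|a u v [h1 h1n uh] [h2 h2n vh]].
      by exists 0; [case: (pw_ideal M (n - c))|rewrite mulr0 subr0; case: Ps].
    exists (a * h1 + h2); first exact: (pw_ideal M (n - c)).2.
    have -> : idfun a * u + v - x * (a * h1 + h2) = a * (u - x * h1) + (v - x * h2).
      by rewrite /=; ring.
    exact: Ps.2.
  have: lin (pw M (n - c)) zs (x * y - p).
    apply: (convM (Q := ispan P [:: x])) xyp; last first.
      by exists y; rewrite /= [y * x]mulrC addrAC subrr add0r; apply: idealN.
    move=> k z zI /(zsP _ _ zI)[w [wl zw1 zw2]]; exists w; split=> //.
    by rewrite -addnBAC // in wl.
  apply: (lin_min Hs) => a z an /zsI[b /= zb]; exists (a * b).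
    by rewrite mulrC; apply: idealM => //; apply: pw_ideal.
  by rewrite mulrCA [x * b]mulrC -mulrBr; apply: idealM.
exists (y - h); last by rewrite subKr.
have [|//|//] := PM x (y - h).
have -> : x * (y - h) = (x * y - p - x * h) + p by ring.
exact: idealD.
Qed.

Definition growth (I : set A) s := exists C, forall n l T, (0 < n)%N -> ideal T ->
  chain idfun l (addI I (pw M n)) T -> (l <= C * n ^ s)%N.

(* Multiplication by [x] embeds [A / (P + M^(n - c))] into [A / (P + M^n)], so
   a chain above [P + M^(n - c)] can be put below one above [P' + M^n]; this is
   iterated [j] times. *)
Lemma growth_chains (P P' : set A) x : primeI P -> ideal P' -> P `<=` P' ->
    P' x -> ~ P x ->
  exists c, forall n l T j, ideal T -> chain idfun l (addI P' (pw M n)) T ->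
    exists2 T', ideal T' & chain idfun (j * l) (addI P (pw M (n + j * c))) T'.
Proof.
move=> Pp P's PP' P'x nPx; have [c cP] := artin_rees Pp nPx.
have Ps : ideal P by case: Pp.
have As n : ideal (addI P (pw M n)) by apply: addI_ideal => //; apply: pw_ideal.
exists c => n l T j Ts lT; elim: j => [|j [T' T's IH]].
  by exists (addI P (pw M n)) => //; rewrite mul0n addn0.
exists T => //; rewrite mulSn addnC.
pose n' := (n + j.+1 * c)%N.
have n'c : (n' - c = n + j * c)%N by rewrite /n' mulSn; lia.
have AA y : addI P (pw M n') (x * y) -> addI P (pw M (n + j * c)) y.
  by move/cP; rewrite n'c.
apply: chain_cat (chain_scale (As _) (As _) T's AA IH) _.
apply: chain_botW lT => z [y _ zy].
have P'A : ideal (addI P' (pw M n)) by apply: addI_ideal => //; apply: pw_ideal.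
rewrite -(subrK (x * y) z); apply: idealD => //.
  by apply: addIS zy => //; apply: pw_leq; rewrite /n'; lia.
apply: addI_subl; first exact: pw_ideal.
by rewrite mulrC; apply: idealM.
Qed.

(** With [j = n], [n] copies of a chain of length [l] fit above [P + M^(n + n * c)]; dividing
    [n * l <= C * (n * (1 + c)) ^ s.+1] by [n] lowers the exponent. *)
Lemma growthS (P P' : set A) x s : primeI P -> ideal P' -> P `<=` P' ->
  P' x -> ~ P x -> growth P s.+1 -> growth P' s.
Proof.
move=> Pp P's PP' P'x nPx [C PC].
have [c cP] := growth_chains Pp P's PP' P'x nPx.
exists (C * (1 + c) ^ s.+1)%N => n l T n0 Ts lT.
have [T' T's /PC] := cP n l T n Ts lT.
have -> : (n + n * c = n * (1 + c))%N by rewrite mulnDr muln1.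
rewrite muln_gt0 n0 => /(_ isT T's) nl; rewrite -(leq_pmul2l n0).
by apply: leq_trans nl _; rewrite expnMn [(n ^ _)%N]expnS; apply/eq_leq; ring.
Qed.

(** The chain of length one above [P' + M], repeated [C.+1] times, already exceeds a constant bound
    [C]. *)
Lemma growth0 (P P' : set A) x : primeI P -> ideal P' -> P `<=` P' ->
  P' x -> ~ P x -> P' `<=` [set y | y \in M] -> ~ growth P 0.
Proof.
move=> Pp P's PP' P'x nPx P'M [C PC].
have [c cP] := growth_chains Pp P's PP' P'x nPx.
have [||T' T's /PC] := cP 1%N 1%N setT C.+1.
- by [].
- exists (addI P' (pw M 1)); split=> //.
    by apply: addI_ideal => //; apply: pw_ideal.
  exists 1 => // -[p /P'M /= pM /pw1 p1].
  have : 1 \in M by rewrite -(subrK p 1); apply: rpredD.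
  by rewrite idealr1.
by move=> /(_ isT T's); rewrite expn0 !muln1 ltnn.
Qed.

Lemma krull_dim_bound s : growth [set 0] s -> ~ has_prime_chain A s.+1.
Proof.
move=> gs /has_prime_chainP[P [Pp PP]].
have PM i : P i `<=` [set y | y \in M].
  move=> x Px; apply: contrapT => /negP /unitM[y yx].
  by have [Ps P1 _] := Pp i; apply: P1; rewrite -yx; apply: idealM.
have: growth (P 0%N) s.
  have [C gC] := gs; exists C => n l T n0 Ts lT; apply: (gC n l T) => //.
  apply: chain_botW lT; apply: addIS => // _ ->.
  by case: (Pp 0%N) => -[].
elim: s P Pp PP PM {gs} => [|s IH] P Pp PP PM gP.
  have [P01 [x P1x P0x]] := PP 0%N isT.
  by apply: growth0 (Pp 0%N) _ P01 P1x P0x (PM _) gP; case: (Pp 1%N).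
apply: (IH (fun i => P i.+1)) => // [i|]; first exact: (PP i.+1).
have [P01 [x P1x P0x]] := PP 0%N isT.
by apply: growthS (Pp 0%N) _ P01 P1x P0x gP; case: (Pp 1%N).
Qed.

End ArtinRees.

(** * The completion *)

Section Residue.
Variables (R : comNzRingType) (m : idealr R).

Lemma pw_lin1 (t : seq R) n : generates m t -> pw m n.+1 `<=` lin (pw m n) t.
Proof.
move=> tm x /idealXSP[s /allP sP ->]; rewrite big_seq.
have Ls := lin_ideal t (pw_ideal m n).
apply: (submod_sum _ Ls) => p /sP /andP[/tm p1 p2].
have : lin setT t `<=` fun y => lin (pw m n) t (y * p.2).
  apply: lin_min => [|a g _ gt].
    split=> [|a y z yL zL]; first by rewrite mul0r; case: Ls.
    by rewrite mulrDl -mulrA; apply: Ls.2.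
  rewrite mulrAC; apply: lin_mem => //; first exact: pw_ideal.
  by apply: idealM => //; apply: pw_ideal.
exact.
Qed.

Lemma lin_generates (t : seq R) : (forall x, x \in t -> x \in m) ->
  (forall x, x \in m -> lin setT t x) -> generates m t.
Proof.
move=> tm mt x; split=> [/mt//|].
have ms : ideal [set y | y \in m].
  split=> [|a y z ym zm]; first exact: idealr0.
  by apply: rpredD => //; apply: idealMr.
by apply: (lin_min ms) => a g _ /tm gm; apply: idealMr.
Qed.

Lemma residue_primeI :
  (forall a, a \in m \/ exists a', a' * a - 1 \in m) -> primeI [set x | x \in m].
Proof.
move=> res; split=> [||x y].
- split=> [|a x y xm ym]; first exact: idealr0.
  by apply: rpredD => //; apply: idealMr.
- by rewrite /= idealr1.
- move=> /= xym; have [|[x' x'x]] := res x; [by left|right].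
  have -> : y = x' * (x * y) - y * (x' * x - 1) by ring.
  by apply: rpredB; apply: idealMr.
Qed.

Hypothesis mU : forall x, x \notin m -> exists y, y * x = 1.

Lemma residue_field a : a \in m \/ exists a', a' * a - 1 \in m.
Proof.
have [?|/mU[a' a'a]] := boolP (a \in m); [by left|right].
by exists a'; rewrite a'a subrr idealr0.
Qed.

Lemma local_primeI : primeI [set x | x \in m].
Proof. exact: residue_primeI residue_field. Qed.

(** The unit [1 - a] allows the head to be expressed through the other generators, which are then
    treated by induction. *)
Lemma nakayama (I : set R) gs : ideal I ->
  (forall g, g \in gs -> addI I (lin [set x | x \in m] gs) g) ->
  forall g, g \in gs -> I g.
Proof.
move=> Is; have ms : ideal [set x | x \in m] by case: local_primeI.
have As s : ideal (addI I (lin [set x | x \in m] s)).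
  by apply: addI_ideal => //; apply: lin_ideal.
elim: gs => // g b IH gP.
have gb : addI I (lin [set x | x \in m] b) g.
  have [p Ip [a /= am gpa]] := gP g (mem_head _ _).
  have /mU[u u1] : 1 - a \notin m.
    apply/negP => a1; have : 1 \in m by rewrite -(subrK a 1); apply: rpredD.
    by rewrite idealr1.
  have -> : g = u * (g - a * g) by rewrite -{2}[g]mul1r -mulrBl mulrA u1 mul1r.
  by apply: idealM => //; exists p => //; rewrite addrAC.
have bI h : h \in b -> I h.
  apply: IH => {}h hb; have [|p Ip [a /= am hpa]] := gP h.
    by rewrite in_cons hb orbT.
  have -> : h = (h - a * g) + a * g by rewrite subrK.
  apply: idealD => //; first by exists p => //; rewrite addrAC.
  exact: idealM.
move=> h; rewrite in_cons => /orP[/eqP->|/bI//].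
have [p Ip gp] := gb; rewrite -(subrK p g); apply: idealD => //.
by apply: lin_min gp => // a c _ /bI Ic; apply: idealM.
Qed.

Lemma nakayama_pw (t : seq R) (I : set R) n : generates m t -> ideal I ->
  pw m n `<=` addI I (pw m n.+1) -> pw m n `<=` I.
Proof.
move=> tm Is nI.
have ms : ideal [set x | x \in m] by case: local_primeI.
have H g : g \in map (mon t) (monos (size t) n) -> I g.
  apply: (nakayama Is) => {}g /mapP[a an ->].
  have [p Ip ap] := nI _ (mon_in tm an); exists p => //.
  have := @pw_lin _ m t tm n 1 (mon t a - p); rewrite addn1 => /(_ ap).
  apply: lin_min; first exact: lin_ideal.
  by move=> c h /pw1 cm hn; apply: lin_mem.
move=> x xn; have := @pw_lin _ m t tm n 0 x; rewrite addn0 => /(_ xn).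
by apply: lin_min => // a g _ /H Ig; apply: idealM.
Qed.

End Residue.

Section Completion.
Variables (R : comNzRingType) (m : idealr R) (t : seq R).
Hypothesis tm : generates m t.
Hypothesis mU : forall x, x \notin m -> exists y, y * x = 1.
Local Notation A := (completion m).
Local Notation cv := completion_val.

Lemma completion_inj (f g : A) : (forall n, cv f n = cv g n) -> f = g.
Proof. by move=> fg; apply/val_inj/functional_extensionality_dep. Qed.

Lemma completion_trans (f : A) n : quoX_trans (cv f n.+1) = cv f n.
Proof. by have /asboolP := completion_valP f; apply. Qed.

Lemma completionB (f g : A) n : cv (f - g) n = cv f n - cv g n.
Proof.
by have /(congr1 (fun h => h n)) :=
  raddfB (val : A -> prodring (quoX m)) f g.
Qed.

Lemma completionD (f g : A) n : cv (f + g) n = cv f n + cv g n.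
Proof.
by have /(congr1 (fun h => h n)) :=
  raddfD (val : A -> prodring (quoX m)) f g.
Qed.

Lemma completion0 n : cv (0 : A) n = 0.
Proof.
by have /(congr1 (fun h => h n)) :=
  raddf0 (val : A -> prodring (quoX m)).
Qed.

Lemma completionM (f g : A) n : cv (f * g) n = cv f n * cv g n.
Proof.
by have /(congr1 (fun h => h n)) :=
  rmorphM (val : A -> prodring (quoX m)) f g.
Qed.

Lemma completion1 n : cv (1 : A) n = 1.
Proof.
by have /(congr1 (fun h => h n)) :=
  rmorph1 (val : A -> prodring (quoX m)).
Qed.

Lemma to_completion_subproof x : (fun n => piX m n x) \in @completion_pred R m.
Proof. by apply/asboolP => n; rewrite quoX_transE. Qed.

Definition to_completion x : A := Completion (to_completion_subproof x).

Lemma to_completion_is_zmod_morphism : zmod_morphism to_completion.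
Proof. by move=> x y; apply: completion_inj => n; rewrite completionB /= rmorphB. Qed.

Lemma to_completion_is_monoid_morphism : monoid_morphism to_completion.
Proof.
split=> [|x y]; apply: completion_inj => n; first by rewrite completion1 /= rmorph1.
by rewrite completionM /= rmorphM.
Qed.

HB.instance Definition _ := GRing.isZmodMorphism.Build R A to_completion
  to_completion_is_zmod_morphism.
HB.instance Definition _ := GRing.isMonoidMorphism.Build R A to_completion
  to_completion_is_monoid_morphism.
Local Notation iota := to_completion.

(** The kernel of the projection to [R / m^n]: coordinate [i] lives in [R / m^(i+1)], whence the
    strict inequality. *)
Definition cfilt n : set A := [set f : A | forall i, (i < n)%N -> cv f i = 0].

Lemma cfilt_ideal n : ideal (cfilt n).
Proof.
split=> [i _|a f g fn gn i i_n]; first exact: completion0.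
by rewrite completionD completionM fn // gn // mulr0 addr0.
Qed.

Lemma cfilt_leq i j : (i <= j)%N -> cfilt j `<=` cfilt i.
Proof. by move=> ij f fj k ki; apply: fj; apply: leq_trans ij. Qed.

Lemma piX0 n x : piX m n x = 0 <-> pw m n.+1 x.
Proof. by rewrite -(rmorph0 (piX m n)) piX_eq subr0. Qed.

Lemma completion_piX (f : A) n i x :
  (i <= n)%N -> cv f n = piX m n x -> cv f i = piX m i x.
Proof.
move=> /subnK <-; elim: (n - i)%N => // k IH; rewrite addSn => fk.
by apply: IH; rewrite -completion_trans fk quoX_transE.
Qed.

Lemma cfilt_eq0 f n : cv f n = 0 -> cfilt n.+1 f.
Proof.
move=> fn i i_n; have -> : cv f i = piX m i 0.
  by apply: (@completion_piX f n); rewrite // fn rmorph0.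
by rewrite rmorph0.
Qed.

Lemma cfilt_iota n x : cfilt n (iota x) <-> pw m n x.
Proof.
case: n => [|n]; first by rewrite pwT; split=> // _ i.
split=> [/(_ n (ltnSn n))/piX0//|xn]; apply: cfilt_eq0.
exact/piX0.
Qed.

Lemma cfilt_approx (f : A) n : exists x, cfilt n (f - iota x).
Proof.
case: n => [|n]; first by exists 0.
exists (reprX (cv f n)); apply: cfilt_eq0.
by rewrite completionB /= reprXK subrr.
Qed.

Lemma cfilt_mul i j f g : cfilt i f -> cfilt j g -> cfilt (i + j) (f * g).
Proof.
move=> fi gj; have [x fx] := cfilt_approx f (i + j).
have [y gy] := cfilt_approx g (i + j).
have xi : pw m i x.
  apply/cfilt_iota; rewrite -(subKr f (iota x)).
  apply: (idealB (cfilt_ideal _)) => //.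
  by apply: cfilt_leq fx; apply: leq_addr.
have yj : pw m j y.
  apply/cfilt_iota; rewrite -(subKr g (iota y)).
  apply: (idealB (cfilt_ideal _)) => //.
  by apply: cfilt_leq gy; apply: leq_addl.
have -> : f * g = g * (f - iota x) + iota x * (g - iota y) + iota (x * y).
  by rewrite rmorphM /=; ring.
have Ks := cfilt_ideal (i + j).
apply: (idealD Ks) => //; last by apply/cfilt_iota/pw_mul.
by apply: (idealD Ks) => //; apply: (idealM _ Ks).
Qed.

Lemma completion_sum_stable (b : nat -> A) k N N' : (N <= N')%N ->
  (forall i, (N <= i)%N -> cv (b i) k = 0) ->
  cv (\sum_(i < N') b i) k = cv (\sum_(i < N) b i) k.
Proof.
move=> /subnK <- bN; elim: (N' - N)%N => // j IH.
by rewrite addSn big_ord_recr completionD IH bN ?addr0 ?leq_addl.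
Qed.

(** Coordinate [n] of the sum is read off the sum of the first [n.+1] terms, after which it no
    longer changes. *)
Lemma cfilt_sum (b : nat -> A) e : (forall i, cfilt (e + i) (b i)) ->
  exists s, forall N, cfilt (e + N) (s - \sum_(i < N) b i).
Proof.
move=> be; pose S n := \sum_(i < n.+1) b i.
have Sp : (fun n => cv (S n) n) \in @completion_pred R m.
  apply/asboolP => n; rewrite completion_trans.
  apply: completion_sum_stable => // i ni.
  by apply: be; apply: leq_trans ni (leq_addl _ _).
exists (Completion Sp) => N k kN; rewrite completionB /=.
apply/eqP; rewrite subr_eq0; apply/eqP.
have [Nk|kN'] := leqP N k.+1.
  apply: completion_sum_stable => // i Ni; apply: be.
  by apply: leq_trans kN _; rewrite leq_add2l.
symmetry; apply: completion_sum_stable => [|i ki]; first exact: ltnW.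
by apply: be; apply: leq_trans ki (leq_addl _ _).
Qed.

Lemma cfilt_lin_sum zs (y : nat -> A) e : (forall k, lin (cfilt (e + k)) zs (y k)) ->
  exists2 s, lin (cfilt e) zs s & forall N, cfilt (e + N) (s - \sum_(i < N) y i).
Proof.
elim: zs y => [|g zs IH] y ye /=.
  exists 0 => // N; rewrite big1 ?subr0 => [|i _]; last exact: ye.
  by case: (cfilt_ideal (e + N)).
have [a aP] := choice (fun k => let: ex_intro2 a ak yk := ye k in
  ex_intro (fun a => cfilt (e + k) a /\ lin (cfilt (e + k)) zs (y k - a * g))
    a (conj ak yk)).
have [s sP] := cfilt_sum (fun k => (aP k).1).
have [u ul uP] := IH _ (fun k => (aP k).2).
exists (u + s * g) => [|N].
  exists s; last by rewrite addrK.
  by have := sP 0%N; rewrite addn0 big_ord0 subr0.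
have -> : u + s * g - \sum_(i < N) y i =
    (u - \sum_(i < N) (y i - a i * g)) + g * (s - \sum_(i < N) a i).
  by rewrite sumrB -mulr_suml; ring.
have Ks := cfilt_ideal (e + N).
by apply: (idealD Ks) => //; apply: (idealM _ Ks).
Qed.

(** The correction step, iterated, leaves remainders [w k] in [cfilt (n + k)]. The corrections add
    up to some [s], coefficient by coefficient, and [z - s] lies in every [cfilt], hence
    vanishes. *)
Lemma cfilt_conv (Q : set A) (zs : seq A) n e :
  (forall k z, Q z -> cfilt (n + k) z -> exists y,
     [/\ lin (cfilt (e + k)) zs y, Q (z - y) & cfilt (n + k).+1 (z - y)]) ->
  forall z, Q z -> cfilt n z -> lin (cfilt e) zs z.
Proof.
move=> step z Qz zn.
have H k : exists f : A -> A, forall z, Q z -> cfilt (n + k) z ->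
    [/\ lin (cfilt (e + k)) zs (f z), Q (z - f z) & cfilt (n + k).+1 (z - f z)].
  have Hz w : exists y, Q w -> cfilt (n + k) w ->
      [/\ lin (cfilt (e + k)) zs y, Q (w - y) & cfilt (n + k).+1 (w - y)].
    have [[Qw wn]|nw] := pselect (Q w /\ cfilt (n + k) w); last first.
      by exists 0 => Qw wn; case: nw.
    by have [y yP] := step k w Qw wn; exists y.
  by have [f fP] := choice Hz; exists f.
have [f fP] := choice H.
pose w := fix w k := if k is j.+1 then w j - f j (w j) else z.
have wP k : Q (w k) /\ cfilt (n + k) (w k).
  elim: k => [|k [Qw wn]] /=; first by rewrite addn0.
  by rewrite addnS; have [] := fP k _ Qw wn.
have [s sl sP] := @cfilt_lin_sum zs (fun k => f k (w k)) e
  (fun k => let: And3 h _ _ := fP k _ (wP k).1 (wP k).2 in h).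
suff -> : z = s by [].
apply: completion_inj => k; apply/eqP; rewrite -subr_eq0 -completionB; apply/eqP.
have wE N : w N = z - \sum_(i < N) f i (w i).
  elim: N => [|N IH]; first by rewrite big_ord0 subr0.
  by rewrite big_ord_recr /= {1}IH opprD addrA.
have -> : z - s = w k.+1 - (s - \sum_(i < k.+1) f i (w i)) by rewrite wE; ring.
apply: (idealB (cfilt_ideal k.+1)) => //.
  by apply: cfilt_leq (wP k.+1).2; apply: leq_addl.
by apply: cfilt_leq (sP k.+1); apply: leq_addl.
Qed.

Lemma lin_iota k gs x : lin (pw m k) gs x -> lin (cfilt k) (map iota gs) (iota x).
Proof.
elim: gs x => [|g gs IH] x /=; first by move->; rewrite rmorph0.
by move=> [a /cfilt_iota ak /IH]; rewrite rmorphB rmorphM; exists (iota a).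
Qed.

Lemma cfilt_lin gs n :
    (forall k, pw m (n + k) `<=` lin (pw m k) gs) ->
  cfilt n `<=` lin setT (map iota gs).
Proof.
move=> ngs f fn.
have <- : cfilt 0 = setT by apply/seteqP; split=> // h _ i.
apply: (@cfilt_conv setT _ n 0) fn => // k z _ zk.
have [x zx] := cfilt_approx z (n + k).+1; exists (iota x); split=> //.
apply/lin_iota/ngs/cfilt_iota; rewrite -(subKr z (iota x)).
apply: (idealB (cfilt_ideal _)) => //.
by apply: cfilt_leq zx; apply: leqnSn.
Qed.

Lemma cfilt1_proper : ~ cfilt 1 1.
Proof. by move=> /(_ 0%N isT)/eqP; rewrite completion1 oner_eq0. Qed.

Definition completion_max_sig := cid (ideal_idealr (cfilt_ideal 1) cfilt1_proper).
Definition completion_max : idealr A := sval completion_max_sig.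
Local Notation M := completion_max.

Lemma completion_maxE x : x \in M <-> cfilt 1 x.
Proof. exact: (svalP completion_max_sig). Qed.

Lemma completion_generates : generates M (map iota t).
Proof.
apply: lin_generates => [_ /mapP[x xt ->]|x /completion_maxE].
  exact/completion_maxE/cfilt_iota/pw1/(generators_in tm).
by apply: cfilt_lin => k; apply: pw_lin1.
Qed.

(** The inclusion of [cfilt n] in the power rests on finite generation of [m]: its elements are
    finite combinations of the monomials of degree [n], with convergent coefficients. *)
Lemma pw_completion n : pw M n = cfilt n.
Proof.
apply/seteqP; split.
  elim: n => [|n IH] x; first by move=> _ i.
  move=> /idealXSP[s /allP sP ->]; rewrite big_seq.
  have Ks := cfilt_ideal n.+1.
  apply: (submod_sum _ Ks) => p /sP /andP[/completion_maxE p1 /IH p2].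
  exact: (cfilt_mul p1 p2).
have := @cfilt_lin (map (mon t) (monos (size t) n)) n.
move=> /(_ (fun k => @pw_lin _ m t tm n k)) H x /H.
apply: (lin_min (pw_ideal M n)) => a _ _ /mapP[_ /mapP[b + ->] ->].
have -> : iota (mon t b) = mon (map iota t) b.
  elim: t b => [|y s IH] [|k b] //=; rewrite ?rmorph1 //.
  by rewrite rmorphM rmorphXn /= IH.
rewrite -(size_map iota t) => bn; apply: idealM; first exact: pw_ideal.
exact: (mon_in completion_generates).
Qed.

Lemma completion_conv (Q : set A) (zs : seq A) n e :
  (forall k z, Q z -> pw M (n + k) z -> exists y,
     [/\ lin (pw M (e + k)) zs y, Q (z - y) & pw M (n + k).+1 (z - y)]) ->
  forall z, Q z -> pw M n z -> lin (pw M e) zs z.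
Proof.
move=> step; rewrite !pw_completion; apply: cfilt_conv => k z.
by have := step k z; rewrite !pw_completion.
Qed.

(** Modulo [cfilt 1], [x] agrees with a unit [a] of [R]; the inverse of [a] is an approximate
    inverse of [x], and successive approximation writes [1] as a multiple of [x]. *)
Lemma completion_unit x : x \notin M -> exists y, y * x = 1.
Proof.
move=> xM; have [a xa] := cfilt_approx x 1.
have am : a \notin m.
  apply: contra xM => am; apply/completion_maxE; rewrite -(subrK (iota a) x).
  by apply: (idealD (cfilt_ideal 1)) => //; apply/cfilt_iota/pw1.
have [b ba] := mU am.
suff step k z : setT z -> cfilt (0 + k) z -> exists y,
    [/\ lin (cfilt (0 + k)) [:: x] y, setT (z - y) & cfilt (0 + k).+1 (z - y)].
  have [//|//|c _ /= /eqP] := cfilt_conv step (z := 1).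
  by rewrite subr_eq0 => /eqP ->; exists c.
move=> _ zk; have Ks := cfilt_ideal (0 + k); exists (z * iota b * x); split=> //.
  apply: lin_mem => //; rewrite ?mem_head //.
  by rewrite mulrC; apply: (idealM _ Ks).
have -> : z - z * iota b * x = z * (iota (b * a) - iota b * x).
  by rewrite ba rmorph1; ring.
rewrite -addn1; apply: cfilt_mul => //.
have -> : iota (b * a) - iota b * x = (- iota b) * (x - iota a).
  by rewrite rmorphM /=; ring.
exact: (idealM _ (cfilt_ideal 1)).
Qed.

Lemma completion_krull_bound C s :
  (forall n, (0 < n)%N -> hilbsum m t n <= C * n ^ s)%N ->
  ~ has_prime_chain A s.+1.
Proof.
move=> hC; apply: (krull_dim_bound completion_generates completion_unit completion_conv).
exists C => n l T n0 Ts lT; apply: leq_trans (hC n n0).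
have {}lT : chain idfun l (cfilt n) T.
  apply: chain_botW lT; rewrite -pw_completion; apply: addI_subr.
  by split=> // a x y -> ->; rewrite mulr0 addr0.
have := chain_preimage (f := iota) (cfilt_approx^~ n) Ts lT.
move=> {}lT; apply: (chain_pw_bound tm (residue_field mU)); last first.
  by apply: chain_botW lT => x xn /=; apply/cfilt_iota.
split=> [|a x y xT yT]; first by rewrite /= rmorph0; case: Ts.
by rewrite /= rmorphD rmorphM; apply: Ts.2.
Qed.

(** Replacing the parameters by elements of [R] congruent to them modulo [M^(N+1)] causes only an
    error in [m^(N+1)], which Nakayama's lemma in [R] absorbs. *)
Lemma completion_parameters e : ~ has_prime_chain A e.+1 ->
  exists cs N, [/\ size cs = e, forall c, c \in cs -> c \in m &
    pw m N `<=` ispan [set 0] cs].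
Proof.
move=> nch; have Mp := local_primeI completion_unit.
have [cs [u [N [scs csM uM csN]]]] := local_parameters completion_generates Mp nch.
have [v vu] := completion_unit uM.
have [a aP] := choice (cfilt_approx^~ N.+1).
exists (map a cs), N; split; first by rewrite size_map.
  move=> _ /mapP[c /csM /completion_maxE c1 ->].
  apply/pw1/cfilt_iota; rewrite -(subKr c (iota (a c))).
  apply: (idealB (cfilt_ideal _)) => //.
  by apply: cfilt_leq (aP c).
have z0 : ideal ([set 0] : set R) by split=> // b x y -> ->; rewrite mulr0 addr0.
have z0' : ideal ([set 0] : set A) by split=> // b x y -> ->; rewrite mulr0 addr0.
have Is : ideal (ispan [set 0] (map a cs)) by apply: span_submod.
apply: (nakayama_pw mU tm Is) => x xN.
have {xN} : ispan [set 0] cs (iota x).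
  rewrite -[iota x]mul1r -vu -mulrA; apply: idealM; first exact: span_submod.
  by apply: csN; rewrite pw_completion; apply/cfilt_iota.
suff H zs y f : cfilt N.+1 (f - iota y) -> ispan [set 0] zs f ->
    addI (ispan [set 0] (map a zs)) (pw m N.+1) y.
  by apply: H; rewrite subrr; case: (cfilt_ideal N.+1).
elim: zs y f => [|z zs IH] y f fy.
  move=> f0; exists 0; first by case: z0.
  rewrite subr0; apply/cfilt_iota; move: fy; rewrite (f0 : f = 0) sub0r.
  by move=> /(idealN (cfilt_ideal _)); rewrite opprK.
move=> [b fb]; have [b' bb'] := cfilt_approx b N.+1.
have [|p pl yp] := IH (y - b' * a z) _ _ fb.
  have -> : f - idfun b * z - iota (y - b' * a z) =
    (f - iota y) - ((b - iota b') * z + iota b' * (z - iota (a z))).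
    by rewrite rmorphB rmorphM /=; ring.
  have Ks := cfilt_ideal N.+1; apply: (idealB Ks) => //; apply: (idealD Ks) => //.
    by rewrite mulrC; apply: (idealM _ Ks).
  by apply: (idealM _ Ks).
exists (p + b' * a z); first by exists b'; rewrite addrK.
by rewrite opprD addrA addrAC.
Qed.

End Completion.

(** * The associated graded ring *)

Section Graded.
Variables (R : comNzRingType) (m : idealr R) (t : seq R).
Hypothesis tm : generates m t.
Hypothesis mU : forall x, x \notin m -> exists y, y * x = 1.
Local Notation G := (graded m).
Local Notation rees := (@rees R m).
Implicit Types p q : {poly R}.

Lemma graded_val_inj : injective (@graded_val R m).
Proof. exact: val_inj. Qed.

(** Presents the graded ring as a quotient of the Rees algebra; polynomials outside it get the
    default [0]. *)
Definition to_graded p : G := insubd 0 (cls m p).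

Lemma to_gradedE p : rees p -> graded_val (to_graded p) = cls m p.
Proof. by move=> pX; apply: (insubdK (0 : G)); apply: cls_graded. Qed.

Lemma to_graded_surj (f : G) : exists2 p, rees p & f = to_graded p.
Proof.
have [p pX pf] := cls_surj (graded_valP f); exists p => //.
by apply: graded_val_inj; rewrite to_gradedE.
Qed.

Lemma to_gradedM p q : rees p -> rees q -> to_graded (p * q) = to_graded p * to_graded q.
Proof.
move=> pX qX; apply: graded_val_inj; rewrite to_gradedE; last exact: reesM.
by rewrite -clsM // -!to_gradedE.
Qed.

Lemma to_gradedD p q : rees p -> rees q -> to_graded (p + q) = to_graded p + to_graded q.
Proof.
move=> pX qX; apply: graded_val_inj; rewrite graded_valD !to_gradedE ?clsD //.
exact: reesD.
Qed.

Lemma rees0 : rees 0.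
Proof. by move=> n; rewrite coef0; case: (pw_ideal m n). Qed.

Lemma to_graded_eq0 p : rees p -> to_graded p = 0 <-> forall n, pw m n.+1 p`_n.
Proof.
move=> pX; have v0 : graded_val (0 : G) = 0.
  exact: (raddf0 (val : G -> prodring (quoX m))).
split=> [p0 n|pP]; last first.
  apply: graded_val_inj; rewrite to_gradedE // v0.
  apply: functional_extensionality_dep => n.
  exact/piX0.
have := to_gradedE pX; rewrite p0 v0 => /(congr1 (fun f => f n)) /esym cn.
exact/piX0.
Qed.

Lemma to_graded0 : to_graded 0 = 0.
Proof.
apply/to_graded_eq0; first exact: rees0.
by move=> n; rewrite coef0; case: (pw_ideal m n.+1).
Qed.

Lemma reesN p : rees p -> rees (- p).
Proof. by move=> pX n; rewrite coefN; exact: (idealN (pw_ideal m n) (pX n)). Qed.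

Lemma reesB p q : rees p -> rees q -> rees (p - q).
Proof. by move=> pX qX; apply: reesD => //; apply: reesN. Qed.

Lemma to_gradedB p q : rees p -> rees q -> to_graded (p - q) = to_graded p - to_graded q.
Proof.
move=> pX qX; apply/eqP; rewrite eq_sym subr_eq -to_gradedD //; last exact: reesB.
by rewrite subrK.
Qed.

Lemma to_graded_eq p q : rees p -> rees q ->
  to_graded p = to_graded q <-> forall n, pw m n.+1 (p`_n - q`_n).
Proof.
move=> pX qX; split=> [pq n|pq].
  have /(to_graded_eq0 (reesB pX qX)) : to_graded (p - q) = 0.
    by rewrite to_gradedB // pq subrr.
  by move=> /(_ n); rewrite coefB.
apply/eqP; rewrite -subr_eq0 -to_gradedB //; apply/eqP/to_graded_eq0.
  exact: reesB.
by move=> n; rewrite coefB.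
Qed.

Lemma rees_sum (I : Type) (r : seq I) (F : I -> {poly R}) :
  (forall i, rees (F i)) -> rees (\sum_(i <- r) F i).
Proof.
move=> FX; elim/big_ind: _ => //; [exact: rees0|exact: reesD].
Qed.

Lemma to_graded_sum (I : Type) (r : seq I) (F : I -> {poly R}) :
  (forall i, rees (F i)) -> to_graded (\sum_(i <- r) F i) = \sum_(i <- r) to_graded (F i).
Proof.
move=> FX; elim: r => [|i r IH]; first by rewrite !big_nil to_graded0.
by rewrite !big_cons to_gradedD ?IH //; apply: rees_sum.
Qed.

Lemma rees_monomial a n : pw m n a -> rees (a *: 'X^n).
Proof.
move=> an k; rewrite coefZ coefXn; case: eqVneq => [->|_]; rewrite ?mulr1 //.
by rewrite mulr0; case: (pw_ideal m k).
Qed.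

Lemma reesC a : rees a%:P.
Proof. by rewrite -[a%:P]mulr1 mul_polyC -(expr0 'X); apply: rees_monomial. Qed.


Definition graded0 a : G := to_graded a%:P.

Lemma graded0_is_zmod_morphism : zmod_morphism graded0.
Proof. by move=> x y; rewrite /graded0 polyCB to_gradedB //; apply: reesC. Qed.

Lemma graded0_is_monoid_morphism : monoid_morphism graded0.
Proof.
split=> [|x y]; last by rewrite /graded0 polyCM to_gradedM //; apply: reesC.
apply: graded_val_inj; rewrite /graded0 to_gradedE ?cls1 //; exact: reesC.
Qed.

HB.instance Definition _ := GRing.isZmodMorphism.Build R G graded0
  graded0_is_zmod_morphism.
HB.instance Definition _ := GRing.isMonoidMorphism.Build R G graded0
  graded0_is_monoid_morphism.


Local Notation iota := graded0.
Local Notation gens := [seq to_graded (x *: 'X^1) | x <- t].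

Lemma graded_mon a : size a = size t ->
  mon gens a = to_graded (mon t a *: 'X^(sumn a)).
Proof.
move: (generators_in tm); elim: t a => [|x s IH] [|n a] //= sm.
  by rewrite scale1r; symmetry; apply: (rmorph1 iota).
move=> [sa]; rewrite IH // => [|y ys]; last by apply: sm; rewrite in_cons ys orbT.
have xm : pw m 1 x by apply/pw1/sm; rewrite mem_head.
have -> : to_graded (x *: 'X^1) ^+ n = to_graded (x ^+ n *: 'X^n).
  have := pwX n (sm x (mem_head _ _)); elim: n => [|n IHn] _.
    by rewrite !expr0 scale1r; symmetry; apply: (rmorph1 iota).
  rewrite exprS IHn; last by apply: pwX; apply: sm; rewrite mem_head.
  rewrite -to_gradedM; [|exact: rees_monomial|apply: rees_monomial]; last first.
    by apply: pwX; apply: sm; rewrite mem_head.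
  by rewrite -scalerAl -scalerAr scalerA -!exprS.
rewrite -to_gradedM; first by rewrite -scalerAl -scalerAr scalerA -exprD.
  by apply: rees_monomial; apply: pwX; apply: sm; rewrite mem_head.
apply: rees_monomial; apply: mon_pw => // y ys.
by apply: sm; rewrite in_cons ys orbT.
Qed.

Lemma iotaM a b n : pw m n b ->
  iota a * to_graded (b *: 'X^n) = to_graded ((a * b) *: 'X^n).
Proof.
move=> bn; rewrite -to_gradedM ?mul_polyC ?scalerA //; first exact: reesC.
exact: rees_monomial.
Qed.

Lemma graded_shift_ideal (K : set G) n : submod graded0 K ->
  ideal [set y | pw m n y /\ K (to_graded (y *: 'X^n))].
Proof.
move=> Ks; split=> [|a y z [yn Ky] [zn Kz]].
  by split; [case: (pw_ideal m n)|rewrite scale0r to_graded0; case: Ks].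
have ayn : pw m n (a * y) by apply: idealM => //; apply: pw_ideal.
split; first exact: (pw_ideal m n).2.
rewrite scalerDl to_gradedD; [|exact: rees_monomial..].
by rewrite -iotaM //; apply: Ks.2.
Qed.

Lemma ideal_submod (K : set G) : ideal K -> submod graded0 K.
Proof. by move=> Ks; split=> [|a x y Kx Ky]; [case: Ks|apply: Ks.2]. Qed.

(** The irrelevant ideal: degree [0] is [R / m], so the condition says that the component of degree
    [0] vanishes. *)
Definition graded_max_set : set G :=
  [set f | exists p, [/\ rees p, f = to_graded p & pw m 1 p`_0]].

Lemma graded_max_ideal : ideal graded_max_set.
Proof.
split=> [|f g h [p [pX -> p0]] [q [qX -> q0]]].
  exists 0; split; [exact: rees0|by rewrite to_graded0|].
  by rewrite coef0; case: (pw_ideal m 1).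
have [r rX ->] := to_graded_surj f.
exists (r * p + q); split; first by apply: reesD => //; apply: reesM.
  by rewrite to_gradedD ?to_gradedM //; apply: reesM.
by rewrite coefD coef0M; apply: (pw_ideal m 1).2.
Qed.

Lemma graded_max_setE p : rees p -> graded_max_set (to_graded p) <-> pw m 1 p`_0.
Proof.
move=> pX; split=> [[q [qX pq q0]]|p0]; last by exists p.
have /(_ 0%N) := (to_graded_eq pX qX).1 pq.
by rewrite -{2}(subrK q`_0 p`_0) => pq0; apply: (idealD (pw_ideal m 1)).
Qed.

Lemma graded_max_proper : ~ graded_max_set 1.
Proof.
rewrite -(rmorph1 iota) => /graded_max_setE -/(_ (@reesC _)); rewrite coefC eqxx.
by move=> /pw1; rewrite idealr1.
Qed.

Definition graded_max_sig := cid (ideal_idealr graded_max_ideal graded_max_proper).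
Definition graded_max : idealr G := sval graded_max_sig.
Local Notation M := graded_max.

Lemma graded_maxE p : rees p -> to_graded p \in M <-> pw m 1 p`_0.
Proof.
move=> pX; rewrite -graded_max_setE //; exact: (svalP graded_max_sig).
Qed.

Lemma to_graded_homogeneous p : rees p ->
  to_graded p = \sum_(i < size p) to_graded (p`_i *: 'X^i).
Proof.
move=> pX; rewrite -[in LHS](coefK p) poly_def to_graded_sum // => i.
exact: rees_monomial (pX i).
Qed.

Lemma graded_generates : generates M gens.
Proof.
apply: lin_generates => [_ /mapP[x /(generators_in tm) xm ->]|f].
  apply/graded_maxE; first by apply: rees_monomial; apply/pw1.
  by rewrite coefZ coefXn mulr0; case: (pw_ideal m 1).
have [p pX ->] := to_graded_surj f; move=> /(graded_maxE pX) p0.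
have Ls : ideal (lin setT gens) by apply: lin_ideal.
rewrite to_graded_homogeneous //; apply: (submod_sum _ Ls) => i _.
case: (nat_of_ord i) => [|n].
  rewrite (_ : to_graded _ = 0); first by case: Ls.
  apply/to_graded_eq0; first exact: rees_monomial (pX _).
  move=> [|k]; rewrite coefZ coefXn ?mulr1 //= mulr0.
  by case: (pw_ideal m k.+2).
suff [] : pw m n.+1 p`_n.+1 /\ lin setT gens (to_graded (p`_n.+1 *: 'X^(n.+1))) by [].
have := pw_lin1 tm (pX n.+1); move: (p`_n.+1) => y.
apply: (lin_min (graded_shift_ideal n.+1 (ideal_submod Ls))) => a g an gt.
have g1 : pw m 1 g by apply/pw1/(generators_in tm).
split; first by rewrite -addn1; apply: pw_mul.
have -> : (a * g) *: 'X^(n.+1) = (a *: 'X^n) * (g *: 'X^1) :> {poly R}.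
  by rewrite -scalerAl -scalerAr scalerA -exprD addn1.
rewrite to_gradedM; [|exact: rees_monomial..].
by apply: lin_mem => //; apply: map_f.
Qed.

Lemma graded_pw n p : rees p -> pw M n (to_graded p) ->
  forall i, (i < n)%N -> pw m i.+1 p`_i.
Proof.
suff H f : pw M n f -> exists q, [/\ rees q, f = to_graded q &
    forall i, (i < n)%N -> pw m i.+1 q`_i].
  move=> pX /H[q [qX pq qn]] i i_n; have := (to_graded_eq pX qX).1 pq i.
  rewrite -{2}(subrK q`_i p`_i) => pqi; apply: (idealD (pw_ideal m i.+1)) => //.
  exact: qn.
elim: n f => [|n IH] f; first by have [q qX ->] := to_graded_surj f; exists q.
move=> /idealXSP[s /allP sP ->]; rewrite big_seq.
elim/big_ind: _ => [|f1 f2 [q1 [q1X -> q1n]] [q2 [q2X -> q2n]]|[f1 f2]].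
- exists 0; split; [exact: rees0|by rewrite to_graded0|].
  by move=> i _; rewrite coef0; case: (pw_ideal m i.+1).
- exists (q1 + q2); split; [exact: reesD|by rewrite to_gradedD|move=> i i_n].
  by rewrite coefD; apply: (idealD (pw_ideal m i.+1)); [apply: q1n|apply: q2n].
move=> /sP /= /andP[f1M /IH[q2 [q2X -> q2n]]].
have [q1 q1X f1E] := to_graded_surj f1; rewrite f1E in f1M *.
move/(graded_maxE q1X) in f1M.
exists (q1 * q2); split; [exact: reesM|by rewrite to_gradedM|move=> i i_n].
rewrite coefM; apply: (submod_sum _ (pw_ideal m i.+1)) => -[[|j] ji] _ /=.
  by rewrite subn0 -add1n; exact: (pw_mul f1M (q2X i)).
have -> : (i.+1 = j.+1 + (i - j.+1).+1)%N by lia.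
have ij : (i - j.+1 < n)%N by lia.
exact: (pw_mul (q1X j.+1) (q2n _ ij)).
Qed.

Lemma graded_residue f : f \in M \/ exists f', f' * f - 1 \in M.
Proof.
have [p pX ->] := to_graded_surj f.
have [pm|[b bp]] := residue_field mU p`_0; [left|right].
  by apply/graded_maxE => //; apply/pw1.
exists (iota b); rewrite -(rmorph1 iota) -to_gradedM //; last exact: reesC.
have bpX : rees (b%:P * p) by apply: reesM => //; apply: reesC.
rewrite -to_gradedB //; last exact: reesC.
apply/graded_maxE; first by apply: reesB => //; apply: reesC.
by apply/pw1; rewrite coefB coefCM coefC.
Qed.

(** Taking components of degree [sumn a] turns a relation in the graded ring into one between the
    generators [t], because [M^(n+1)] has no components of degree up to [n]. *)
Lemma graded_nonstd a : size a = size t -> nonstd M gens a -> nonstd m t a.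
Proof.
move=> sa; rewrite /nonstd /standard_gt size_map graded_mon //.
have H bs p : {subset bs <= monos (size t) (sumn a)} -> rees p ->
    ispan (pw M (sumn a).+1) (map (mon gens) bs) (to_graded p) ->
    ispan (pw m (sumn a).+1) (map (mon t) bs) p`_(sumn a).
  elim: bs p => [|b bs IH] p bsP pX /=.
    by move=> /(graded_pw pX); apply.
  move=> [g gb]; have [q qX gE] := to_graded_surj g; rewrite {}gE in gb.
  have := bsP b (mem_head _ _); rewrite mem_monos => /andP[/eqP sb /eqP nb].
  have bX : rees (mon t b *: 'X^(sumn a)).
    by apply: rees_monomial; rewrite -nb; apply: (mon_pw_sumn tm).
  exists q`_0; have := IH (p - q * (mon t b *: 'X^(sumn a))).
  rewrite coefB -scalerAr coefZ coefMXn ltnn subnn [mon t b * _]mulrC; apply.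
  - by move=> c cbs; apply: bsP; rewrite in_cons cbs orbT.
  - by rewrite scalerAr; apply: reesB => //; apply: reesM.
  - rewrite scalerAr to_gradedB ?to_gradedM //; last exact: reesM.
    by move: gb; rewrite graded_mon // nb.
have := H [seq b <- monos (size t) (sumn a) | slt a b] (mon t a *: 'X^(sumn a)).
rewrite coefZ coefXn eqxx mulr1; apply.
  by move=> b; rewrite mem_filter => /andP[].
by apply: rees_monomial; apply: (mon_pw_sumn tm).
Qed.

Lemma graded_hilbsum n : (hilbsum m t n <= hilbsum M gens n)%N.
Proof.
apply: leq_sum => i _; rewrite /hilb size_map.
apply: (@leq_trans (count (fun a => (size a == size t) && ~~ `[< nonstd m t a >])
                      (monos (size t) i))).
  apply/eq_leq/eq_in_count => a; rewrite mem_monos => /andP[-> _] //.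
apply: sub_count => a /andP[/eqP sa]; apply: contra => /asboolP na.
exact/asboolP/graded_nonstd.
Qed.

Lemma graded_growth e : ~ has_prime_chain G e.+1 ->
  exists C, forall n, (hilbsum m t n <= C * n ^ e)%N.
Proof.
move=> nch; have Mp := residue_primeI graded_residue.
have [cs [u [N [scs csM uM csN]]]] := local_parameters graded_generates Mp nch.
have [n x xN|C CP] := chain_pw_growth graded_generates graded_residue csM (N := N).
  have Js : ideal (ispan (pw M n) cs) by apply: span_submod; apply: pw_ideal.
  have [/negP//|[v vu]] := graded_residue u; first by rewrite (negbTE uM).
  (* The multiplier [u] is invertible modulo [M^n]: the geometric series in [y], an element of [M],
     gives an inverse up to [y ^+ n]. *)
  pose y := 1 - v * u.
  have yM : y \in M by rewrite /y -opprB rpredN.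
  have -> : x = y ^+ n * x + (\sum_(i < n) y ^+ i) * v * (u * x).
    have := subrX1 y n; set S := \sum_(i < n) _ => yn.
    have -> : S * v * (u * x) = - ((y - 1) * S) * x by rewrite /y; ring.
    by rewrite -yn; ring.
  apply: idealD => //.
    rewrite mulrC; apply: idealM => //; apply: span_base; exact: pwX.
  apply: idealM => //; apply: span_subset (csN _ xN) => _ ->.
  by case: (pw_ideal M n).
exists C => n; rewrite -scs; apply: leq_trans (graded_hilbsum n) _.
by apply: (CP n _ setT) => //; apply: chain_pw_hilbsum graded_generates n.
Qed.

Local Notation z0 := ([set 0] : set G).

Lemma z0_submod : submod graded0 z0.
Proof. by split=> // a x y -> ->; rewrite mulr0 addr0. Qed.

Lemma span_graded_mons i bs y : {subset bs <= monos (size t) i} -> pw m i y ->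
  ispan (pw m i.+1) (map (mon t) bs) y ->
  span graded0 z0 (map (mon gens) bs) (to_graded (y *: 'X^i)).
Proof.
elim: bs y => [|b bs IH] y bsP yi /=.
  move=> yi1; apply/to_graded_eq0; first exact: rees_monomial.
  move=> k; rewrite coefZ coefXn; case: eqVneq => [->|_]; rewrite ?mulr1 //.
  by rewrite mulr0; case: (pw_ideal m k.+1).
move=> [a yb]; exists a.
have := bsP b (mem_head _ _); rewrite mem_monos => /andP[/eqP sb /eqP nb].
have bi : pw m i (mon t b) by rewrite -nb; apply: (mon_pw_sumn tm).
have abi : pw m i (a * mon t b) by apply: idealM => //; apply: pw_ideal.
rewrite graded_mon // nb iotaM // -to_gradedB; [|exact: rees_monomial..].
rewrite -scalerBl; apply: IH => //; last exact: (idealB (pw_ideal m i)).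
by move=> c cbs; apply: bsP; rewrite in_cons cbs orbT.
Qed.

Local Notation gmons := (mons_from gens).

Lemma span_graded_degree k p : rees p -> (size p <= k)%N ->
  span graded0 z0 (gmons 0 k) (to_graded p).
Proof.
move=> pX pk; have Ss : submod graded0 (span graded0 z0 (gmons 0 k)).
  by apply: span_submod; apply: z0_submod.
rewrite to_graded_homogeneous //; apply: (submod_sum _ Ss) => i _.
have : span graded0 z0 (map (mon gens) (monos (size t) i)) (to_graded (p`_i *: 'X^i)).
  by apply: span_graded_mons; rewrite ?span_mons //; exact: pX.
apply: span_min => // [_ ->|g gi]; first by case: Ss.
apply: mem_span => //; first exact: z0_submod.
apply/flatten_mapP; exists (nat_of_ord i); last by rewrite size_map.
by rewrite mem_iota /=; apply: leq_trans pk.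
Qed.

(** With scalars in [R] instead of the graded ring, [ess] counts a dimension over [R / m], with
    which independent monomials can be compared. *)
Lemma tower_graded j k : tower graded0 z0 (gmons j k).
Proof.
apply: tower_simple => [|_ /flatten_mapP[i _ /mapP[b + ->]] a]; first exact: z0_submod.
rewrite size_map mem_monos => /andP[/eqP sb /eqP nb].
have bi : pw m i (mon t b) by rewrite -nb; apply: (mon_pw_sumn tm).
rewrite graded_mon // nb; have [am|/mU[a' a'a]] := boolP (a \in m); [left|right].
  rewrite iotaM //; apply: (@span_graded_mons i [::]) => //.
    by apply: idealM => //; apply: pw_ideal.
  by rewrite /= -add1n; apply: pw_mul => //; apply/pw1.
by exists a'; rewrite -rmorphM a'a rmorph1 mul1r subrr.
Qed.

Lemma ess_graded j k :
  (ess graded0 z0 (gmons j k) <= \sum_(i < k) hilb m t (j + i))%N.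
Proof.
elim: k j => [|k IH] j //; rewrite /mons_from /= ess_cat big_ord_recl addn0.
apply: leq_add; last first.
  apply: leq_trans (IH j.+1) _; apply/eq_leq/eq_bigr => i _.
  by rewrite -addSnnS.
rewrite -ess_mons size_map.
apply: ess_le => s1 b s2 jE bs2; rewrite span_cat.
have s2P : {subset b :: s2 <= monos (size t) j}.
  by move=> c cs2; rewrite jE mem_cat cs2 orbT.
have := s2P b (mem_head _ _); rewrite mem_monos => /andP[/eqP sb /eqP nb].
have bj : pw m j (mon t b) by rewrite -nb; apply: (mon_pw_sumn tm).
have : span graded0 z0 (map (mon gens) s2) (mon gens b).
  rewrite graded_mon // nb; apply: span_graded_mons => // c cs2.
  by apply: s2P; rewrite in_cons cs2 orbT.
apply: (span_subset (J := z0)) => _ ->.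
exact: (span_submod _ z0_submod).1.
Qed.

Lemma graded_mon_degree (xs : seq G) D b : size b = size xs ->
    (forall x, x \in xs -> exists p, [/\ rees p, x = to_graded p & (size p <= D.+1)%N]) ->
  exists p, [/\ rees p, mon xs b = to_graded p & (size p <= (sumn b * D).+1)%N].
Proof.
elim: xs b => [|x xs IH] [|n b] //=.
  move=> _ _; exists 1%:P; split; [exact: reesC| |by rewrite size_polyC oner_eq0].
  by symmetry; apply: (rmorph1 iota).
move=> [sb] xsD; have [|q [qX -> sq]] := IH b sb.
  by move=> y yxs; apply: xsD; rewrite in_cons yxs orbT.
have [p [pX -> sp]] := xsD x (mem_head _ _).
elim: n => [|n [r [rX rE sr]]].
  by exists q; rewrite expr0 mul1r.
exists (p * r); split; [exact: reesM| |].
  by rewrite to_gradedM // -rE exprS mulrA.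
apply: leq_trans (size_polyMleq _ _) _.
move: sr; rewrite addSn mulSn; set k := ((n + _) * D)%N => sr.
by have := leq_add sp sr; rewrite addSn addnS; case: (_ + _)%N.
Qed.

(* The [n ^ s.+1] monomials with exponents less than [n] in elements separating
   a chain of [s.+2] primes are linearly independent over [R / m], in a space
   of dimension [hilbsum m t (O n)]. *)
Lemma graded_krull_bound C s :
  (forall n, (0 < n)%N -> hilbsum m t n <= C * n ^ s)%N ->
  ~ has_prime_chain G s.+1.
Proof.
move=> hC /has_prime_chainP[P [Pp PP]].
have [x xP] : exists x : nat -> G, forall i, (i < s.+1)%N -> P i.+1 (x i) /\ ~ P i (x i).
  have H i : exists y, (i < s.+1)%N -> P i.+1 y /\ ~ P i y.
    have [/PP[_ [y Py nPy]]|?] := boolP (i < s.+1)%N; first by exists y.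
    by exists 0.
  by have [x xP] := choice H; exists x.
pose xs := mkseq x s.+1; have sxs : size xs = s.+1 by rewrite size_mkseq.
have nxs : ~ bmon xs 0.
  move=> /(prime_chain_bmon Pp) H; apply: H; last by case: (Pp 0%N) => -[].
  move=> i; rewrite sxs => i_s; rewrite nth_mkseq //.
  by have [] := PP i i_s; have [] := xP i i_s.
have [D xsD] : exists D, forall x, x \in xs ->
    exists p, [/\ rees p, x = to_graded p & (size p <= D.+1)%N].
  elim: xs {sxs nxs} => [|y ys [D DP]]; first by exists 0%N.
  have [p pX yp] := to_graded_surj y; exists (D + size p)%N => z.
  rewrite in_cons => /orP[/eqP->|/DP[q [qX zq sq]]].
    by exists p; split=> //; lia.
  by exists q; split=> //; lia.
have bound n : (n ^ s.+1 <= C * (s.+1 * n * D).+1 ^ s)%N.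
  (* A monomial from the box has total exponent at most [s.+1 * n], and each member of [xs] has
     degree at most [D]. *)
  pose E := (s.+1 * n * D).+1.
  apply: leq_trans (hC E isT).
  have := ess_lex graded0 nxs (pairwise_box s.+1 n)
    (fun b bb => etrans (mem_box bb).1 (esym sxs)).
  rewrite size_box => <-; apply: leq_trans (ess_graded 0 E).
  apply: (chain_bound z0_submod (tower_graded 0 E)) (chain_ess _ z0_submod).
    exact: span_submod z0_submod.
  apply: span_min => [||_ /mapP[b /mem_box[sb nb] ->]].
  - exact: span_submod z0_submod.
  - exact: span_base.
  - have [p [pX -> sp]] := graded_mon_degree (etrans sb (esym sxs)) xsD.
    apply: span_graded_degree => //; apply: leq_trans sp _.
    by rewrite ltnS leq_mul2r nb orbT.
(* As [(s.+1 * n * D).+1 <= (s.+1 * D).+1 * n] for positive [n], the bound implies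
   [n ^ s.+1 <= K * n ^ s], which fails at [n = K.+1]. *)
pose K := (C * (s.+1 * D).+1 ^ s)%N.
have := bound K.+1; apply/negP; rewrite -ltnNge.
apply: (@leq_ltn_trans (K * K.+1 ^ s)); last by rewrite expnS ltn_pmul2r // expn_gt0.
have L0 : (0 < K.+1)%N by []; move: (K.+1) L0 => L L0.
rewrite /K -(mulnA C) leq_mul2l -expnMn; apply/orP; right.
have [->//|s0] := posnP s; rewrite leq_exp2r //; nia.
Qed.

End Graded.

(** * Systems of parameters *)

Section Chains.
Variable B : comNzRingType.
Implicit Types (J K T : set B).

Lemma ideal_submodClosed K :
  ideal K -> exists N : submodClosed B^o, forall x, x \in N <-> K x.
Proof.
move=> [K0 KM]; have Kc : GRing.submod_closed ([pred x | `[< K x >]] : {pred B^o}).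
  split; first exact/asboolP.
  by move=> a x y /asboolP Kx /asboolP Ky; apply/asboolP/KM.
pose N : submodClosed B^o := HB.pack_for (submodClosed B^o) (fun x : B^o => `[< K x >])
  (GRing.isSubmodClosed.Build B B^o _ Kc).
by exists N => x; split=> /asboolP.
Qed.

Lemma submodClosed_ideal (N : submodClosed B^o) : ideal [set x : B | x \in N].
Proof.
split=> [|a x y xN yN]; first exact: (rpred0 N).
by apply: (@rpredD _ N) => //; apply: (@rpredZ _ _ N).
Qed.

Lemma has_submod_chainP l :
  has_submod_chain B^o l <-> exists2 T : set B, ideal T & chain idfun l [set 0] T.
Proof.
split=> [[N NP]|[T Ts lT]].
  exists [set x : B | x \in N l]; first exact: submodClosed_ideal.
  elim: l NP => [|l IH] NP /=; first by move=> _ ->; apply: (rpred0 (N 0%N)).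
  have [NS nN] := NP l (ltnSn l).
  exists [set x : B | x \in N l]; split=> //; first exact: submodClosed_ideal.
    by apply: IH => i il; apply: NP; apply: ltnW.
  apply: contrapT => nex; apply: nN => x xN.
  by apply: contrapT => nx; apply: nex; exists x.
have [N [Ns _ NP]] : exists N : nat -> set B, [/\ forall i, ideal (N i), N l = T &
    forall i, (i < l)%N -> N i `<=` N i.+1 /\ exists2 x, N i.+1 x & ~ N i x].
  elim: l T Ts lT => [|l IH] T Ts /=; first by exists (fun=> T).
  move=> [K [Ks /(IH _ Ks)[N [Ns Nl NP]] KT Tx]].
  exists (fun i => if (i <= l)%N then N i else T).
  split=> [i||i]; [by case: ifP|by rewrite ltnn|rewrite ltnS => il].
  rewrite il; move: il; rewrite leq_eqVlt => /orP[/eqP->|il].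
    by rewrite ltnn Nl.
  by rewrite il; apply: NP.
have [L LE] := choice (fun i => ideal_submodClosed (Ns i)).
exists L => i /NP[NS [x Nx nNx]]; split=> [y /LE/NS/LE //|LL].
by apply/nNx/LE/LL/LE.
Qed.

Lemma chain_image (S : comNzRingType) (f : {rmorphism S -> B}) (J : set S) J' l
    (T : set S) : ideal J -> ideal J' -> ideal T -> (forall z, exists x, z = f x) ->
    (forall y, J' (f y) -> J y) -> chain idfun l J T ->
  chain idfun l J' [set z | exists2 y, T y & J' (z - f y)].
Proof.
move=> Js Js' + fS JJ'; elim: l T => [|l IH] T Ts /=.
  by move=> JT z Jz; exists 0; [case: Ts|rewrite rmorph0 subr0].
move=> [K [Ks JK KT [y Ty nKy]]].
exists [set z | exists2 y, K y & J' (z - f y)]; split.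
- split=> [|a u v [u' Ku uu] [v' Kv vv]].
    by exists 0; [case: Ks|rewrite rmorph0 subr0; case: Js'].
  have [b ->] := fS a; exists (b * u' + v'); first exact: Ks.2.
  have -> : idfun (f b) * u + v - f (b * u' + v') = f b * (u - f u') + (v - f v').
    by rewrite rmorphD rmorphM /=; ring.
  exact: Js'.2.
- exact: IH.
- by move=> z [k /KT Tk zk]; exists k.
exists (f y); first by exists y => //; rewrite subrr; case: Js'.
move=> [k Kk]; rewrite -rmorphB => /JJ' /(chain_sub JK) Kyk.
by apply: nKy; rewrite -(subrK k y); apply: idealD.
Qed.

Lemma set0_ideal : ideal ([set 0] : set B).
Proof. by split=> // a x y -> ->; rewrite mulr0 addr0. Qed.

Lemma lin_ispanE gs : lin setT gs = ispan [set (0 : B)] gs.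
Proof.
apply/seteqP; split; first exact: lin_ispan set0_ideal.
by move=> x /ispan_lin[y yl /eqP]; rewrite subr_eq0 => /eqP->.
Qed.

Lemma lin_tuple n (a : n.-tuple B) x :
  (exists c : 'I_n -> B, x = \sum_(i < n) c i * tnth a i) <-> lin setT a x.
Proof.
elim: n a x => [|n IH] a x.
  rewrite tuple0 /=; split=> [[c]|->]; first by rewrite big_ord0.
  by exists (fun=> 0); rewrite big_ord0.
case/tupleP: a => g a /=; split=> [[c ->]|[b _ /IH[c xb]]].
  exists (c ord0) => //; apply/IH; exists (fun i => c (lift ord0 i)).
  rewrite big_ord_recl tnth0 addrAC subrr add0r.
  by apply: eq_bigr => i _; rewrite tnthS.
exists (fun i => if unlift ord0 i is Some j then c j else b).
rewrite big_ord_recl unlift_none tnth0 -[LHS](subrK (b * g)) xb addrC.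
by congr (_ + _); apply: eq_bigr => i _; rewrite liftK tnthS.
Qed.

Lemma generated_byP n (a : n.-tuple B) (J : idealr B) :
  generated_by a J <-> forall x, x \in J <-> lin setT a x.
Proof.
by split=> H x; split=> [/H/lin_tuple|/lin_tuple/H].
Qed.

Lemma local_ringP (m : idealr B) :
  local_ring m <-> forall x, x \notin m -> exists y, y * x = 1.
Proof.
split=> [lm x|mU]; first exact: local_ring_unit.
have sub (J : idealr B) : {subset J <= m}.
  move=> x xJ; apply: contrapT => /negP/mU[y yx].
  by have := idealr1 J; rewrite -yx idealMr.
split=> [J mJ x|M Mmax x]; first by apply/idP/idP; [apply: sub|apply: mJ].
by rewrite (Mmax m (sub M)).
Qed.

End Chains.

Section HasParams.
Variables (R : comNzRingType) (m : idealr R).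

(** The common form of the geometric dimension and of the number of generators of a primary ideal.
    Carrying [J] along describes parameters of [R / J] without leaving [R]. *)
Definition has_params (J : set R) d := exists a N, [/\ size a = d,
  forall x, x \in a -> x \in m & pw m N `<=` ispan J a].

Variable t : seq R.
Hypothesis tm : generates m t.
Hypothesis mU : forall x, x \notin m -> exists y, y * x = 1.

(** [ideal_inf m] lies in [m^(N+1)], so Nakayama's lemma removes it. *)
Lemma has_params_inf d : has_params (ideal_inf m) d <-> has_params [set 0] d.
Proof.
split=> -[a [N [sa am aN]]]; exists a, N; split=> //; last first.
  move=> x /aN; apply: span_subset => _ ->; exact: idealr0.
apply: (nakayama_pw mU tm); first exact: span_submod (set0_ideal R).
move=> x /aN/ispan_lin[y]; rewrite lin_ispanE => ya /asboolP xy.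
by exists y => //; apply: xy.
Qed.

Lemma has_params_step d :
  has_params [set 0] d.+1 <-> exists2 x, x \in m & has_params (ispan [set 0] [:: x]) d.
Proof.
split=> [[a [N []]]|[x xm [a [N [sa am aN]]]]].
  case: (lastP a) => // {}a x; rewrite size_rcons => -[sa] am aN.
  exists x; first by apply: am; rewrite mem_rcons mem_head.
  exists a, N; split=> // [y ya|y /aN].
    by apply: am; rewrite mem_rcons in_cons ya orbT.
  by rewrite -cats1 span_cat.
exists (rcons a x), N; split; first by rewrite size_rcons sa.
  by move=> y; rewrite mem_rcons in_cons => /orP[/eqP->|/am].
by rewrite -cats1 span_cat.
Qed.

(** One exponent puts the powers of all generators [t] in [I], so [I] contains a power of [m].
    Conversely, elements outside [m] are units, which makes the ideal primary. *)
Lemma m_primary_gensP d : m_primary_gens m d <-> has_params [set 0] d.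
Proof.
split=> [[I [a [/generated_byP aI [_ mI]]]]|[a [N [sa am aN]]]].
  have [n tn] : exists n, forall x, x \in t -> x ^+ n \in I.
    elim: t (generators_in tm) => [|y s IH] sm; first by exists 0%N.
    have [|n sn] := IH; first by move=> x xs; apply: sm; rewrite in_cons xs orbT.
    have /mI[k yk] := sm y (mem_head _ _); exists (k + n)%N => x.
    rewrite in_cons exprD => /orP[/eqP->|/sn xn]; last exact: idealMr.
    by rewrite mulrC idealMr.
  exists a, (size t * n).+1; split; first by rewrite size_tuple.
    move=> x xa; apply/mI; exists 1%N; rewrite expr1; apply/aI.
    by rewrite -[x]mul1r; apply: lin_mem.
  rewrite -lin_ispanE => x; have Is : ideal [set x | x \in I].
    split=> [|b y z yI zI]; first exact: idealr0.
    by apply: rpredD => //; apply: idealMr.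
  have := @pw_lin _ m t tm (size t * n).+1 0 x; rewrite addn0 => H /H xl.
  apply/aI; move: xl; apply: (lin_min Is) => b _ _ /mapP[c + ->].
  rewrite mem_monos => /andP[/eqP sc /eqP nc]; apply: idealMr.
  by apply: (mon_large Is sc tn); rewrite nc.
have [ms m1 mP] := local_primeI mU.
have As : ideal (ispan [set 0] a) := span_submod a (set0_ideal R).
have am' : ispan [set 0] a `<=` [set x | x \in m].
  by apply: span_min => // _ ->; case: ms.
have [I IE] := ideal_idealr As (fun a1 => m1 (am' _ a1)).
have mI x : x \in m -> x ^+ N \in I by move=> xm; apply/IE/aN/pwX.
exists I, (tcast sa (in_tuple a)); split; last split.
- by apply/generated_byP => x; rewrite val_tcast lin_ispanE.
- move=> x y xyI; have [ym|/mU[z zy]] := boolP (y \in m).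
    by right; exists N; apply: mI.
  by left; rewrite -[x]mulr1 -zy mulrCA idealMr.
- move=> x; split=> [xm|[n /IE/am' xn]]; first by exists N; apply: mI.
  exact: (primeIX (local_primeI mU) xn).
Qed.

End HasParams.

(** * Parameters of quotient rings and the geometric dimension *)

Section Quotient.
Variables (R Q : comNzRingType) (f : {rmorphism R -> Q}) (m : idealr R) (t : seq R).
Hypothesis fS : forall z, exists x, z = f x.
Hypothesis fm : forall x, f x = 0 -> x \in m.
Hypothesis tm : generates m t.
Hypothesis mU : forall x, x \notin m -> exists y, y * x = 1.

Lemma quotient_max : exists mQ : idealr Q, [/\ forall x, f x \in mQ <-> x \in m,
  generates mQ (map f t) & forall z, z \notin mQ -> exists y, y * z = 1].
Proof.
pose K : set Q := [set z | exists2 x, x \in m & z = f x].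
have Ks : ideal K.
  split=> [|a u v [x xm ->] [y ym ->]]; first by exists 0; rewrite ?idealr0 ?rmorph0.
  have [b ->] := fS a; exists (b * x + y); last by rewrite rmorphD rmorphM.
  by apply: rpredD => //; apply: idealMr.
have KE x : K (f x) <-> x \in m.
  split=> [[y ym /eqP]|xm]; last by exists x.
  rewrite -subr_eq0 -rmorphB => /eqP/fm xy.
  by rewrite -(subrK y x); apply: rpredD.
have [|mQ mE] := ideal_idealr Ks; first by rewrite -(rmorph1 f) KE idealr1.
exists mQ; split=> [x||z zm]; first by rewrite mE.
- apply: lin_generates => [_ /mapP[x xt ->]|z /mE[x /tm xm ->]].
    by apply/mE/KE; apply: (generators_in tm).
  elim: t x xm => [|g s IH] x /=; first by move->; rewrite rmorph0.
  by move=> [a _ /IH]; rewrite rmorphB rmorphM; exists (f a).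
- have [x zx] := fS z; have /mU[y yx] : x \notin m.
    by apply: contra zm => xm; apply/mE; rewrite zx; apply/KE.
  by exists (f y); rewrite zx -rmorphM yx rmorph1.
Qed.

Variable mQ : idealr Q.
Hypothesis mQE : forall x, f x \in mQ <-> x \in m.

Lemma quotient_pw N z : pw mQ N z <-> exists2 x, pw m N x & z = f x.
Proof.
split=> [|[x xN ->]].
  elim: N z => [|N IH] z; first by move=> _; have [x ->] := fS z; exists x.
  move=> /idealXSP[s /allP sP ->]; rewrite big_seq.
  elim/big_ind: _ => [|u v [x xN ->] [y yN ->]|[u v] /sP /= /andP[um /IH[y yN ->]]].
  - by exists 0; [case: (pw_ideal m N.+1)|rewrite rmorph0].
  - by exists (x + y); [apply: idealD => //; apply: pw_ideal|rewrite rmorphD].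
  - have [x ux] := fS u; exists (x * y); last by rewrite ux rmorphM.
    by rewrite -add1n; apply: pw_mul => //; apply/pw1/mQE; rewrite -ux.
elim: N x xN => // N IH x /idealXSP[s /allP sP ->]; rewrite big_seq rmorph_sum.
apply: (submod_sum _ (pw_ideal mQ N.+1)) => p /sP/andP[p1 /IH p2].
rewrite rmorphM -add1n; apply: pw_mul => //.
by apply/pw1/mQE.
Qed.

Lemma quotient_ispan a y :
  ispan [set 0] (map f a) (f y) <-> ispan [set x | f x = 0] a y.
Proof.
elim: a y => //= g a IH y; split=> [[b yb]|[b /IH yb]].
  have [c bc] := fS b; exists c; apply/IH.
  by rewrite rmorphB rmorphM /= -bc.
by exists (f b); move: yb; rewrite rmorphB rmorphM.
Qed.

Lemma quotient_params d : has_params mQ [set 0] d <-> has_params m [set x | f x = 0] d.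
Proof.
split=> -[a [N [sa am aN]]].
  have [g gP] := choice fS; have ag : a = map f (map g a).
    by rewrite -map_comp -[LHS]map_id; apply: eq_map => z /=.
  exists (map g a), N; split; first by rewrite size_map.
    by move=> _ /mapP[z za ->]; apply/mQE; rewrite -gP; apply: am.
  by move=> x xN; apply/quotient_ispan; rewrite -ag; apply/aN/quotient_pw; exists x.
exists (map f a), N; split; first by rewrite size_map.
  by move=> _ /mapP[x xa ->]; apply/mQE/am.
by move=> _ /quotient_pw[x xN ->]; apply/quotient_ispan/aN.
Qed.

End Quotient.

Lemma pi_surj (R : comNzRingType) (J : idealr R) (z : {ideal_quot J}) :
  exists x, z = \pi_({ideal_quot J})%qT x.
Proof. by exists (repr z); rewrite reprK. Qed.

Lemma pi_eq0 (R : comNzRingType) (J : idealr R) x :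
  \pi_({ideal_quot J})%qT x = 0 <-> x \in J.
Proof.
rewrite -(rmorph0 (\pi_({ideal_quot J})%qT)) -[in X in _ <-> X](subr0 x).
by rewrite Quotient.idealrBE; split=> /eqP.
Qed.

(** If the powers of [m] stabilize, Nakayama's lemma makes them zero. Conversely, if [m^N = 0], a
    decreasing sequence that never stabilizes would contain chains longer than [hilbsum m t N]. *)
Lemma artinianP (R : comNzRingType) (m : idealr R) (t : seq R) :
  generates m t -> (forall x, x \notin m -> exists y, y * x = 1) ->
  artinian R <-> exists N, pw m N `<=` [set 0].
Proof.
move=> tm mU; split=> [art|[N N0] I Idec].
  have [I IE] := choice (fun n => ideal_submodClosed (pw_ideal m n)).
  have [|N NP] := art I; first by move=> n x /IE/(pw_leq (leqnSn n))/IE.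
  exists N; apply: (nakayama_pw mU tm (set0_ideal R)) => x /IE.
  rewrite -(NP N.+1) // => /IE xN; apply: addI_subr => //; exact: set0_ideal.
apply: contrapT => nst.
have step k : exists2 n, (k <= n)%N & exists2 x, x \in I k & x \notin I n.
  apply: contrapT => nk; apply: nst; exists k => n kn x.
  apply/idP/idP.
    by move: kn x => /subnK <-; elim: (n - k)%N => // j IH x /Idec/IH.
  move=> xk; apply: contrapT => /negP xn; apply: nk; exists n => //.
  by exists x.
have Imono k n : (k <= n)%N -> [set x : R | x \in I n] `<=` [set x : R | x \in I k].
  by move=> /subnK <-; elim: (n - k)%N => // j IH x /Idec/IH.
have ch l k : exists n, chain idfun l [set x : R | x \in I n] [set x : R | x \in I k].
  elim: l k => [|l IH] k; first by exists k.
  have [n kn [x xk xn]] := step k; have [n' ln'] := IH n; exists n'.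
  rewrite -addn1; apply: chain_cat ln' _.
  exists [set x : R | x \in I n]; split=> //; first exact: submodClosed_ideal.
    exact: Imono.
  by exists x => //; apply/negP.
have [n] := ch (hilbsum m t N).+1 0%N.
have IN : pw m N `<=` [set x : R | x \in I n].
  by move=> x /N0 ->; case: (submodClosed_ideal (I n)).
move=> /(chain_botW IN) /(chain_pw_bound tm (residue_field mU) (submodClosed_ideal _)).
by rewrite ltnn.
Qed.

(** Dividing by [x] in the recursive definition amounts to moving one parameter into [J]; the
    induction is over all such rings because it passes to [R / x R]. *)
Lemma gdim_leP d (R : comNzRingType) (m : idealr R) (t : seq R) :
  generates m t -> (forall x, x \notin m -> exists y, y * x = 1) ->
  gdim_le d R <-> has_params m [set 0] d.
Proof.
elim: d R m t => [|d IH] R m t tm mU.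
  rewrite /= (artinianP tm mU); split=> [[N N0]|[a [N [/size0nil -> _ N0]]]].
    by exists [::], N.
  by exists N.
have IHJ (J : idealr R) : {subset J <= m} ->
    gdim_le d {ideal_quot J} <-> has_params m [set x | x \in J] d.
  move=> Jm; pose f : {rmorphism R -> {ideal_quot J}} := \pi_({ideal_quot J})%qT.
  have fm x : f x = 0 -> x \in m by move=> /pi_eq0/Jm.
  have [mQ [mQE tQ QU]] := quotient_max (@pi_surj R J) fm tm mU.
  rewrite (IH _ _ _ tQ QU) (quotient_params (@pi_surj R J) mQE).
  by rewrite (_ : [set x | _] = [set x | x \in J]) //; apply/seteqP; split=> x /pi_eq0.
rewrite (has_params_step m); split.
  move=> [m' [J [x [lm' xm' /generated_byP Jx]]]].
  have m'm : m' =i m by case: ((local_ringP m).2 mU) => _ /(_ m' lm'.1).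
  have JE y : y \in J <-> ispan [set 0] [:: x] y by rewrite Jx lin_ispanE.
  have Jm : {subset J <= m}.
    move=> y /JE[a /eqP]; rewrite subr_eq0 => /eqP -> /=.
    by rewrite -m'm idealMr.
  move=> /(IHJ J Jm) H; exists x; first by rewrite -m'm.
  by rewrite (_ : ispan _ _ = [set y | y \in J]) //; apply/seteqP; split=> y /JE.
move=> [x xm].
have xm' : ispan [set 0] [:: x] `<=` [set y | y \in m].
  by move=> y [a /eqP]; rewrite subr_eq0 => /eqP -> /=; rewrite idealMr.
have [|J JE] := ideal_idealr (span_submod (phi := idfun) [:: x] (set0_ideal R)).
  by move=> /xm' /=; rewrite idealr1.
move=> H; exists m, J, x; split=> //; first exact/local_ringP.
  by apply/generated_byP => y; rewrite JE lin_ispanE.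
apply/IHJ; first by move=> y /JE/xm'.
by rewrite (_ : [set y | y \in J] = ispan [set 0] [:: x]) //; apply/seteqP; split=> y /JE.
Qed.

(** * The Hilbert-Samuel polynomial *)

Section HilbertSamuel.
Variables (R : comNzRingType) (m : idealr R) (t : seq R).
Hypothesis tm : generates m t.
Hypothesis mU : forall x, x \notin m -> exists y, y * x = 1.

Lemma has_length_quoX n l : has_length (quoX m n)^o l <-> l = hilbsum m t n.+1.
Proof.
have surj (z : quoX m n) : exists x, z = piX m n x by exists (reprX z); rewrite reprXK.
have ub k : has_submod_chain (quoX m n)^o k -> (k <= hilbsum m t n.+1)%N.
  move=> /has_submod_chainP[T Ts kT].
  have H z : exists x, [set (0 : quoX m n)] (z - piX m n x).
    by have [x ->] := surj z; exists x; rewrite /= subrr.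
  have {kT} := chain_preimage H Ts kT.
  have E : pw m n.+1 `<=` [set x | [set (0 : quoX m n)] (piX m n x)].
    by move=> x /piX0.
  move=> /(chain_botW E)/(chain_pw_bound tm (residue_field mU)); apply.
  split=> [|a x y xT yT]; first by rewrite /= rmorph0; case: Ts.
  by rewrite /= rmorphD rmorphM; apply: Ts.2.
have lb : has_submod_chain (quoX m n)^o (hilbsum m t n.+1).
  apply/has_submod_chainP.
  have ker (y : R) : [set (0 : quoX m n)] (piX m n y) -> pw m n.+1 y by move/piX0.
  have := chain_image (pw_ideal m n.+1) (set0_ideal _) _ surj ker
    (chain_pw_hilbsum tm n.+1).
  move=> /(_ (ltac:(by []))) H; eexists; last exact: H.
  split=> [|a x y _ _]; first by exists 0; rewrite ?rmorph0 ?subr0.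
  have [z zE] := surj (a * x + y); exists z => //; rewrite /= zE subrr //.
split=> [[lc lmax]|->]; last by split.
by apply/eqP; rewrite eqn_leq lmax // ub.
Qed.

(** The last two clauses express the degree by growth alone: it is the least [s] for which [hilbsum]
    is [O(n^s)]. *)
Lemma hilbert_samuelP : exists p : {poly rat}, [/\ p != 0,
    forall q, hilbert_samuel m q <-> q = p,
    exists C, forall n, (0 < n)%N -> (hilbsum m t n <= C * n ^ (size p).-1)%N &
    forall C s, (forall n, (0 < n)%N -> (hilbsum m t n <= C * n ^ s)%N) ->
      ((size p).-1 <= s)%N].
Proof.
have [p [N pN]] := evpoly_hilbsum tm; exists p.
have hs0 := hilbsum_gt0 tm (residue_field mU).
split.
- apply/eqP => p0; have := pN N.+1 (leqnSn N); rewrite p0 horner0 => /eqP.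
  by rewrite pnatr_eq0 gtn_eqF // hs0.
- move=> q; split=> [[M qM]|->].
    apply: (@horner_natr_inj _ _ (maxn N M).+1) => -[//|n]; rewrite ltnS geq_max.
    move=> /andP[Nn Mn]; have [l [/has_length_quoX -> ->]] := qM n Mn.
    by rewrite pN // ltnW.
  exists N => n Nn; exists (hilbsum m t n.+1); split; first exact/has_length_quoX.
  by rewrite pN // ltnW.
- have [C pC] := horner_natr_bound p.
  exists (C + hilbsum m t N)%N => n n0; have [Nn|nN] := leqP N n.
    apply: (@leq_trans (C * n ^ (size p).-1)); last by rewrite leq_mul2r leq_addr orbT.
    have := pC n n0; rewrite -pN // normr_nat.
    by rewrite -natrX -natrM ler_nat.
  apply: (@leq_trans (hilbsum m t N)).
    rewrite /hilbsum -(subnK (ltnW nN)) addnC big_split_ord /=.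
    exact: leq_addr.
  by rewrite mulnDl; apply: leq_trans (leq_addl _ _); rewrite leq_pmulr // expn_gt0 n0.
- move=> C s hC; suff : (size p <= s.+1)%N by case: (size p).
  apply: (@size_horner_bound p C s (maxn N 1)) => n; rewrite geq_max => /andP[Nn n0].
  by rewrite -pN // normr_nat -natrX -natrM ler_nat hC.
Qed.

Lemma params_growth d : has_params m [set 0] d ->
  exists C, forall n, (hilbsum m t n <= C * n ^ d)%N.
Proof.
move=> [a [N [<- am aN]]].
have [n x /aN|C CP] := chain_pw_growth tm (residue_field mU) am (N := N).
  by apply: span_subset => _ ->; case: (pw_ideal m n).
by exists C => n; apply: (CP n _ setT) => //; apply: chain_pw_hilbsum tm n.
Qed.

End HilbertSamuel.

Lemma has_gdim_min (R : comNzRingType) (P : nat -> Prop) d :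
  (forall n, gdim_le n R <-> P n) -> P d -> (forall n, P n -> (d <= n)%N) ->
  has_gdim R d.
Proof.
move=> gP Pd dmin; split=> [|d0 /gP/dmin]; first exact/gP.
by rewrite leqNgt prednK ?leqnn.
Qed.

Lemma has_krull_dimP (R : comNzRingType) d :
  ~ has_prime_chain R d.+1 -> (exists P : set R, primeI P) ->
  (forall e, ~ has_prime_chain R e.+1 -> (d <= e)%N) -> has_krull_dim R d.
Proof.
move=> ub [P Pp] lb; split=> [|n [Q QP]]; last first.
  rewrite leqNgt; apply/negP => dn; apply: ub; exists Q => i id.
  by apply: QP; apply: leq_trans id dn.
(* A chain of length zero is a single prime; otherwise the lower bound at [e = d - 1] excludes the
   absence of a chain of length [d]. *)
case: d ub lb => [|d] ub lb; first by apply/has_prime_chainP; exists (fun=> P).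
by apply: contrapT => /lb; rewrite ltnn.
Qed.

Theorem theorem3p4 (R : comNzRingType) (m : idealr R)
    (locR : local_ring m) (embR : finite_embdim m) :
  exists d : nat,
    has_gdim R d /\
    least_m_primary_gens m d /\
    has_krull_dim (completion m) d /\
    has_krull_dim (graded m) d /\
    (exists! HS : {poly rat}, hilbert_samuel m HS) /\
    (forall HS : {poly rat}, hilbert_samuel m HS -> size HS = d.+1) /\
    has_gdim {ideal_quot (ideal_inf m)} d.
Proof.
have mU x : x \notin m -> exists y, y * x = 1 by exact: local_ring_unit.
have [k [t0 /generated_byP]] := embR; set t := tval t0 => tm.
have [p [p0 HSp [C hC] pmin]] := hilbert_samuelP tm mU.
pose d := (size p).-1; exists d.
have pard e : has_params m [set 0] e -> (d <= e)%N.
  by move=> /(params_growth tm mU)[C' hC']; apply: (pmin C') => n _; apply: hC'.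
have cpar e : ~ has_prime_chain (completion m) e.+1 -> has_params m [set 0] e.
  move=> /(completion_parameters tm mU)[cs [N [scs csm csN]]].
  by exists cs, N.
have cub := completion_krull_bound tm mU hC.
(* The cycle closes: growth of degree [d] excludes chains of length [d.+1] in the completion, which
   provides [d] parameters, the least number that [pard] allows. *)
have pd : has_params m [set 0] d by apply: cpar.
have gd := gdim_leP _ tm mU.
have mp := m_primary_gensP tm mU.
split; first exact: has_gdim_min gd pd pard.
split; first by split=> [|n /mp/pard]; first exact/mp.
split.
  apply: has_krull_dimP => [//||e /cpar/pard//].
  exists [set x | x \in completion_max m]; apply: local_primeI => x.
  exact: completion_unit mU x.
split.
  apply: has_krull_dimP; first exact: graded_krull_bound tm mU _ _ hC.
    exists [set x | x \in graded_max m]; apply: residue_primeI => f.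
    exact: graded_residue mU f.
  by move=> e /(graded_growth tm mU)[C' hC']; apply: (pmin C') => n _; apply: hC'.
split; first by exists p; split=> [|q /HSp//]; exact/HSp.
split=> [q /HSp->|]; first by rewrite /d prednK // lt0n size_poly_eq0.
pose f : {rmorphism R -> {ideal_quot (ideal_inf m)}} :=
  \pi_({ideal_quot (ideal_inf m)})%qT.
have infm x : x \in ideal_inf m -> x \in m by move=> /asboolP/(_ 1%N)/pw1.
have fm x : f x = 0 -> x \in m by move=> /pi_eq0/infm.
have [mQ [mQE tQ QU]] := quotient_max (@pi_surj R _) fm tm mU.
(* Both rings have the same numbers of parameters, so [pd] and [pard] serve again for the separated
   quotient. *)
apply: has_gdim_min pd pard => n.
rewrite (gdim_leP n tQ QU) (quotient_params (@pi_surj R _) mQE).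
rewrite -(has_params_inf tm mU) (_ : [set x | _] = ideal_inf m) //.
by apply/seteqP; split=> x /pi_eq0.
Qed.
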